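(* Assume (A1)–(A4) and run Algorithm SC with step sizes $\alpha_{ij,k}=\alpha_{ij,1}/k^{\gamma_{ij}}$ and $\beta_{i,k}=\beta_{i,1}/k$, where (i) $\alpha_{ij,1}=\alpha_{ji,1}>0$ for all $(i,j)\in\mathcal{E}$ and $\beta_{i,1}>0$ for all $i\in\mathcal{V}$; (ii) $1/2<\gamma_{ij}=\gamma_{ji}\le1$ and $\nu_{ij}+\gamma_{ij}\le1$ for all $(i,j)\in\mathcal{E}$. Let $h=\min_{(i,j)\in\mathcal{E}}(\nu_{ij}/2+\gamma_{ij})$, $\mathcal{E}'=\{(i,j)\in\mathcal{E}:\nu_{ij}+\gamma_{ij}=1\}$, $\underline\beta=\min_{i\in\mathcal{V}}\beta_{i,1}$, $m'=\min_{(i,j)\in\mathcal{E}'}\alpha_{ij,1}e^{-\|\theta\|_1/b_{ij}}/b_{ij}$ (when $\mathcal{E}'\neq\varnothing$), and $a=\delta\underline\beta/N$ if $\mathcal{E}'=\varnothing$, and $a=\dfrac{\delta\lambda_2(\mathcal{L})\underline\beta\, m'}{2Nn\bar H^2\underline\beta+N\lambda_2(\mathcal{L})m'}$ if $\mathcal{E}'\neq\varnothing$. Then for every $i\in\mathcal{V}$, almost surely, $\tilde\theta_{i,k}=O(k^{-a})$ if $2h-2a>1$; $\tilde\theta_{i,k}=O(\ln k/k^{h-1/2})$ if $2h-2a=1$; $\tilde\theta_{i,k}=O(\sqrt{\ln k}/k^{h-1/2})$ if $2h-2a<1$.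
   Context: Network: undirected weighted graph with sensor set $\mathcal{V}=\{1,\dots,N\}$, symmetric nonnegative weights $a_{ij}=a_{ji}$, with $a_{ij}>0$ iff $(i,j)\in\mathcal{E}$; the edge set $\mathcal{E}$ is regarded as a set of ordered pairs that is symmetric ($(i,j)\in\mathcal{E}\iff(j,i)\in\mathcal{E}$), $M=|\mathcal{E}|/2$ is the number of undirected edges, and $\mathcal{N}_i=\{j:(i,j)\in\mathcal{E}\}$. The Laplacian is $\mathcal{L}=\mathcal{D}-\mathcal{A}$ with $\mathcal{A}=(a_{ij})$, $\mathcal{D}=\mathrm{diag}(\sum_{j\in\mathcal{N}_i}a_{ij})$; $\lambda_2(\mathcal{L})$ is its second smallest eigenvalue. Observations: unknown $\theta\in\mathbb{R}^n$; sensor $i$ observes $y_{i,k}=H_{i,k}\theta+w_{i,k}$, $k\ge1$, with deterministic $H_{i,k}\in\mathbb{R}^{m_i\times n}$ and noise $w_{i,k}\in\mathbb{R}^{m_i}$. Let $d_{i,k}$ ($i\in\mathcal{V},k\ge1$) be the dithering noises used below, $\mathcal{F}_k=\sigma(w_{i,t},d_{i,t}: i\in\mathcal{V},1\le t\le k)$ and $\mathcal{F}^w_k=\sigma(w_{i,t}: i\in\mathcal{V},1\le t\le k)$. Assumptions. (A1) There is $\bar H>0$ with $\|H_{i,k}\|\le\bar H$ for all $i,k$, and there are a positive integer $p$ and $\delta>0$ with $\frac1p\sum_{t=k}^{k+p-1}\sum_{i=1}^N H_{i,t}^\top H_{i,t}\ge\delta I_n$ for all $k\ge1$. (A2) $\{w_{i,k},\mathcal{F}_k\}$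 is a martingale difference sequence and $\sup_{i,k}\mathbb{E}[\|w_{i,k}\|^\rho\mid\mathcal{F}^w_{k-1}]<\infty$ a.s. for some $\rho>2$. (A3) The graph is connected, i.e. $\mathrm{rank}(\mathcal{L})=N-1$. (A4) The $d_{i,k}$ are i.i.d. with the Laplace distribution $\mathrm{Lap}(0,1)$ (density $f(x)=\frac12e^{-|x|}$, distribution function $F$), mutually independent over all $(i,k)$, and independent of all $w_{j,t}$. Algorithm SC. Inputs: deterministic initial estimates $\hat\theta_{i,0}\in\mathbb{R}^n$; event-triggered coefficients $\nu_{ij}=\nu_{ji}\ge0$; noise coefficients $b_{ij}=b_{ji}>0$; step sizes $\alpha_{ij,k}=\alpha_{ji,k}>0$ ($(i,j)\in\mathcal{E}$) and $\beta_{i,k}>0$. For $k=1,2,\dots$: let $\varphi_k\in\mathbb{R}^n$ be the $l$-th standard basis vector, where $k=nq+l$ with $q\in\mathbb{N}\cup\{0\}$, $l\in\{1,\dots,n\}$; set $x_{i,k}=\varphi_k^\top\hat\theta_{i,k-1}$; set $C_{ij,k}=\nu_{ij}b_{ij}\ln k$; set $s_{ij,k}=1$ if $x_{i,k}+b_{ij}d_{i,k}>0$ and $s_{ij,k}=-1$ otherwise. Sensor $i$ sends the one-bit message $s_{ij,k}$ to neighbor $j$ iff $|x_{i,k}+b_{ij}d_{i,k}|>C_{ij,k}$; sensor $i$ sets $\hat s_{ji,k}=s_{ji,k}$ if it received $s_{ji,k}$ from $j$, and $\hat s_{ji,k}=0$ otherwise. With $G_{ij,k}(x)=F((x-C_{ij,k})/b_{ij})-F((-x-C_{ij,k})/b_{ij})$,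 update $\check\theta_{i,k}=\hat\theta_{i,k-1}+\varphi_k\sum_{j\in\mathcal{N}_i}\alpha_{ij,k}a_{ij}(\hat s_{ji,k}-G_{ij,k}(x_{i,k}))$, $\hat\theta_{i,k}=\check\theta_{i,k}+\beta_{i,k}H_{i,k}^\top(y_{i,k}-H_{i,k}\hat\theta_{i,k-1})$. Write $\tilde\theta_{i,k}=\hat\theta_{i,k}-\theta$. Here $\|\theta\|_1$ is the $\ell_1$ norm, and for random vectors $X_k$ and positive numbers $r_k$, ''$X_k=O(r_k)$ a.s.'' means $\sup_k\|X_k\|/r_k<\infty$ almost surely. *)

(* Defs.v *)
From HB Require Import structures.
From mathcomp Require Import all_boot all_order all_algebra.
From mathcomp Require Import all_classical all_reals all_analysis measurable_realfun.
Set Implicit Arguments. Unset Strict Implicit. Unset Printing Implicit Defensive.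
Import Order.TTheory GRing.Theory Num.Theory.
Import numFieldNormedType.Exports.
Local Open Scope classical_set_scope.
Local Open Scope ring_scope.

Definition enorm {R : realType} {m : nat} (v : 'cV[R]_m) : R :=
  Num.sqrt (\sum_(l < m) v l 0 ^+ 2).

Definition l1norm {R : realType} {m : nat} (v : 'cV[R]_m) : R :=
  \sum_(l < m) `|v l 0|.

Definition loewner_ge {R : realType} {n : nat} (A B : 'M[R]_n) : Prop :=
  forall x : 'cV[R]_n, 0 <= (x^T *m (A - B) *m x) 0 0.

Definition opnorm_le {R : realType} {p q : nat} (M : 'M[R]_(p, q)) (c : R) : Prop :=
  forall x : 'cV[R]_q, enorm (M *m x) <= c * enorm x.

Definition laplacian {R : realType} {N : nat} (aw : 'I_N -> 'I_N -> R) : 'M[R]_N :=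
  \matrix_(i, j) ((i == j)%:R * (\sum_(l < N | 0 < aw i l) aw i l) - aw i j).

Definition sorted_eigenvalues {R : realType} {N : nat} (M : 'M[R]_N) (s : seq R) : Prop :=
  sorted <=%R s /\ char_poly M = \prod_(x <- s) ('X - x%:P).

(* second smallest eigenvalue (for a real symmetric matrix, whose characteristic
   polynomial splits over R) *)
Definition lambda2 {R : realType} {N : nat} (M : 'M[R]_N) : R :=
  xget 0 [set x | exists s, sorted_eigenvalues M s /\ x = s`_1].

Definition lap_density {R : realType} (x : R) : R := expR (- `|x|) / 2.

Definition lapF {R : realType} (x : R) : R :=
  if x < 0 then expR x / 2 else 1 - expR (- x) / 2.

(* Algorithm SC (run pathwise, for one realization of the noises)      *)
Section AlgorithmSC.
Variables (R : realType) (N n : nat) (m : 'I_N -> nat).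
Variable aw : 'I_N -> 'I_N -> R.
Variables (nu b : 'I_N -> 'I_N -> R).
Variable alpha : 'I_N -> 'I_N -> nat -> R.
Variable beta : 'I_N -> nat -> R.
Variable H : forall i : 'I_N, nat -> 'M[R]_(m i, n).
Variable theta : 'cV[R]_n.
Variable theta0 : 'I_N -> 'cV[R]_n.
Variable w : forall i : 'I_N, nat -> 'cV[R]_(m i).
Variable dn : 'I_N -> nat -> R.

(* phi_k = l-th standard basis vector, k = n q + l, 1 <= l <= n *)
Definition phi (k : nat) : 'cV[R]_n :=
  \col_(l < n) ((nat_of_ord l == (k.-1 %% n)%N)%:R).

Definition yobs (i : 'I_N) (k : nat) : 'cV[R]_(m i) := H i k *m theta + w i k.

Definition xval (est : 'I_N -> 'cV[R]_n) (k : nat) (i : 'I_N) : R :=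
  ((phi k)^T *m est i) 0 0.

Definition Cthr (i j : 'I_N) (k : nat) : R := nu i j * b i j * ln k%:R.

Definition sbit (est : 'I_N -> 'cV[R]_n) (i j : 'I_N) (k : nat) : R :=
  if 0 < xval est k i + b i j * dn i k then 1 else -1.

(* \hat s_{ji,k}: what sensor i holds from neighbor j *)
Definition shat (est : 'I_N -> 'cV[R]_n) (j i : 'I_N) (k : nat) : R :=
  if Cthr j i k < `|xval est k j + b j i * dn j k| then sbit est j i k else 0.

Definition Gfun (i j : 'I_N) (k : nat) (x : R) : R :=
  lapF ((x - Cthr i j k) / b i j) - lapF ((- x - Cthr i j k) / b i j).

Definition SC_step (k : nat) (est : 'I_N -> 'cV[R]_n) (i : 'I_N) : 'cV[R]_n :=
  let x := xval est k i in
  let check := est i +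
    (\sum_(j < N | 0 < aw i j) alpha i j k * aw i j * (shat est j i k - Gfun i j k x))
      *: phi k in
  check + beta i k *: ((H i k)^T *m (yobs i k - H i k *m est i)).

Fixpoint SC_est (k : nat) : 'I_N -> 'cV[R]_n :=
  match k with
  | 0 => theta0
  | k'.+1 => SC_step k'.+1 (SC_est k')
  end.

End AlgorithmSC.

Section Proba.
Context {R : realType} {d : measure_display} {T : measurableType d}.
Local Open Scope ereal_scope.

Definition sigma_of {C : Type} (D : set C) (X : C -> T -> R) : set (set T) :=
  <<s [set A | exists c B, D c /\ measurable B /\ A = X c @^-1` B] >>.

Definition mutually_independent {I : eqType} (P : probability T R)
    (G : I -> set (set T)) : Prop :=
  forall (s : seq I) (A : I -> set T), uniq s ->
    (forall i, i \in s -> G i (A i)) ->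
    P (\bigcap_(i in [set` s]) A i) = \big[*%E/1%E]_(i <- s) P (A i).

Definition cond_exp_nonneg (P : probability T R) (G : set (set T))
    (X : T -> \bar R) (Z : T -> \bar R) : Prop :=
  (forall t, 0 <= Z t) /\
  (forall B : set (\bar R), measurable B -> G (Z @^-1` B)) /\
  (forall A, G A -> \int[P]_(t in A) Z t = \int[P]_(t in A) X t).

End Proba.

Section Filtrations.
Context {R : realType} {d : measure_display} {T : measurableType d}.
Context {N : nat} {m : 'I_N -> nat}.
Variable w : forall i : 'I_N, nat -> T -> 'cV[R]_(m i).
Variable dn : 'I_N -> nat -> T -> R.

Definition wcoord (c : {i : 'I_N & 'I_(m i)} * nat) (t : T) : R :=
  w (projT1 c.1) c.2 t (projT2 c.1) 0.

Definition wdcoord (c : ({i : 'I_N & 'I_(m i)} * nat) + ('I_N * nat)) (t : T) : R :=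
  match c with inl c' => wcoord c' t | inr c' => dn c'.1 c'.2 t end.

Definition Fw (k : nat) : set (set T) :=
  sigma_of [set c | (1 <= c.2 <= k)%N] wcoord.

Definition Fwd (k : nat) : set (set T) :=
  sigma_of [set c | match c with
                    | inl c' => (1 <= c'.2 <= k)%N
                    | inr c' => (1 <= c'.2 <= k)%N end] wdcoord.

Definition Fw_all : set (set T) := sigma_of [set c | (1 <= c.2)%N] wcoord.

(* sigma(d_{i,k}) (trivial sigma-algebra for the unused index k = 0) *)
Definition Fd (i : 'I_N) (k : nat) : set (set T) :=
  sigma_of [set _ : unit | (0 < k)%N] (fun _ => dn i k).

End Filtrations.

(* Main.v *)
(** Let [e_k] be the matrix of estimation errors, one row per sensor. One step of
    the algorithm is [e_(k+1) = e_k + f_k(e_k) + noise], where the noise is a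
    martingale difference and, because the quantized channel [G] is increasing
    with slope at least [k^(-nu) exp(-|x|/b) / b],
    [<e, f_k(e)> <= - (beta/k) sum_i |H_i e_i|^2 - c_k sum_ij (a_ij/2) (phi.(e_i - e_j))^2].
    Excitation and the cyclic choice of [phi] give coercivity of these two forms only
    after averaging over a window of times. Subtracting from [|e|^2] linearly weighted
    sums of the forms over the next window turns the averaging into a telescoping
    term and yields a quadratic Lyapunov function [U_k] that contracts by
    [1 - 2a/k + O(k^(-1-s))] at every step; the rate [a] comes from splitting [e] into
    its mean over the sensors and the deviations, the latter being controlled
    by the spectral gap of the Laplacian.

    A message is sent with conditional probability [O(k^(-nu))], so the gain times the
    noise variance is [O(k^(-2h))]. A Robbins-Siegmund type argument for [(om_k U_k)^r],
    [1 < r <= min(2, rho/2)], with [om_k] equal to [k^(2a)], [k^(2h-1)/(ln k)^2]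
    or [k^(2h-1)/ln k], gives the three rates. Since the slope of [G] and the sending
    probability depend on the current state, the argument is run three times: to
    bound the errors, to make them decay like some power of [k], and finally, with the
    limiting slope [exp(-|theta|_1/b)/b], to get the sharp rate. *)
Require Import Defs.
From HB Require Import structures.
From mathcomp Require Import all_boot all_order all_algebra.
From mathcomp Require Import all_classical all_reals all_analysis measurable_realfun.
From mathcomp Require Import ring lra.
From mathcomp Require complex spectral sesquilinear.
Import Order.TTheory GRing.Theory Num.Theory.
Import numFieldNormedType.Exports.
Local Open Scope classical_set_scope.
Local Open Scope ring_scope.
Set Implicit Arguments. Unset Strict Implicit. Unset Printing Implicit Defensive.

Section LaplaceDistribution.
Variable R : realType.
Implicit Types u v x y c K : R.
Local Notation mu := (@lebesgue_measure R).

Lemma lapF_ge0 u : 0 <= lapF u.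
Proof.
rewrite /lapF; case: ltP => u0; first by rewrite divr_ge0 ?expR_ge0.
have : expR (- u) <= 1 by rewrite -expR0 ler_expR; lra.
lra.
Qed.

Lemma lapF_le1 u : lapF u <= 1.
Proof.
rewrite /lapF; case: ltP => u0.
  have : expR u <= 1 by rewrite -expR0 ler_expR; lra.
  lra.
have := expR_ge0 (- u); lra.
Qed.

Lemma lapF_normr_le1 u : `|lapF u| <= 1.
Proof. by rewrite ger0_norm ?lapF_le1 ?lapF_ge0. Qed.

Lemma lapFN u : lapF (- u) = 1 - lapF u.
Proof.
rewrite /lapF oppr_lt0; case: (ltgtP 0 u) => u0; rewrite ?opprK; try lra.
by rewrite -u0 oppr0 expR0; lra.
Qed.

Lemma lapF_le_expR u : lapF u <= expR u / 2.
Proof.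
rewrite /lapF; case: ltP => // _.
have expRKN : expR u * expR (- u) = 1 by rewrite -expRD subrr expR0.
have := mulr_ge0 (expR_ge0 (- u)) (sqr_ge0 (expR u - 1)).
have -> : expR (- u) * (expR u - 1) ^+ 2 =
    expR u * expR (- u) * expR u - 2 * (expR u * expR (- u)) + expR (- u) by ring.
rewrite expRKN; lra.
Qed.

Lemma lapF_ge0E u : 0 <= u -> lapF u = 1 - expR (- u) / 2.
Proof. by move=> u0; rewrite /lapF ltNge u0. Qed.

Lemma sym_interval_ind (S : R -> R -> Prop) :
    (forall v u, 0 <= v -> v <= u -> S v u) ->
    (forall v u, S v u -> S (- u) (- v)) ->
    (forall v u, v <= 0 -> 0 <= u -> S v 0 -> S 0 u -> S v u) ->
  forall v u, v <= u -> S v u.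
Proof.
move=> S_pos S_opp S_join.
have S_neg v u : u <= 0 -> v <= u -> S v u.
  move=> u0 vu; rewrite -(opprK u) -(opprK v); apply: S_opp; apply: S_pos; lra.
move=> v u vu; have [v0|v0] := leP 0 v; first exact: S_pos.
have [u0|u0] := leP u 0; first exact: S_neg.
by apply: S_join; [exact: ltW|exact: ltW|exact/S_neg/ltW|exact/S_pos/ltW].
Qed.

Lemma lapF_increment_ge K u v : v <= u -> `|u| <= K -> `|v| <= K ->
  expR (- K) / 2 * (u - v) <= lapF u - lapF v.
Proof.
move: v u; apply: sym_interval_ind => [v u v0 vu uK vK|v u IH|v u v0 u0 IHv IHu uK vK].
- rewrite !lapF_ge0E ?(le_trans v0)//.
  have expKu : expR (- K) <= expR (- u).
    by rewrite ler_expR lerN2 (le_trans _ uK)// ler_norm.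
  have tangent : 1 + (u - v) <= expR (u - v) by exact: expR_ge1Dx.
  have -> : expR (- v) = expR (- u) * expR (u - v) by rewrite -expRD; congr expR; lra.
  have := expR_gt0 (- K); nra.
- by rewrite !normrN => vK uK; rewrite !lapFN; have := IH uK vK; lra.
- have K0 : `|0 : R| <= K by rewrite normr0 (le_trans _ uK).
  by have := IHv K0 vK; have := IHu uK K0; lra.
Qed.

Lemma lapF_increment_le u v : v <= u -> lapF u - lapF v <= (u - v) / 2.
Proof.
move: v u; apply: sym_interval_ind => [v u v0 vu|v u|v u _ _]; [|rewrite !lapFN; lra|lra].
rewrite !lapF_ge0E ?(le_trans v0)//.
have -> : expR (- u) = expR (- v) * expR (- (u - v)) by rewrite -expRD; congr expR; lra.
have tangent : 1 - (u - v) <= expR (- (u - v)) by exact: expR_ge1Dx.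
have : expR (- v) <= 1 by rewrite -expR0 ler_expR; lra.
have := expR_ge0 (- v); nra.
Qed.

Lemma lapF_nondecreasing u v : v <= u -> lapF v <= lapF u.
Proof.
move=> vu; rewrite -subr_ge0.
have := @lapF_increment_ge (Num.max `|u| `|v|) u v vu.
rewrite !le_max !lexx orbT => /(_ isT isT); apply: le_trans.
by rewrite mulr_ge0 ?divr_ge0 ?expR_ge0 ?subr_ge0.
Qed.

Lemma lapF_lipschitz u v : `|lapF u - lapF v| <= `|u - v| / 2.
Proof.
wlog vu : u v / v <= u.
  move=> le_case; have [|/ltW] := leP v u; first exact: le_case.
  by rewrite distrC (distrC u); exact: le_case.
rewrite ger0_norm ?subr_ge0 ?lapF_nondecreasing// ger0_norm ?subr_ge0//.
exact: lapF_increment_le.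
Qed.

Lemma measurable_lapF : measurable_fun setT (@lapF R).
Proof.
apply: measurable_fun_ifT => //.
- exact: measurable_fun_ltr.
- by apply: measurable_funM => //; exact: measurable_expR.
- apply: measurable_funB => //; apply: measurable_funM => //.
  exact: (measurableT_comp (@measurable_expR R)).
Qed.

Lemma continuous_lap_density : continuous (@lap_density R).
Proof.
move=> x; apply: cvgM; last exact: cvg_cst.
apply: continuous_comp; last exact: continuous_expR.
by apply: cvgN; exact: norm_continuous.
Qed.

Lemma lap_density_ge0 x : 0 <= lap_density x.
Proof. by rewrite divr_ge0// expR_ge0. Qed.

Lemma measurable_lap_density (D : set R) : measurable_fun D (EFin \o @lap_density R).
Proof.
apply/measurable_EFinP; apply: measurable_funTS.
exact: continuous_measurable_fun continuous_lap_density.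
Qed.

Lemma is_derive_Nexp_half x :
  is_derive x (1 : R) (fun x : R => - (expR (- x) / 2)) (expR (- x) / 2).
Proof.
have derive_expRN : is_derive x (1 : R) (fun x : R => expR (- x)) (- expR (- x)).
  by apply: is_derive_eq; rewrite mulrN1.
have := @is_deriveZ _ _ _ _ (- 2^-1) x (1 : R) _ derive_expRN.
rewrite /GRing.scale/=; congr is_derive; last by rewrite mulrNN mulrC.
by apply/funext => y /=; rewrite /GRing.scale/= mulNr mulrC.
Qed.

Lemma is_derive_exp_half x : is_derive x (1 : R) (fun x : R => expR x / 2) (expR x / 2).
Proof.
have := @is_deriveZ _ _ _ _ (2^-1) x (1 : R) _ (is_derive_expR x).
rewrite /GRing.scale/=; congr is_derive; last by rewrite mulrC.
by apply/funext => y /=; rewrite /GRing.scale/= mulrC.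
Qed.

Lemma integral_lap_density_right c : 0 <= c ->
  (\int[mu]_(x in `]c, +oo[) (lap_density x)%:E = (expR (- c) / 2)%:E)%E.
Proof.
move=> c0; rewrite integral_itv_obnd_cbnd; last exact: measurable_lap_density.
rewrite (@ge0_continuous_FTC2y _ (@lap_density R) (fun x => - (expR (- x) / 2)) c 0).
- by rewrite -EFinB sub0r opprK.
- by move=> x _; exact: lap_density_ge0.
- exact: continuous_subspaceT continuous_lap_density.
- rewrite -oppr0 -(mul0r 2^-1); apply: cvgN; apply: cvgM; last exact: cvg_cst.
  exact: cvgr_expR.
- by move=> x _; have [] := is_derive_Nexp_half x.
- apply: cvg_at_right_filter; apply: cvgN; apply: cvgM; last exact: cvg_cst.
  by apply: continuous_comp; [exact: opp_continuous|exact: continuous_expR].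
- move=> x; rewrite in_itv /= andbT => cx; rewrite derive1E.
  have [_ ->] := is_derive_Nexp_half x.
  by rewrite /lap_density ger0_norm// (le_trans c0)// ltW.
Qed.

Lemma integral_lap_density_left c : c < 0 ->
  (\int[mu]_(x in `]c, 0%R]) (lap_density x)%:E = (2^-1 - expR c / 2)%:E)%E.
Proof.
move=> c0; rewrite integral_itv_obnd_cbnd; last exact: measurable_lap_density.
have continuous_exp_half : continuous (fun x : R => expR x / 2).
  by move=> x; apply: cvgM; [exact: continuous_expR|exact: cvg_cst].
rewrite (@continuous_FTC2 _ (@lap_density R) (fun x => expR x / 2) c 0)//.
- by rewrite -EFinB expR0 mul1r.
- exact: continuous_subspaceT continuous_lap_density.
- split.
  + by move=> x _; have [] := is_derive_exp_half x.
  + by apply: cvg_at_right_filter; exact: continuous_exp_half.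
  + by apply: cvg_at_left_filter; exact: continuous_exp_half.
- move=> x; rewrite in_itv /= => /andP[_ x0]; rewrite derive1E.
  have [_ ->] := is_derive_exp_half x.
  by rewrite /lap_density ltr0_norm// opprK.
Qed.

Lemma integral_lap_density_gt c :
  (\int[mu]_(x in `]c, +oo[) (lap_density x)%:E = (lapF (- c))%:E)%E.
Proof.
have [c0|c0] := leP 0 c.
  rewrite integral_lap_density_right//; congr EFin.
  by rewrite lapFN lapF_ge0E//; lra.
have -> : `]c, +oo[%classic = `]c, 0%R] `|` `]0%R, +oo[ :> set R.
  by rewrite -itv_bndbnd_setU// bnd_simp// ltW.
rewrite ge0_integral_setU//=; last 3 first.
- exact: measurable_lap_density.
- by move=> x _; rewrite lee_fin lap_density_ge0.
- apply: lt_disjoint => x y; rewrite !in_itv/= andbT => /andP[_ x0]; exact: le_lt_trans.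
rewrite integral_lap_density_right// integral_lap_density_left// -EFinD; congr EFin.
by rewrite lapF_ge0E ?oppr_ge0 ?ltW// oppr0 expR0 opprK; lra.
Qed.

End LaplaceDistribution.

Section SymmetricSpectrum.
Import complex mxpoly spectral sesquilinear.
Variables (R : realType) (N : nat).
Local Notation toC := (real_complex R).
Local Notation "A ^C" := (map_mx toC A) : ring_scope.

Lemma char_poly_similar (F : fieldType) (A B P : 'M[F]_N) :
  P \in unitmx -> P *m A = B *m P -> char_poly A = char_poly B.
Proof.
move=> P_unit PA; rewrite /char_poly.
have detP_neq0 : \det (map_mx (@polyC F) P) != 0.
  by rewrite det_map_mx polyC_eq0 -unitfE -unitmxE.
apply: (mulfI detP_neq0); rewrite -det_mulmx [RHS]mulrC -det_mulmx; congr (\det _).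
rewrite /char_poly_mx mulmxBr mulmxBl -!map_mxM PA; congr (_ - _).
by rewrite mul_mx_scalar mul_scalar_mx.
Qed.

Lemma symmetric_diagonalizable (M : 'M[R]_N) : M^T = M ->
  exists (P : 'M[R[i]]_N) (d : 'I_N -> R),
    P \is unitarymx /\ P *m M^C = diag_mx (\row_i toC (d i)) *m P.
Proof.
move=> M_sym.
have MC_real : M^C \is a mxOver Num.real.
  by apply/mxOverP => i j; rewrite mxE; apply/complex_realP; exists (M i j).
have MC_herm : M^C \is hermsymmx.
  apply: realsym_hermsym => //; apply/is_hermitianmxP.
  by rewrite expr0 scale1r map_mx_id// map_trmx M_sym.
have /orthomx_spectralP MCE := hermitian_normalmx MC_herm.
have /mxOverP spectrum_real := hermitian_spectral_diag_real MC_herm.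
have := spectral_unitarymx M^C.
move: (spectralmx _) (spectral_diag _) spectrum_real MCE => P sp sp_real MCE P_unitary.
exists P, (fun i => complex.Re (sp 0 i)); split; first exact: P_unitary.
have P_unit := unitarymx_unit P_unitary.
rewrite MCE !mulmxA mulmxV// mul1mx; congr (diag_mx _ *m _).
by apply/rowP => i; rewrite mxE RRe_real.
Qed.

Section Diagonalization.
Variables (M : 'M[R]_N) (P : 'M[R[i]]_N) (d : 'I_N -> R).
Hypothesis P_unitary : P \is unitarymx.
Hypothesis PM : P *m M^C = diag_mx (\row_i toC (d i)) *m P.

Lemma char_poly_diagonalized : char_poly M = \prod_i ('X - (d i)%:P).
Proof.
apply: (map_poly_inj toC); rewrite map_char_poly rmorph_prod/=.
rewrite (char_poly_similar (unitarymx_unit P_unitary) PM).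
rewrite char_poly_trig ?diag_mx_is_trig//; apply: eq_bigr => i _.
by rewrite rmorphB/= map_polyX map_polyC/= !mxE eqxx mulr1n.
Qed.

Lemma row_diagonalized i : row i P *m M^C = toC (d i) *: row i P.
Proof.
rewrite -row_mul PM; apply/rowP => j; rewrite !mxE (bigD1 i)//= !mxE eqxx mulr1n.
by rewrite big1 ?addr0// => l /negPf li; rewrite !mxE eq_sym li mulr0n mul0r.
Qed.

Lemma row_orthonormal i j : \sum_l P i l * Num.conj (P j l) = (i == j)%:R.
Proof.
have /unitarymxP/matrixP/(_ i j) := P_unitary.
by rewrite !mxE => <-; apply: eq_bigr => l _; rewrite !mxE.
Qed.

Let tr_realC (x : 'cV[R]_N) : (x^C)^t*%sesqui = (x^T)^C.
Proof.
apply/matrixP => i j; rewrite !mxE/=; apply: CrealP.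
by apply/complex_realP; exists (x j i).
Qed.

Lemma sqr_norm_diagonalized (x : 'cV[R]_N) :
  toC (\sum_l x l 0 ^+ 2) = \sum_i `|(P *m x^C) i 0| ^+ 2.
Proof.
transitivity (((x^C)^t*%sesqui *m x^C) 0 0).
  rewrite tr_realC -map_mxM !mxE; congr toC; apply: eq_bigr => l _.
  by rewrite !mxE expr2.
transitivity (((P *m x^C)^t*%sesqui *m (P *m x^C)) 0 0).
  rewrite trmx_mul map_mxM/= -!mulmxA; congr ((_ *m _) 0 0).
  by rewrite mulmxA -invmx_unitary// mulVmx ?unitarymx_unit// mul1mx.
by rewrite mxE; apply: eq_bigr => i _; rewrite normCK [RHS]mulrC !mxE.
Qed.

Lemma form_diagonalized (x : 'cV[R]_N) :
  toC ((x^T *m M *m x) 0 0) = \sum_i toC (d i) * `|(P *m x^C) i 0| ^+ 2.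
Proof.
have MCE : M^C = invmx P *m diag_mx (\row_i toC (d i)) *m P.
  by rewrite -mulmxA -PM mulKmx ?unitarymx_unit.
transitivity (((x^C)^t*%sesqui *m M^C *m x^C) 0 0).
  by rewrite tr_realC -!map_mxM [RHS]mxE.
transitivity (((P *m x^C)^t*%sesqui *m diag_mx (\row_i toC (d i)) *m (P *m x^C)) 0 0).
  rewrite trmx_mul map_mxM/= -!mulmxA; congr ((_ *m _) 0 0).
  by rewrite [in RHS]mulmxA -invmx_unitary// MCE !mulmxA.
rewrite mxE; apply: eq_bigr => i _; rewrite normCK.
by rewrite mul_mx_diag !mxE -mulrA mulrCA; congr (_ * _); rewrite mulrC.
Qed.

End Diagonalization.

Lemma lambda2E (M : 'M[R]_N) (s : seq R) : sorted_eigenvalues M s -> lambda2 M = s`_1.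
Proof.
move=> [s_sorted charM].
have /(@xgetPex _ 0) : exists x, (fun x => exists s, sorted_eigenvalues M s /\ x = s`_1) x.
  by exists s`_1, s.
rewrite -/(lambda2 M) => -[s' [[s'_sorted charM'] ->]].
by rewrite (sorted_eq le_trans le_anti s'_sorted s_sorted)//; apply: prod_XsubC_eq;
  rewrite -charM -charM'.
Qed.

End SymmetricSpectrum.

Section LaplacianSpectrum.
Import complex mxpoly spectral sesquilinear.
Variables (R : realType) (N : nat) (aw : 'I_N -> 'I_N -> R).
Hypothesis aw_ge0 : forall i j, 0 <= aw i j.
Hypothesis aw_sym : forall i j, aw i j = aw j i.
Local Notation toC := (real_complex R).
Local Notation "A ^C" := (map_mx toC A) : ring_scope.
Local Notation L := (laplacian aw).

Lemma laplacian_sym : L^T = L.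
Proof.
apply/matrixP => i j; rewrite !mxE eq_sym aw_sym; congr (_ - _).
by case: eqP => [->//|_]; rewrite !mul0r.
Qed.

Lemma laplacian_degree i : \sum_(l < N | 0 < aw i l) aw i l = \sum_l aw i l.
Proof.
rewrite big_mkcond; apply: eq_bigr => l _; case: ltP => // aw_le0.
by apply/eqP; rewrite eq_le aw_le0 aw_ge0.
Qed.

Lemma laplacian_form (x : 'cV[R]_N) :
  (x^T *m L *m x) 0 0 = (\sum_i \sum_j aw i j * (x i 0 - x j 0) ^+ 2) / 2.
Proof.
have diag_sum : \sum_j \sum_i (i == j)%:R * (\sum_l aw i l) * (x i 0 * x j 0)
        = \sum_i \sum_j aw i j * x i 0 ^+ 2.
  rewrite exchange_big/=; apply: eq_bigr => i _; rewrite -mulr_suml.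
  set degree := \sum_l aw i l.
  rewrite (bigD1 i)//= eqxx mul1r big1 ?addr0 -?expr2// => j ji.
  by rewrite eq_sym (negPf ji) !mul0r.
have sum_sym : \sum_i \sum_j aw i j * x i 0 ^+ 2 = \sum_i \sum_j aw i j * x j 0 ^+ 2.
  rewrite exchange_big/=; apply: eq_bigr => i _; apply: eq_bigr => j _.
  by rewrite aw_sym.
have sqr_expand : \sum_i \sum_j aw i j * (x i 0 - x j 0) ^+ 2 =
   \sum_i \sum_j aw i j * x i 0 ^+ 2 + \sum_i \sum_j aw i j * x j 0 ^+ 2
   - 2 * \sum_i \sum_j aw i j * (x i 0 * x j 0).
  rewrite mulr_sumr -big_split/= -sumrB; apply: eq_bigr => i _.
  rewrite mulr_sumr -big_split/= -sumrB; apply: eq_bigr => j _; ring.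
have -> : (x^T *m L *m x) 0 0 =
    \sum_j \sum_i (i == j)%:R * (\sum_l aw i l) * (x i 0 * x j 0)
    - \sum_i \sum_j aw i j * (x i 0 * x j 0).
  rewrite mxE [X in _ - X]exchange_big -sumrB/=; apply: eq_bigr => j _.
  rewrite mxE mulr_suml -sumrB; apply: eq_bigr => i _.
  by rewrite !mxE laplacian_degree; ring.
rewrite diag_sum sqr_expand -sum_sym; lra.
Qed.

Lemma laplacian_form_ge0 (x : 'cV[R]_N) : 0 <= (x^T *m L *m x) 0 0.
Proof.
rewrite laplacian_form divr_ge0// sumr_ge0// => i _; rewrite sumr_ge0// => j _.
by rewrite mulr_ge0// sqr_ge0.
Qed.

Lemma const_mul_laplacian : const_mx 1 *m L = 0 :> 'rV_N.
Proof.
apply/rowP => j; rewrite !mxE; under eq_bigr do rewrite !mxE mul1r laplacian_degree.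
rewrite sumrB (bigD1 j)//= eqxx mul1r [X in _ + X - _]big1 ?addr0; last first.
  by move=> i /negPf ->; rewrite mul0r.
by apply/eqP; rewrite subr_eq0; apply/eqP/eq_bigr => i _; rewrite aw_sym.
Qed.

Section Connected.
Hypothesis N_gt1 : (1 < N)%N.
Hypothesis conn : \rank L = N.-1.
Variables (P : 'M[R[i]]_N) (d : 'I_N -> R).
Hypothesis P_unitary : P \is unitarymx.
Hypothesis PL : P *m L^C = diag_mx (\row_i toC (d i)) *m P.

Let const1_neq0 (F : nzRingType) : (const_mx 1 : 'rV[F]_N) != 0.
Proof.
apply/eqP => /rowP/(_ (Ordinal (ltnW N_gt1))).
by rewrite !mxE => /eqP; rewrite oner_eq0.
Qed.

Lemma laplacian_ker (v : 'rV[R[i]]_N) : v *m L^C = 0 -> exists c, v = c *: const_mx 1.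
Proof.
move=> vL; apply/sub_rVP.
have const_ker : ((const_mx 1 : 'rV[R[i]]_N) <= kermx L^C)%MS.
  apply/sub_kermxP; have /(congr1 (map_mx toC)) := const_mul_laplacian.
  by rewrite map_mxM map_mx0 map_const_mx/= rmorph1.
have : (v <= kermx L^C)%MS by apply/sub_kermxP.
move/submx_trans; apply; rewrite -(geq_leqif (mxrank_leqif_sup const_ker)).
rewrite mxrank_ker mxrank_map conn rank_rV const1_neq0.
by rewrite leq_subLR addn1 prednK// ltnW.
Qed.

Lemma laplacian_null_row i : d i = 0 -> exists c, row i P = c *: const_mx 1.
Proof.
by move=> di0; apply: laplacian_ker; rewrite (row_diagonalized PL) di0 rmorph0 scale0r.
Qed.

Lemma laplacian_null_row_neq0 i c : row i P = c *: const_mx 1 -> c != 0.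
Proof.
move=> rowE; apply/eqP => c0; have := row_orthonormal P_unitary i i.
rewrite eqxx big1 => [/eqP|l _]; first by rewrite eq_sym oner_eq0.
by have /rowP/(_ l) := rowE; rewrite c0 scale0r !mxE => ->; rewrite mul0r.
Qed.

Lemma laplacian_null_row_uniq i j : d i = 0 -> d j = 0 -> i = j.
Proof.
move=> /laplacian_null_row[c rowi] /laplacian_null_row[c' rowj].
have c_neq0 := laplacian_null_row_neq0 rowi; have c'_neq0 := laplacian_null_row_neq0 rowj.
apply/eqP; apply: contraT => ij.
have := row_orthonormal P_unitary i j; rewrite (negPf ij)/=.
have -> : \sum_l P i l * Num.conj (P j l) = \sum_(l < N) c * Num.conj c'.
  apply: eq_bigr => l _.
  by have /rowP/(_ l) := rowi; have /rowP/(_ l) := rowj; rewrite !mxE !mulr1 => -> ->.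
move/eqP; rewrite sumr_const card_ord mulrn_eq0 mulf_eq0 conjC_eq0.
by rewrite (negPf c_neq0) (negPf c'_neq0) -leqn0 leqNgt (ltnW N_gt1).
Qed.

Lemma laplacian_spectrum_ge0 i : 0 <= d i.
Proof.
have : eigenvalue L (d i).
  rewrite eigenvalue_root_char (char_poly_diagonalized P_unitary PL).
  by rewrite (bigD1 i)//= rootM root_XsubC eqxx.
case/eigenvalueP => v vL v_neq0.
have v_sqr_gt0 : 0 < (v *m v^T) 0 0.
  rewrite mxE lt_neqAle sumr_ge0 ?andbT; last by move=> l _; rewrite mxE -expr2 sqr_ge0.
  apply: contra v_neq0 => /eqP/esym sum0; apply/eqP/rowP => l.
  have := psumr_eq0P _ sum0 => /(_ _ l isT); rewrite !mxE -expr2 => sqr0.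
  by apply/eqP; rewrite -sqrf_eq0 sqr0// => l' _; rewrite mxE -expr2 sqr_ge0.
by have := laplacian_form_ge0 v^T; rewrite trmxK vL -scalemxAl mxE pmulr_lge0.
Qed.

Lemma laplacian_null_row_exists : exists i, d i = 0.
Proof.
have : eigenvalue L 0.
  apply/eigenvalueP; exists (const_mx 1); first by rewrite const_mul_laplacian scale0r.
  exact: const1_neq0.
rewrite eigenvalue_root_char (char_poly_diagonalized P_unitary PL) /root horner_prod.
by move=> /prodf_eq0[i _]; rewrite hornerXsubC sub0r oppr_eq0 => /eqP di0; exists i.
Qed.

Lemma lambda2_laplacian i0 : d i0 = 0 ->
  0 < lambda2 L /\ forall i, i != i0 -> lambda2 L <= d i.
Proof.
move=> di0; pose others := [seq d i | i <- enum 'I_N & i != i0].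
pose s : seq R := sort <=%R others.
have s_sorted : sorted <=%R s by exact/sort_sorted/le_total.
have perm_s : perm_eq s others by rewrite perm_sort.
have mem_sE x : x \in s -> exists2 i, i != i0 & x = d i.
  by rewrite (perm_mem perm_s) => /mapP[j]; rewrite mem_filter => /andP[ji0 _] ->; exists j.
have d_in_s i : i != i0 -> d i \in s.
  by move=> ii0; rewrite (perm_mem perm_s); apply: map_f; rewrite mem_filter ii0 mem_enum.
have /lambda2E -> : sorted_eigenvalues L (0 :: s).
  split.
    rewrite /= path_min_sorted//; apply/allP => x /mem_sE[i _ ->].
    exact: laplacian_spectrum_ge0.
  rewrite (char_poly_diagonalized P_unitary PL) (bigD1 i0)//= di0 big_cons; congr (_ * _).
  by rewrite (perm_big _ perm_s) big_map big_filter big_enum_cond.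
have [i1 i1i0] : exists i1, i1 != i0.
  apply/existsP; rewrite -negb_forall; apply/negP => /forallP all_i0.
  have := eqP (all_i0 (Ordinal N_gt1)); rewrite -(eqP (all_i0 (Ordinal (ltnW N_gt1)))).
  by move/(congr1 val).
move: mem_sE d_in_s s_sorted; case: (s) => [|x l] mem_lE d_in_l l_sorted.
  by have := d_in_l i1 i1i0.
split => /= [|i /d_in_l]; last first.
  by rewrite inE => /predU1P[->//|]; exact/allP/(order_path_min le_trans).
have [i ii0 ->] := mem_lE x (mem_head _ _); rewrite lt_neqAle laplacian_spectrum_ge0 andbT.
by apply: contra ii0 => /eqP/esym di; apply/eqP/laplacian_null_row_uniq.
Qed.

End Connected.

Lemma laplacian_spectral_gap : (1 < N)%N -> \rank L = N.-1 ->
  0 < lambda2 L /\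
  forall x : 'I_N -> R, \sum_i x i = 0 ->
    lambda2 L * \sum_i x i ^+ 2 <= (\sum_i \sum_j aw i j * (x i - x j) ^+ 2) / 2.
Proof.
move=> N_gt1 conn; have [P [d [P_unitary PL]]] := symmetric_diagonalizable laplacian_sym.
have [i0 di0] := laplacian_null_row_exists N_gt1 P_unitary PL.
have [lambda2_gt0 lambda2_le] := lambda2_laplacian N_gt1 conn P_unitary PL di0.
split => // x sum_x0; pose v : 'cV[R]_N := \col_i x i.
have -> : (\sum_i \sum_j aw i j * (x i - x j) ^+ 2) / 2 = (v^T *m L *m v) 0 0.
  rewrite laplacian_form; congr (_ / _).
  by apply: eq_bigr => i _; apply: eq_bigr => j _; rewrite !mxE.
have -> : \sum_i x i ^+ 2 = \sum_i v i 0 ^+ 2 by apply: eq_bigr => i _; rewrite mxE.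
rewrite -lecR rmorphM/= (sqr_norm_diagonalized P_unitary) (form_diagonalized P_unitary PL).
rewrite mulr_sumr; apply: ler_sum => i _; have [->|ii0] := eqVneq i i0; last first.
  by rewrite ler_wpM2r ?exprn_ge0// lecR lambda2_le.
suff -> : (P *m v^C) i0 0 = 0 by rewrite normr0 expr0n/= !mulr0.
have [c row_const] := laplacian_null_row N_gt1 conn PL di0.
have -> : (P *m v^C) i0 0 = (row i0 P *m v^C) 0 0 by rewrite -row_mul [RHS]mxE.
rewrite row_const -scalemxAl mxE [X in _ * X]mxE.
under eq_bigr do rewrite !mxE mul1r.
by rewrite -rmorph_sum/= sum_x0 rmorph0 mulr0.
Qed.

End LaplacianSpectrum.

Section RealIntegrals.
Context {R : realType} {d : measure_display} {T : measurableType d}.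
Variable P : {measure set T -> \bar R}.
Variable A : set T.
Hypothesis mA : measurable A.
Implicit Types f g : T -> R.
Local Notation rintegrable f := (P.-integrable A (EFin \o f)).

Lemma rintegrableD f g : rintegrable f -> rintegrable g ->
  rintegrable (fun t => f t + g t).
Proof. by move=> fi gi; apply: eq_integrable (integrableD mA fi gi). Qed.

Lemma rintegrableZ c f : rintegrable f -> rintegrable (fun t => c * f t).
Proof. by move=> fi; apply: eq_integrable (integrableZl mA c fi). Qed.

Lemma rintegrableN f : rintegrable f -> rintegrable (fun t => - f t).
Proof. by move=> fi; apply: eq_integrable (integrableN fi). Qed.

Lemma rintegrableB f g : rintegrable f -> rintegrable g ->
  rintegrable (fun t => f t - g t).
Proof. by move=> fi gi; apply: rintegrableD => //; exact: rintegrableN. Qed.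

Lemma rintegrable_sum (I : Type) (s : seq I) (F : I -> T -> R) :
  (forall i, rintegrable (F i)) -> rintegrable (fun t => \sum_(i <- s) F i t).
Proof.
move=> Fi.
apply: eq_integrable (@integrable_sum _ _ _ P A mA _ s xpredT _ (fun i _ => Fi i)) => //.
by move=> t _ /=; rewrite sumEFin.
Qed.

Lemma RintegralN f : rintegrable f -> \int[P]_(t in A) - f t = - \int[P]_(t in A) f t.
Proof.
move=> fi; rewrite -[RHS]mulN1r -RintegralZl//.
by apply: eq_Rintegral => t _; rewrite mulN1r.
Qed.

Lemma Rintegral_sum (I : Type) (s : seq I) (F : I -> T -> R) :
  (forall i, rintegrable (F i)) ->
  \int[P]_(t in A) (\sum_(i <- s) F i t) = \sum_(i <- s) \int[P]_(t in A) F i t.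
Proof.
move=> Fi; elim: s => [|i s IH].
  rewrite big_nil; under eq_Rintegral do rewrite big_nil.
  by rewrite /Rintegral integral0.
rewrite big_cons -IH -RintegralD//; last exact: rintegrable_sum.
by apply: eq_Rintegral => t _; rewrite big_cons.
Qed.

Lemma EFin_Rintegral f : rintegrable f ->
  (\int[P]_(t in A) (f t)%:E = (\int[P]_(t in A) f t)%:E)%E.
Proof. by move=> fi; rewrite /Rintegral fineK//; exact: integrable_fin_num. Qed.

Lemma rintegrable_le f g : measurable_fun A f -> rintegrable g ->
  (forall t, A t -> `|f t| <= g t) -> rintegrable f.
Proof.
move=> mf gi fg; apply: (le_integrable mA _ _ gi); first exact/measurable_EFinP.
move=> t At /=; rewrite lee_fin (le_trans (fg _ At))// ler_norm//.
Qed.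

Lemma rintegrable_bounded_mul (K : R) f g : measurable_fun A f -> rintegrable g ->
  (forall t, A t -> `|f t| <= K) -> rintegrable (fun t => f t * g t).
Proof.
move=> mf gi fK; apply: (@rintegrable_le _ (fun t => K * `|g t|)).
- apply: measurable_funM => //; apply/measurable_EFinP; exact: (measurable_int P).
- by apply: rintegrableZ; exact: (integrable_norm gi).
- by move=> t At; rewrite normrM ler_wpM2r// fK.
Qed.

End RealIntegrals.

Section FiniteMeasureIntegrals.
Context {R : realType} {d : measure_display} {T : measurableType d}.
Variable P : {finite_measure set T -> \bar R}.
Variable A : set T.
Hypothesis mA : measurable A.

Lemma rintegrable_cst (K : R) : P.-integrable A (EFin \o cst K).
Proof.
apply: measurable_bounded_integrable => //; first by rewrite ltey_eq fin_num_measure.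
exact: bounded_cst.
Qed.

Lemma rintegrable_bounded (K : R) (f : T -> R) : measurable_fun A f ->
  (forall t, A t -> `|f t| <= K) -> P.-integrable A (EFin \o f).
Proof. by move=> mf fK; apply: (rintegrable_le mA mf (rintegrable_cst K)). Qed.

End FiniteMeasureIntegrals.

Section GeneratedSigmaAlgebra.
Context {d : measure_display} {T : measurableType d}.
Variable G : set (set T).
Local Notation TG := (g_sigma_algebraType G).

Lemma gsigmaI A B : <<s G >> A -> <<s G >> B -> <<s G >> (A `&` B).
Proof. exact: (@measurableI _ TG). Qed.

Lemma gsigmaU A B : <<s G >> A -> <<s G >> B -> <<s G >> (A `|` B).
Proof. exact: (@measurableU _ TG). Qed.

Lemma gsigmaC A : <<s G >> A -> <<s G >> (~` A).
Proof. exact: (@measurableC _ TG). Qed.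

Lemma gsigmaT : <<s G >> setT.
Proof. exact: (@measurableT _ TG). Qed.

Lemma gsigma_preimage d' (T' : measurableType d') (f : T -> T') (B : set T') :
  measurable_fun [set: TG] f -> measurable B -> <<s G >> (f @^-1` B).
Proof. by move=> mf mB; have := mf measurableT B mB; rewrite setTI. Qed.

Lemma gsigma_measurable_fun d' (T' : measurableType d') (f : T -> T') A :
  <<s G >> `<=` measurable -> measurable_fun [set: TG] f -> measurable_fun A f.
Proof.
move=> G_meas mf; apply: measurable_funTS => _ B mB.
by rewrite setTI; apply: G_meas; exact: gsigma_preimage.
Qed.

Lemma gsigma_sub (F : set (set T)) : <<s G >> `<=` <<s F >> ->
  forall d' (T' : measurableType d') (f : T -> T'),
  measurable_fun [set: TG] f -> measurable_fun [set: g_sigma_algebraType F] f.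
Proof.
by move=> GF d' T' f mf _ B mB; rewrite setTI; apply: GF; exact: gsigma_preimage.
Qed.

End GeneratedSigmaAlgebra.

Lemma measurable_preimage d d' (T : measurableType d) (T' : measurableType d')
    (f : T -> T') (B : set T') :
  measurable_fun setT f -> measurable B -> measurable (f @^-1` B).
Proof. by move=> mf mB; rewrite -[X in measurable X]setTI; exact: mf. Qed.

Section SupermartingaleMaximal.
Context {R : realType} {d : measure_display} {T : measurableType d}.
Variable P : probability T R.
Variable G : nat -> set (set T).
Hypothesis G_meas : forall k, <<s G k >> `<=` measurable.
Hypothesis G_mono : forall k, <<s G k >> `<=` <<s G k.+1 >>.
Variable E : nat -> T -> R.
Hypothesis E_ge0 : forall k t, 0 <= E k t.
Hypothesis E_adapted : forall k, measurable_fun [set: g_sigma_algebraType (G k)] (E k).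
Variable B : nat -> set T.
Hypothesis B_adapted : forall k, <<s G k >> (B k).
Hypothesis E_super : forall k (L : R) A, <<s G k >> A ->
  A `<=` B k -> A `<=` [set t | E k t <= L] ->
  (\int[P]_(t in A) (E k.+1 t)%:E <= \int[P]_(t in A) (E k t)%:E)%E.

Let mE k A : measurable_fun A (EFin \o E k).
Proof. by apply/measurable_EFinP; exact: gsigma_measurable_fun. Qed.

Section Level.
Variables (K L : R).
Hypotheses (K_ge0 : 0 <= K) (KL : K < L).

Let below k : set T := [set t | E k t < L].

Fixpoint stays_below k : set T :=
  match k with
  | 0 => [set t | E 0 t <= K] `&` B 0
  | k'.+1 => stays_below k' `&` (below k'.+1 `&` B k'.+1)
  end.

Fixpoint has_crossed k : set T :=
  match k with
  | 0 => set0
  | k'.+1 => has_crossed k' `|` (stays_below k' `&` ~` below k'.+1)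
  end.

Let below_adapted k : <<s G k >> (below k).
Proof.
have -> : below k = E k @^-1` `]-oo, L[.
  by apply/seteqP; split => t; rewrite /below /= in_itv.
exact: gsigma_preimage.
Qed.

Let stays_below_adapted k : <<s G k >> (stays_below k).
Proof.
elim: k => [|k IH] /=; last by apply: gsigmaI; [exact: G_mono|exact: gsigmaI].
apply: gsigmaI => //.
have -> : [set t | E 0 t <= K] = E 0 @^-1` `]-oo, K].
  by apply/seteqP; split => t; rewrite /= in_itv.
exact: gsigma_preimage.
Qed.

Lemma stays_below_lt k t : stays_below k t -> E k t < L.
Proof. by case: k => [|k] [] // E0; [move=> _; exact: le_lt_trans KL|case]. Qed.

Let mbelow k : measurable (below k). Proof. exact: G_meas. Qed.

Let mstays_below k : measurable (stays_below k). Proof. exact: G_meas. Qed.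

Lemma measurable_has_crossed k : measurable (has_crossed k).
Proof.
elim: k => [|k IH] /=; first exact: measurable0.
by apply: measurableU => //; apply: measurableI => //; apply: measurableC.
Qed.

Let stays_below_super k : (\int[P]_(t in stays_below k) (E k.+1 t)%:E <=
  \int[P]_(t in stays_below k) (E k t)%:E)%E.
Proof.
apply: (@E_super _ L) => //; first by case: k => [|k] t /= [] // _ [].
by move=> t /stays_below_lt /ltW.
Qed.

Lemma has_crossed_le k :
  (L%:E * P (has_crossed k) + \int[P]_(t in stays_below k) (E k t)%:E <= K%:E)%E.
Proof.
have L_gt0 : 0 < L by exact: le_lt_trans KL.
elim: k => [|k IH].
  rewrite [has_crossed 0]/= measure0 mule0 add0e.
  apply: (@le_trans _ _ (\int[P]_(t in stays_below 0) (cst K%:E) t)%E).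
    apply: ge0_le_integral => //.
    - by move=> t _; rewrite lee_fin.
    - exact: mE.
    - by move=> t [].
  by rewrite integral_cst// -[leRHS]mule1 lee_wpmul2l// probability_le1.
apply: le_trans IH => /=; set A := stays_below k; set C := has_crossed k.
set up := A `&` ~` below k.+1; set down := A `&` below k.+1.
have mup : measurable up.
  by apply: measurableI; [exact: mstays_below|exact/measurableC/mbelow].
have mdown : measurable down by apply: measurableI; [exact: mstays_below|exact: mbelow].
apply: (@le_trans _ _ (L%:E * (P C + P up) + \int[P]_(t in down) (E k.+1 t)%:E)%E).
  apply: leeD.
    apply: lee_wpmul2l; first by rewrite lee_fin ltW.
    by apply: measureU2 => //; exact: measurable_has_crossed.
  apply: ge0_subset_integral => //; first exact: (mstays_below k.+1).
  - exact: mE.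
  - by move=> t _; rewrite lee_fin.
  - by move=> t [? []].
rewrite ge0_muleDr// -addeA leeD2l//; apply: le_trans (stays_below_super k).
have -> : stays_below k = up `|` down by rewrite /up /down -setIUr setUC setUv setIT.
rewrite ge0_integral_setU//; last 3 first.
- exact: mE.
- by move=> t _; rewrite lee_fin.
- by rewrite disj_set2E /up /down; apply/eqP; rewrite setIACA setICl setI0.
rewrite leeD2r// -integral_cst//; apply: ge0_le_integral => //.
- by move=> t _; rewrite lee_fin ltW.
- exact: mE.
- by move=> t [_ /= /negP]; rewrite -leNgt lee_fin.
Qed.

Lemma ever_crossed_le : (P (\bigcup_k has_crossed k) <= (K / L)%:E)%E.
Proof.
have L_gt0 : 0 < L by exact: le_lt_trans KL.
have crossed_mono : nondecreasing_seq has_crossed.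
  by apply/nondecreasing_seqP => k; apply/subsetPset => t; left.
have mcrossed := measurable_has_crossed.
have /cvg_lim <-// : P (has_crossed k) @[k --> \oo] --> P (\bigcup_k has_crossed k).
  by apply: nondecreasing_cvg_mu => //; exact: bigcup_measurable.
apply: lime_le.
  apply: ereal_nondecreasing_is_cvgn => i j ij.
  by apply: le_measure; rewrite ?inE//; apply/subsetPset; exact: crossed_mono.
apply: nearW => k; have int_ge0 : (0 <= \int[P]_(t in stays_below k) (E k t)%:E)%E.
  by apply: integral_ge0 => t _; rewrite lee_fin.
rewrite EFinM muleC lee_pdivlMl//.
exact: le_trans (leeDl _ int_ge0) (has_crossed_le k).
Qed.

End Level.

Lemma nonneg_supermartingale_bounded :
  {ae P, forall t, (forall k, B k t) -> exists C : R, forall k, E k t <= C}.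
Proof.
have level_lt (j i : nat) : j%:R < j%:R + 1 + i%:R :> R.
  by rewrite -addrA ltrDl; have : 0 <= i%:R :> R by []; lra.
pose always_crossed (j : nat) :=
  \bigcap_(i : nat) \bigcup_k has_crossed j%:R (j%:R + 1 + i%:R) k.
have mcrossed j i : measurable (\bigcup_k has_crossed j%:R (j%:R + 1 + i%:R) k).
  by apply: bigcup_measurable => k _; exact: measurable_has_crossed.
have malways j : measurable (always_crossed j) by exact: bigcapT_measurable.
have null j : P (always_crossed j) = 0%E.
  apply/eqP; rewrite eq_le measure_ge0 andbT; apply/lee_addgt0Pr => e e0; rewrite add0e.
  pose i := (Num.truncn (j%:R / e)).+1.
  apply: (@le_trans _ _ (j%:R / (j%:R + 1 + i%:R))%:E).
    apply: le_trans (ever_crossed_le (ler0n _ j) (level_lt j i)).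
    by apply: le_measure; rewrite ?inE// => t /(_ i I).
  have : j%:R / e <= i%:R by apply/ltW/truncnS_gt.
  rewrite lee_fin !ler_pdivrMr//.
  by move=> /le_trans; apply; rewrite [leLHS]mulrC ler_pM2l// lerDr addr_ge0.
have : P.-negligible (\bigcup_j always_crossed j).
  by apply: negligible_bigcup => j; exists (always_crossed j); split; [exact: malways|exact: null|].
apply: negligibleS => t; apply: contra_notP => not_crossed Bt.
have [j E0j] : exists j : nat, E 0 t <= j%:R.
  by exists (Num.truncn (E 0 t)).+1; apply/ltW/truncnS_gt.
have [i not_crossed_i] : exists i, ~ (\bigcup_k has_crossed j%:R (j%:R + 1 + i%:R) k) t.
  apply: contrapT => /forallNP crossed; apply: not_crossed; exists j => // i _.
  by apply: contrapT; exact: crossed.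
exists (j%:R + 1 + i%:R) => k; apply/ltW/(stays_below_lt (level_lt j i)).
elim: k => [|k IH] //=; split => //; split => //=.
by apply: contrapT => crossed; apply: not_crossed_i; exists k.+1 => //=; right.
Qed.

End SupermartingaleMaximal.

Section AlmostSupermartingale.
Context {R : realType} {d : measure_display} {T : measurableType d}.
Variable P : probability T R.
Variable G : nat -> set (set T).
Hypothesis G_meas : forall k, <<s G k >> `<=` measurable.
Hypothesis G_mono : forall k, <<s G k >> `<=` <<s G k.+1 >>.
Variable D : nat -> T -> R.
Hypothesis D_ge0 : forall k t, 0 <= D k t.
Hypothesis D_adapted : forall k, measurable_fun [set: g_sigma_algebraType (G k)] (D k).
Variable B : nat -> set T.
Hypothesis B_adapted : forall k, <<s G k >> (B k).
Variables (eps : nat -> R) (M : R).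
Hypothesis eps_ge0 : forall k, 0 <= eps k.
Hypothesis eps_prod : forall k, \prod_(i < k) (1 + eps i) <= M.
Hypothesis D_super : forall k (L : R) A, <<s G k >> A ->
  A `<=` B k -> A `<=` [set t | D k t <= L] ->
  (\int[P]_(t in A) (D k.+1 t + 1)%:E <=
     (1 + eps k)%:E * \int[P]_(t in A) (D k t + 1)%:E)%E.

Let pr k : R := \prod_(i < k) (1 + eps i).
Let E k t : R := (pr k)^-1 * (D k t + 1).

Let pr_gt0 k : 0 < pr k.
Proof. by apply: prodr_gt0 => i _; rewrite ltr_pwDl. Qed.

Let integral_E k A : measurable A ->
  (\int[P]_(t in A) (E k t)%:E = (pr k)^-1%:E * \int[P]_(t in A) (D k t + 1)%:E)%E.
Proof.
move=> mA; rewrite -ge0_integralZl_EFin//.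
- by move=> t _; rewrite lee_fin addr_ge0.
- apply/measurable_EFinP/(gsigma_measurable_fun (@G_meas k)).
  exact: measurable_funD.
- by rewrite invr_ge0 ltW.
Qed.

Let E_super k (L : R) A : <<s G k >> A -> A `<=` B k -> A `<=` [set t | E k t <= L] ->
  (\int[P]_(t in A) (E k.+1 t)%:E <= \int[P]_(t in A) (E k t)%:E)%E.
Proof.
move=> GA AB AL; have mA : measurable A := G_meas GA; rewrite !integral_E//.
have eps1_gt0 : 0 < 1 + eps k by rewrite ltr_pwDl.
apply: (@le_trans _ _ ((pr k.+1)^-1%:E *
    ((1 + eps k)%:E * \int[P]_(t in A) (D k t + 1)%:E))%E).
  apply: lee_wpmul2l; first by rewrite lee_fin invr_ge0 ltW.
  apply: (@D_super _ (L * pr k)) => // t /AL /=; rewrite /E mulrC ler_pdivrMr//.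
  by apply: le_trans; rewrite lerDl.
by rewrite muleA -EFinM /pr big_ord_recr/= invfM mulfVK// gt_eqF.
Qed.

Lemma almost_supermartingale_bounded :
  {ae P, forall t, (forall k, B k t) -> exists C : R, forall k, D k t <= C}.
Proof.
have E_ge0 k t : 0 <= E k t by rewrite mulr_ge0 ?invr_ge0 ?(ltW (pr_gt0 k))// addr_ge0.
have E_adapted k : measurable_fun [set: g_sigma_algebraType (G k)] (E k).
  by apply: measurable_funM => //; exact: measurable_funD.
have := nonneg_supermartingale_bounded G_meas G_mono E_ge0 E_adapted B_adapted E_super.
apply: filterS => t E_bnd /E_bnd[C EC]; exists (C * M) => k.
have := EC k; rewrite /E mulrC ler_pdivrMr// => DC.
apply: (@le_trans _ _ (D k t + 1)); first by rewrite lerDl.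
by apply: (le_trans DC); rewrite ler_wpM2l ?eps_prod// (le_trans (E_ge0 k t)).
Qed.

End AlmostSupermartingale.

Section Staircase.
Variable R : realType.
Implicit Types (y : R) (m n : nat).

Lemma staircase_sum y m n : (0 < m)%N -> 0 <= y -> (Num.truncn (y * m%:R) < n)%N ->
  \sum_(i < n) (i%:R / m%:R : R) * (i%:R / m%:R <= y < i.+1%:R / m%:R)%R%:R =
  (Num.truncn (y * m%:R))%:R / m%:R.
Proof.
move=> m_gt0 y0 qn; have mR_gt0 : 0 < m%:R :> R by rewrite ltr0n.
have stepE (i : nat) : ((i%:R / m%:R : R) <= y < i.+1%:R / m%:R) = (Num.truncn (y * m%:R) == i).
  by rewrite truncn_eq ?mulr_ge0// ler_pdivrMr// ltr_pdivlMr.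
rewrite (bigD1 (Ordinal qn))//= stepE eqxx mulr1 big1 ?addr0// => i ineq.
rewrite stepE; case: eqP => [qi|_]; last by rewrite mulr0.
by case/eqP: ineq; apply: val_inj; rewrite /= qi.
Qed.

Lemma truncn_approx y m : (0 < m)%N -> 0 <= y ->
  `|y - (Num.truncn (y * m%:R))%:R / m%:R| <= m%:R^-1.
Proof.
move=> m_gt0 y0; have mR_gt0 : 0 < m%:R :> R by rewrite ltr0n.
have /andP[lo hi] := truncn_itv (mulr_ge0 y0 (ler0n R m)).
rewrite ger0_norm ?subr_ge0 ?ler_pdivrMr// lerBlDl -(ler_pM2r mR_gt0).
by rewrite mulrDl divfK ?gt_eqF// mulVf ?gt_eqF// natr1 ltW.
Qed.

End Staircase.

Section AdaptedMultiplier.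
Context {R : realType} {d : measure_display} {T : measurableType d}.
Variables (P : probability T R) (G : set (set T)).
Hypothesis G_meas : <<s G >> `<=` measurable.
Variable A : set T.
Hypothesis GA : <<s G >> A.
Local Notation adapted Y := (measurable_fun [set: g_sigma_algebraType G] Y).

Let mA : measurable A. Proof. exact: G_meas. Qed.

Lemma adapted_mul_integrable (Y z : T -> R) (K : R) : adapted Y ->
  P.-integrable A (EFin \o z) -> (forall t, A t -> `|Y t| <= K) ->
  P.-integrable A (EFin \o (fun t => Y t * z t)).
Proof.
move=> mY zi YK; apply: (rintegrable_bounded_mul mA _ zi YK).
exact: (gsigma_measurable_fun G_meas).
Qed.

Section Nonpositive.
Variables (Y z : T -> R) (K : R).
Hypothesis mY : adapted Y.
Hypothesis zi : P.-integrable A (EFin \o z).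
Hypothesis z_le0 : forall C, <<s G >> C -> C `<=` A -> \int[P]_(t in C) z t <= 0.
Hypothesis YK : forall t, A t -> 0 <= Y t <= K.

Let staircase m t : R := (Num.truncn (Y t * m%:R))%:R / m%:R.

Let staircase_mul m : (0 < m)%N ->
  P.-integrable A (EFin \o (fun t => staircase m t * z t)) /\
  \int[P]_(t in A) (staircase m t * z t) <= 0.
Proof.
move=> m_gt0; pose n := (Num.truncn (K * m%:R)).+1.
pose level (i : nat) : set T := Y @^-1` `[i%:R / m%:R, i.+1%:R / m%:R[.
have G_level i : <<s G >> (level i) by apply: gsigma_preimage => //; exact: measurable_itv.
pose F (i : 'I_n) t := i%:R / m%:R * (z \_ (level i)) t.
have staircaseE t : A t -> staircase m t * z t = \sum_(i < n) F i t.
  move=> /YK/andP[Y0 YtK]; rewrite /staircase -(staircase_sum (n := n) m_gt0 Y0); last first.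
    by rewrite ltnS le_truncn// ler_wpM2r.
  rewrite mulr_suml; apply: eq_bigr => i _; rewrite /F -mulrA; congr (_ * _).
  rewrite /patch; case: ifPn => [|].
    by rewrite inE /level /= in_itv /= => ->; rewrite mul1r.
  by rewrite notin_setE /level /= in_itv /= => /negP/negPf ->; rewrite mul0r.
have z_level i : P.-integrable A (EFin \o (z \_ (level i))).
  rewrite -restrict_EFin; apply/integrable_restrict => //; first exact: G_meas.
  by apply: integrableS zi => //; apply: measurableI => //; exact: G_meas.
have Fi i : P.-integrable A (EFin \o F i) by exact: rintegrableZ.
split.
  apply: eq_integrable (rintegrable_sum mA (index_enum 'I_n) Fi) => // t.
  by rewrite inE => At /=; rewrite staircaseE.
rewrite (@eq_Rintegral _ _ _ P A (fun t => \sum_(i < n) F i t)); last first.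
  by move=> t; rewrite inE => /staircaseE.
rewrite Rintegral_sum//; apply: sumr_le0 => i _; rewrite RintegralZl//.
rewrite -Rintegral_mkcondr mulr_ge0_le0 ?divr_ge0//; apply: z_le0; last by move=> t [].
exact: gsigmaI.
Qed.

Lemma integral_mul_le0 : \int[P]_(t in A) (Y t * z t) <= 0.
Proof.
have YKn t : A t -> `|Y t| <= K by move=> /YK /andP[Y0 YtK]; rewrite ger0_norm.
have Yzi := adapted_mul_integrable mY zi YKn.
set S := \int[P]_(t in A) `|z t|; set J := \int[P]_(t in A) (Y t * z t).
have approx m : (0 < m)%N -> J <= m%:R^-1 * S.
  move=> m_gt0; have [stair_int stair_le0] := staircase_mul m_gt0.
  rewrite -[J](subrK (\int[P]_(t in A) (staircase m t * z t))) -[leRHS]addr0 lerD//.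
  rewrite /S -RintegralZl//; last exact: (integrable_norm zi).
  rewrite /J -RintegralB//; apply: le_Rintegral => //; first exact: rintegrableB.
    by apply: rintegrableZ => //; exact: (integrable_norm zi).
  move=> t At; rewrite -mulrBl (le_trans (ler_norm _))// normrM ler_wpM2r//.
  by apply: truncn_approx => //; have /andP[] := YK At.
rewrite leNgt; apply/negP => J_gt0.
have := approx (Num.truncn (S / J)).+1 isT; rewrite leNgt => /negP; apply.
by rewrite mulrC ltr_pdivrMr ?ltr0n// mulrC -ltr_pdivrMr// truncnS_gt.
Qed.

End Nonpositive.

Lemma integral_mul_le (Y f : T -> R) (K v : R) : adapted Y ->
  P.-integrable A (EFin \o f) ->
  (forall C, <<s G >> C -> C `<=` A -> \int[P]_(t in C) f t <= v * fine (P C)) ->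
  (forall t, A t -> 0 <= Y t <= K) ->
  \int[P]_(t in A) (Y t * f t) <= v * \int[P]_(t in A) Y t.
Proof.
move=> mY fi f_le YK; have YKn t : A t -> `|Y t| <= K.
  by move=> /YK /andP[Y0 YtK]; rewrite ger0_norm.
have Yi : P.-integrable A (EFin \o Y).
  by apply: (rintegrable_bounded P mA _ YKn); exact: (gsigma_measurable_fun G_meas).
have vi C : measurable C -> P.-integrable C (EFin \o cst v).
  by move=> mC; exact: (rintegrable_cst P mC).
have : \int[P]_(t in A) (Y t * (f t - v)) <= 0.
  apply: (integral_mul_le0 mY _ _ YK); first exact: rintegrableB (vi _ _).
  move=> C GC CA; have mC : measurable C := G_meas GC.
  by rewrite RintegralB//; [rewrite Rintegral_cst// subr_le0 f_le|exact: integrableS fi|exact: vi].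
under eq_Rintegral do rewrite mulrBr [Y _ * v]mulrC.
rewrite RintegralB//; [|exact: adapted_mul_integrable YKn|exact: rintegrableZ].
by rewrite RintegralZl// subr_le0.
Qed.

(* The bounded multiplier is shifted to be nonnegative, once for [z] and once for [- z]. *)
Lemma integral_mul_eq0 (Y z : T -> R) (K : R) : adapted Y ->
  P.-integrable A (EFin \o z) ->
  (forall C, <<s G >> C -> C `<=` A -> \int[P]_(t in C) z t = 0) ->
  (forall t, A t -> `|Y t| <= K) ->
  \int[P]_(t in A) (Y t * z t) = 0.
Proof.
move=> mY zi z_eq0 YK.
suff mul_le0 (z' : T -> R) : P.-integrable A (EFin \o z') ->
    (forall C, <<s G >> C -> C `<=` A -> \int[P]_(t in C) z' t = 0) ->
    \int[P]_(t in A) (Y t * z' t) <= 0.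
  apply/eqP; rewrite eq_le mul_le0//= -oppr_le0 -RintegralN//; last first.
    exact: adapted_mul_integrable YK.
  under eq_Rintegral do rewrite -mulrN.
  apply: mul_le0 => [|C GC CA]; first exact: rintegrableN.
  have mC : measurable C := G_meas GC.
  by rewrite RintegralN ?z_eq0 ?oppr0//; exact: integrableS zi.
move=> z'i z'_eq0.
have <- : \int[P]_(t in A) ((Y t + K) * z' t) = \int[P]_(t in A) (Y t * z' t).
  under eq_Rintegral do rewrite mulrDl.
  rewrite RintegralD//; [|exact: adapted_mul_integrable YK|exact: rintegrableZ].
  by rewrite RintegralZl// (z'_eq0 A)// mulr0 addr0.
apply: (@integral_mul_le0 _ _ (K + K)) => //; first exact: measurable_funD.
  by move=> C GC CA; rewrite z'_eq0.
by move=> t /YK; rewrite ler_norml => /andP[lo hi]; apply/andP; lra.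
Qed.

End AdaptedMultiplier.

Section Freezing.
Context {R : realType} {d : measure_display} {T : measurableType d}.
Variables (P : probability T R) (G : set (set T)).
Hypothesis G_meas : <<s G >> `<=` measurable.
Local Notation TG := (g_sigma_algebraType G).
Variable Y : T -> R.
Hypothesis mY : measurable_fun setT Y.
Hypothesis Y_indep : forall A (B : set R), <<s G >> A -> measurable B ->
  P (A `&` Y @^-1` B) = (P A * P (Y @^-1` B))%E.

Let idG : T -> TG := fun t => t.

Let midG : measurable_fun setT idG.
Proof. by move=> _ C mC; rewrite setTI; exact: G_meas. Qed.

Let mpair : measurable_fun setT (fun t => (idG t, Y t)).
Proof. exact: measurable_fun_pair. Qed.

Let idG_mfun : {mfun T >-> TG} := HB.pack idG (isMeasurableFun.Build _ _ _ _ _ midG).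
Let Y_mfun : {mfun T >-> R} := HB.pack Y (isMeasurableFun.Build _ _ _ _ _ mY).
Let pair_mfun : {mfun T >-> (TG * R)%type} :=
  HB.pack (fun t => (idG t, Y t)) (isMeasurableFun.Build _ _ _ _ _ mpair).

Lemma freezing (E : set (TG * R)) : measurable E ->
  P [set t | E (t, Y t)] = (\int[P]_t P (Y @^-1` (xsection E t)))%E.
Proof.
move=> mE; transitivity (distribution P pair_mfun E); first by [].
rewrite -(@product_measure_unique _ _ TG R R
  (distribution P idG_mfun) (distribution P Y_mfun) (distribution P pair_mfun) _ E mE).
  by rewrite /product_measure1 ge0_integral_distribution//; exact: measurable_fun_xsection.
by move=> A B mA mB; exact: Y_indep.
Qed.

Lemma freezing_event (X : T -> R) (A : set T) (S : set (R * R)) :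
  measurable_fun [set: TG] X -> <<s G >> A -> measurable S ->
  P (A `&` [set t | S (X t, Y t)]) = (\int[P]_(t in A) P (Y @^-1` (xsection S (X t))))%E.
Proof.
move=> mX GA mS; pose E : set (TG * R) := [set p | A p.1 /\ S (X p.1, p.2)].
have mE : measurable E.
  have -> : E = fst @^-1` A `&` (fun p : TG * R => (X p.1, p.2)) @^-1` S by [].
  apply: measurableI.
    exact: (@measurable_preimage _ _ (TG * R)%type TG fst A measurable_fst GA).
  apply: measurable_preimage mS; apply: measurable_fun_pair => //.
  exact: (measurableT_comp mX measurable_fst).
have := freezing mE; rewrite [X in P X](_ : _ = A `&` [set t | S (X t, Y t)])//.
move=> ->; rewrite [RHS]integral_mkcond; apply: eq_integral => t _; rewrite /patch.
case: ifPn => [|]; rewrite ?inE ?notin_setE => At.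
  by congr (P _); apply/seteqP; split => s /=; rewrite /xsection/= !inE; [case|].
by rewrite (_ : _ @^-1` _ = set0) ?measure0//; apply/seteqP; split => s //=;
  rewrite /xsection /= inE => -[].
Qed.

End Freezing.

Section IndependentIntegral.
Context {R : realType} {d : measure_display} {T : measurableType d}.
Variable P : probability T R.

Lemma ge0_integral_indep (D : set T) (g : T -> \bar R) : measurable D ->
  measurable_fun setT g -> (forall t, (0 <= g t)%E) ->
  (forall B : set (\bar R), measurable B ->
     P (g @^-1` B `&` D) = (P D * P (g @^-1` B))%E) ->
  (\int[P]_(t in D) g t = P D * \int[P]_t g t)%E.
Proof.
move=> mD mg g0 g_indep.
have PD_fin : P D \is a fin_num by exact: fin_num_measure.
pose pD : {nonneg R} := NngNum (fine_ge0 (measure_ge0 P D)).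
have restrict : (\int[P]_(t in D) g t = \int[mrestr P mD]_t g t)%E.
  rewrite [RHS](@ge0_negligible_integral _ _ _ (mrestr P mD) setT (~` D))//.
  - rewrite setTD setCK; apply: eq_measure_integral => A mA AD.
    by rewrite /= /mrestr setIidl.
  - exact: measurableC.
  - by rewrite /= /mrestr setICl measure0.
have push (mu : {measure set T -> \bar R}) :
    (\int[mu]_t g t = \int[pushforward mu g]_y `|y|)%E.
  rewrite (ge0_integral_pushforward mg)// preimage_setT.
  by apply: eq_integral => t _ /=; rewrite gee0_abs.
rewrite restrict !push (eq_measure_integral (mscale pD (pushforward P g))); last first.
  move=> B mB _; rewrite /= /pushforward /mrestr g_indep//.
  by rewrite -[in LHS](fineK PD_fin).
by rewrite ge0_integral_mscale// -[in RHS](fineK PD_fin).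
Qed.

End IndependentIntegral.

Section DensityMeasure.
Context {R : realType} {d : measure_display} {T : measurableType d}.
Variables (P : {measure set T -> \bar R}) (f : T -> \bar R).
Hypothesis mf : measurable_fun setT f.
Hypothesis f_ge0 : forall t, (0 <= f t)%E.

(* The measurability proof is a parameter so that the measure instance can be found. *)
Definition density_measure (_ : measurable_fun setT f) (A : set T) : \bar R :=
  (\int[P]_(t in A) f t)%E.

Let density_measure0 : density_measure mf set0 = 0%E.
Proof. exact: integral_set0. Qed.

Let density_measure_ge0 A : (0 <= density_measure mf A)%E.
Proof. exact: integral_ge0. Qed.

Let density_measure_sigma_additive : semi_sigma_additive (density_measure mf).
Proof.
move=> F mF tF mUF; rewrite /density_measure ge0_integral_bigcup//.
  apply: is_cvg_ereal_nneg_natsum_cond => n _ _; exact: integral_ge0.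
exact: measurable_funTS.
Qed.

HB.instance Definition _ := isMeasure.Build _ _ _ (density_measure mf)
  density_measure0 density_measure_ge0 density_measure_sigma_additive.

End DensityMeasure.

Section PiSystem.
Context {R : realType} {d : measure_display} {T : measurableType d}.
Variables (P : probability T R) (G : set (set T)).
Hypothesis G_meas : G `<=` measurable.
Hypothesis G_T : G setT.
Hypothesis G_I : setI_closed G.

Lemma pi_system_indep (D : set T) : measurable D ->
  (forall A, G A -> P (A `&` D) = (P A * P D)%E) ->
  forall A, <<s G >> A -> P (A `&` D) = (P A * P D)%E.
Proof.
move=> mD G_indep A GA.
have PD_fin : P D \is a fin_num by exact: fin_num_measure.
pose pD : {nonneg R} := NngNum (fine_ge0 (measure_ge0 P D)).
have scaleE X : mscale pD P X = (P X * P D)%E by rewrite muleC -[in RHS](fineK PD_fin).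
rewrite -scaleE; apply: (@g_sigma_algebra_measure_unique _ R T G G_meas (fun=> setT)
  (fun=> G_T) _ (mrestr P mD)) => //.
- by rewrite bigcup_const.
- by move=> X GX; rewrite [RHS]scaleE /= /mrestr G_indep.
- by move=> _; rewrite /= /mrestr setTI ltey_eq PD_fin.
Qed.

Lemma pi_system_integral_eq (f g : T -> \bar R) :
  measurable_fun setT f -> measurable_fun setT g ->
  (forall t, (0 <= f t)%E) -> (forall t, (0 <= g t)%E) ->
  (\int[P]_t f t < +oo)%E ->
  (forall A, G A -> \int[P]_(t in A) f t = \int[P]_(t in A) g t)%E ->
  forall A, <<s G >> A -> (\int[P]_(t in A) f t = \int[P]_(t in A) g t)%E.
Proof.
move=> mf mg f0 g0 f_fin G_eq.
apply: (@g_sigma_algebra_measure_unique _ R T G G_meas (fun=> setT) (fun=> G_T) _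
  (density_measure P mf) (density_measure P mg)) => //.
by rewrite bigcup_const.
Qed.

End PiSystem.

Section OneBitMessage.
Context {R : realType} {d : measure_display} {T : measurableType d}.
Variables (P : probability T R) (G : set (set T)).
Hypothesis G_meas : <<s G >> `<=` measurable.
Local Notation TG := (g_sigma_algebraType G).
Variable Y : T -> R.
Hypothesis mY : measurable_fun setT Y.
Hypothesis Y_indep : forall A (B : set R), <<s G >> A -> measurable B ->
  P (A `&` Y @^-1` B) = (P A * P (Y @^-1` B))%E.
Hypothesis Y_laplace : forall B : set R, measurable B ->
  P (Y @^-1` B) = (\int[lebesgue_measure]_(x in B) (lap_density x)%:E)%E.

Lemma laplace_gt (c : R) : P (Y @^-1` `]c, +oo[) = (lapF (- c))%:E.
Proof. by rewrite Y_laplace// integral_lap_density_gt. Qed.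

Lemma laplace_lt (c : R) : P (Y @^-1` `]-oo, c[) = (lapF c)%:E.
Proof.
have -> : `]-oo, c[%classic = ~` `[c, +oo[%classic :> set R by rewrite setCitvr.
have mc : measurable (Y @^-1` `[c, +oo[) by exact: measurable_preimage.
have laplace_ge : P (Y @^-1` `[c, +oo[) = (lapF (- c))%:E.
  rewrite Y_laplace// -integral_itv_obnd_cbnd; last exact: measurable_lap_density.
  exact: integral_lap_density_gt.
by rewrite preimage_setC probability_setC// [P _]laplace_ge lapFN -EFinB opprB addrC subrK.
Qed.

Variables (X : T -> R) (A : set T) (b C : R).
Hypothesis mX : measurable_fun [set: TG] X.
Hypothesis GA : <<s G >> A.
Hypothesis b_gt0 : 0 < b.
Hypothesis C_ge0 : 0 <= C.

Local Notation dithered := (fun t => X t + b * Y t).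
Local Notation prob_pos := (fun t => lapF ((X t - C) / b)).
Local Notation prob_neg := (fun t => lapF ((- X t - C) / b)).

Let above : set T := [set t | C < dithered t].
Let below : set T := [set t | dithered t < - C].

Let mA : measurable A. Proof. exact: G_meas. Qed.

Let mXT : measurable_fun setT X. Proof. exact: (gsigma_measurable_fun G_meas). Qed.

Let mdithered : measurable_fun setT dithered.
Proof. by apply: measurable_funD => //; apply: measurable_funM. Qed.

Let mabove : measurable above.
Proof.
have -> : above = dithered @^-1` `]C, +oo[.
  by apply/seteqP; split => t; rewrite /above /= in_itv /= andbT.
exact: measurable_preimage.
Qed.

Let mbelow : measurable below.
Proof.
have -> : below = dithered @^-1` `]-oo, - C[.
  by apply/seteqP; split => t; rewrite /below /= in_itv.
exact: measurable_preimage.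
Qed.

Let measurable_halfplane (I : set R) : measurable I ->
  measurable [set p : R * R | I (p.1 + b * p.2)].
Proof.
apply: (@measurable_preimage _ _ _ _ (fun p : R * R => p.1 + b * p.2)).
by apply: measurable_funD => //; apply: measurable_funM.
Qed.

Lemma prob_above : P (A `&` above) = (\int[P]_(t in A) (prob_pos t)%:E)%E.
Proof.
have -> : above = [set t | [set p : R * R | `]C, +oo[%classic (p.1 + b * p.2)] (X t, Y t)].
  by apply/seteqP; split => t; rewrite /above /= in_itv /= andbT.
rewrite (freezing_event G_meas mY Y_indep mX GA); last exact: measurable_halfplane.
apply: eq_integral => t _; rewrite -(opprB C) mulNr -laplace_gt; congr (P (_ @^-1` _)).
apply/seteqP; split => y; rewrite /xsection /= inE /= !in_itv /= !andbT;
  rewrite ltr_pdivrMr// mulrC; lra.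
Qed.

Lemma prob_below : P (A `&` below) = (\int[P]_(t in A) (prob_neg t)%:E)%E.
Proof.
have -> : below = [set t | [set p : R * R | `]-oo, - C[%classic (p.1 + b * p.2)] (X t, Y t)].
  by apply/seteqP; split => t; rewrite /below /= in_itv.
rewrite (freezing_event G_meas mY Y_indep mX GA); last exact: measurable_halfplane.
apply: eq_integral => t _; rewrite -laplace_lt; congr (P (_ @^-1` _)).
apply/seteqP; split => y; rewrite /xsection /= inE /= !in_itv /=;
  rewrite ltr_pdivlMr// mulrC; lra.
Qed.

Definition onebit (z : R) : R := if C < `|z| then (if 0 < z then 1 else -1) else 0.

Lemma onebitE z : onebit z = (C < z)%R%:R - (z < - C)%R%:R.
Proof.
rewrite /onebit real_ltr_normr ?num_real// ltrNr.
case: (ltP C z) => Cz; case: (ltP z (- C)) => zC; case: (ltP 0 z) => z0 //=; try lra.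
all: by have := lt_trans Cz zC; rewrite ltNge (le_trans _ C_ge0)// oppr_le0.
Qed.

Lemma onebit_normr_le1 z : `|onebit z| <= 1.
Proof.
by rewrite /onebit; case: ifP => _; [case: ifP => _|]; rewrite ?normrN ?normr1 ?normr0.
Qed.

Lemma measurable_onebit : measurable_fun setT onebit.
Proof.
apply: measurable_fun_ifT => //; last by apply: measurable_fun_ifT => //; exact: measurable_fun_ltr.
by apply: measurable_fun_ltr => //; exact: normr_measurable.
Qed.

Let onebit_indic t : onebit (dithered t) = \1_above t - \1_below t.
Proof.
rewrite onebitE !indicE; congr (_%:R - _%:R); congr nat_of_bool.
  by apply/idP/idP; rewrite inE.
by apply/idP/idP; rewrite inE.
Qed.

Let mprob (f : T -> R) : measurable_fun setT f ->
  measurable_fun setT (fun t => lapF ((f t - C) / b)).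
Proof.
move=> mf; apply: (measurableT_comp (@measurable_lapF R)).
by apply: measurable_funM => //; exact: measurable_funB.
Qed.

Let prob_int (f : T -> R) : measurable_fun setT f ->
  P.-integrable A (EFin \o (fun t => lapF ((f t - C) / b))).
Proof.
move=> mf; apply: (rintegrable_bounded P mA _ (fun t _ => lapF_normr_le1 _)).
exact/measurable_funTS/mprob.
Qed.

Let prob_pos_int : P.-integrable A (EFin \o prob_pos). Proof. exact: prob_int. Qed.

Let prob_neg_int : P.-integrable A (EFin \o prob_neg).
Proof. by apply: prob_int; exact: measurableT_comp. Qed.

Let indic_int (S : set T) : measurable S -> P.-integrable A (EFin \o \1_S).
Proof.
move=> mS; apply: (@rintegrable_bounded _ _ _ P _ mA 1); first exact: measurable_indic.
by move=> t _; rewrite indicE; case: (_ \in _); rewrite ?normr1 ?normr0.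
Qed.

Let Rintegral_indic (S : set T) : measurable S ->
  \int[P]_(t in A) \1_S t = fine (P (A `&` S)).
Proof. by move=> mS; rewrite /Rintegral integral_indic// setIC. Qed.

Lemma onebit_mean :
  \int[P]_(t in A) onebit (dithered t) = \int[P]_(t in A) (prob_pos t - prob_neg t).
Proof.
under eq_Rintegral do rewrite onebit_indic.
rewrite !RintegralB//; [|exact: indic_int|exact: indic_int].
by rewrite !Rintegral_indic// prob_above prob_below.
Qed.

Let sqr_deviation_le (above_t below_t : bool) (p q : R) : 0 <= p <= 1 -> 0 <= q <= 1 ->
  (above_t%:R - below_t%:R - (p - q)) ^+ 2 <=
  2 * (above_t%:R + below_t%:R) + 2 * (p + q).
Proof.
by move=> /andP[p0 p1] /andP[q0 q1]; case: above_t; case: below_t; rewrite /=; nra.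
Qed.

Let lapF01 (u : R) : 0 <= lapF u <= 1. Proof. by rewrite lapF_ge0 lapF_le1. Qed.

Lemma onebit_variance :
  \int[P]_(t in A) (onebit (dithered t) - (prob_pos t - prob_neg t)) ^+ 2 <=
  4 * \int[P]_(t in A) (prob_pos t + prob_neg t).
Proof.
have prob_sum_int : P.-integrable A (EFin \o (fun t => prob_pos t + prob_neg t)).
  exact: rintegrableD.
have indic_sum_int : P.-integrable A (EFin \o (fun t => \1_above t + \1_below t)).
  by apply: rintegrableD => //; exact: indic_int.
have sqr_le t : (onebit (dithered t) - (prob_pos t - prob_neg t)) ^+ 2 <=
    2 * (\1_above t + \1_below t) + 2 * (prob_pos t + prob_neg t).
  by rewrite onebit_indic !indicE; exact: sqr_deviation_le.
have bound_int : P.-integrable A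
    (EFin \o (fun t => 2 * (\1_above t + \1_below t) + 2 * (prob_pos t + prob_neg t))).
  by apply: rintegrableD => //; exact: rintegrableZ.
apply: (@le_trans _ _ (\int[P]_(t in A)
    (2 * (\1_above t + \1_below t) + 2 * (prob_pos t + prob_neg t)))).
  apply: le_Rintegral => //; apply: (rintegrable_le mA _ bound_int); last first.
    by move=> t _; rewrite ger0_norm ?sqr_ge0.
  apply/measurable_funTS/measurable_funX/measurable_funB.
    exact: (measurableT_comp measurable_onebit).
  by apply: measurable_funB; apply: mprob => //; exact: measurableT_comp.
have indic_sumE : \int[P]_(t in A) (\1_above t + \1_below t) =
    \int[P]_(t in A) (prob_pos t + prob_neg t).
  rewrite !RintegralD//; [|exact: indic_int|exact: indic_int].
  by rewrite !Rintegral_indic// prob_above prob_below.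
rewrite [leLHS]RintegralD//; [|exact: rintegrableZ|exact: rintegrableZ].
by rewrite !RintegralZl// indic_sumE -mulrDl -natrD.
Qed.

End OneBitMessage.

Section SigmaOf.
Context {R : realType} {d : measure_display} {T : measurableType d} {C : Type}.
Implicit Types (D : set C) (X : C -> T -> R).

Definition sigma_of_gens D X : set (set T) :=
  [set A | exists c (B : set R), D c /\ measurable B /\ A = X c @^-1` B].

Lemma sigma_of_sub D X (F : set (set T)) : sigma_algebra setT F ->
  (forall c B, D c -> measurable B -> F (X c @^-1` B)) -> sigma_of D X `<=` F.
Proof.
move=> F_sigma F_gen; apply: smallest_sub => // A [c [B [Dc [mB ->]]]]; exact: F_gen.
Qed.

Lemma sigma_of_preimage D X c (B : set R) :
  D c -> measurable B -> sigma_of D X (X c @^-1` B).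
Proof. by move=> Dc mB; apply: sub_gen_smallest; exists c, B. Qed.

Lemma sigma_of_measurable D X :
  (forall c, measurable_fun setT (X c)) -> sigma_of D X `<=` measurable.
Proof.
move=> mX; apply: sigma_of_sub; first exact: sigma_algebra_measurable.
by move=> c B _ mB; exact: measurable_preimage.
Qed.

Lemma sigma_ofS D D' X : D `<=` D' -> sigma_of D X `<=` sigma_of D' X.
Proof.
move=> DD'; apply: sigma_of_sub; first exact: smallest_sigma_algebra.
by move=> c B /DD' D'c mB; exact: sigma_of_preimage.
Qed.

Lemma sigma_of_adapted D X c : D c ->
  measurable_fun [set: g_sigma_algebraType (sigma_of_gens D X)] (X c).
Proof. by move=> Dc _ B mB; rewrite setTI; exact: sigma_of_preimage. Qed.

End SigmaOf.

Section NoiseFiltration.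
Context {R : realType} {d : measure_display} {T : measurableType d}.
Variable P : probability T R.
Variables (N : nat) (m : 'I_N -> nat).
Variable w : forall i : 'I_N, nat -> T -> 'cV[R]_(m i).
Variable dn : 'I_N -> nat -> T -> R.
Hypothesis w_meas : forall i k (l : 'I_(m i)), measurable_fun setT (fun t => w i k t l 0).
Hypothesis d_meas : forall i k, measurable_fun setT (dn i k).

Definition Fwd_gens (k : nat) : set (set T) :=
  sigma_of_gens [set c | match c with
                         | inl c' => (1 <= c'.2 <= k)%N
                         | inr c' => (1 <= c'.2 <= k)%N end] (wdcoord w dn).

Lemma Fwd_measurable k : <<s Fwd_gens k >> `<=` measurable.
Proof.
by apply: sigma_of_measurable => -[[[i l] t]|[i t]]; [exact: (@w_meas i t l)|exact: d_meas].
Qed.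

Lemma Fw_all_measurable : Fw_all w `<=` measurable.
Proof. by apply: sigma_of_measurable => -[[i l] t]; exact: (@w_meas i t l). Qed.

Lemma Fd_measurable i k : Fd dn i k `<=` measurable.
Proof. by apply: sigma_of_measurable => _; exact: d_meas. Qed.

Lemma Fwd_nondecreasing k l : (k <= l)%N -> <<s Fwd_gens k >> `<=` <<s Fwd_gens l >>.
Proof.
by move=> kl; apply: sigma_ofS => -[] c /= /andP[-> ck]; exact: leq_trans ck kl.
Qed.

Lemma Fw_sub_Fwd k : Fw w k `<=` <<s Fwd_gens k >>.
Proof.
apply: sigma_of_sub; first exact: smallest_sigma_algebra.
by move=> c B Dc mB; exact: (@sigma_of_preimage _ _ _ _ _ (wdcoord w dn) (inl c)).
Qed.

Lemma Fw_sub_Fw_all k : Fw w k `<=` Fw_all w.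
Proof. by apply: sigma_ofS => c /andP[]. Qed.

Lemma wcoord_adapted i k (l : 'I_(m i)) : (0 < k)%N ->
  measurable_fun [set: g_sigma_algebraType (Fwd_gens k)] (fun t => w i k t l 0).
Proof.
move=> k_gt0; apply: (@sigma_of_adapted _ _ _ _ _ (wdcoord w dn) (inl (existT _ i l, k))).
by rewrite /= k_gt0 leqnn.
Qed.

Lemma dn_adapted i k : (0 < k)%N ->
  measurable_fun [set: g_sigma_algebraType (Fwd_gens k)] (dn i k).
Proof.
move=> k_gt0; apply: (@sigma_of_adapted _ _ _ _ _ (wdcoord w dn) (inr (i, k))).
by rewrite /= k_gt0 leqnn.
Qed.

Local Notation source := (('I_N * nat) + unit)%type.
Local Notation source_algebra := (fun c : source =>
  match c with inl (i, k) => Fd dn i k | inr _ => Fw_all w end).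
Hypothesis d_indep : mutually_independent P source_algebra.

Let dithers (k : nat) : seq source :=
  [seq inl p | p <- [seq (i, t) | i <- enum 'I_N, t <- iota 1 k]].

(* The events [W /\ D] with [W] in [Fw k] and [D] determined by the dithers up to time [k]
   form a pi-system generating [Fwd k]. *)
Let rectangle (k : nat) : set (set T) := [set E | exists A : source -> set T,
  [/\ forall c, source_algebra c (A c), Fw w k (A (inr tt)) &
      E = A (inr tt) `&` \bigcap_(c in [set` dithers k]) A c]].

Let mem_dithers k i t : (inl (i, t) \in dithers k) = (1 <= t <= k)%N.
Proof.
apply/mapP/idP => [[p /allpairsP[[i' t'] /= [_ t'k ->]] [_ ->]]|tk].
  by move: t'k; rewrite mem_iota add1n ltnS.
exists (i, t) => //; apply/allpairsP; exists (i, t) => //=.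
by rewrite mem_enum mem_iota add1n ltnS.
Qed.

Let inr_notin_dithers k : (inr tt \in dithers k) = false.
Proof. by apply/mapP => -[]. Qed.

Let dithers_uniq k : uniq (dithers k).
Proof.
rewrite map_inj_uniq; last by move=> x y [].
by apply: allpairs_uniq; rewrite ?enum_uniq ?iota_uniq// => -[a b] [a' b'] _ _ [-> ->].
Qed.

Let source_measurable c : source_algebra c `<=` measurable.
Proof. by case: c => [[i k]|[]]; [exact: Fd_measurable|exact: Fw_all_measurable]. Qed.

Let source_setT c : source_algebra c setT.
Proof. by case: c => [[i k]|[]]; exact: gsigmaT. Qed.

Let source_setI c A B : source_algebra c A -> source_algebra c B -> source_algebra c (A `&` B).
Proof. by case: c => [[i k]|[]]; exact: gsigmaI. Qed.

Let bigcap_dithers_measurable k (A : source -> set T) :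
  (forall c, source_algebra c (A c)) -> measurable (\bigcap_(c in [set` dithers k]) A c).
Proof.
move=> GA; apply: fin_bigcap_measurable => // c _; exact: (@source_measurable c _ (GA c)).
Qed.

Let rectangle_measurable k : rectangle k `<=` measurable.
Proof.
move=> E [A [GA _ ->]]; apply: measurableI; last exact: bigcap_dithers_measurable.
exact: (@source_measurable (inr tt) _ (GA (inr tt))).
Qed.

Let rectangleI k : setI_closed (rectangle k).
Proof.
move=> E1 E2 [A1 [G1 F1 ->]] [A2 [G2 F2 ->]]; exists (fun c => A1 c `&` A2 c); split.
- by move=> c; apply: source_setI; [exact: G1|exact: G2].
- exact: gsigmaI F1 F2.
- by rewrite setIACA bigcapI.
Qed.

Let rectangleT k : rectangle k setT.
Proof.
exists (fun=> setT); split; [exact: source_setT|exact: gsigmaT|].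
by apply/seteqP; split.
Qed.

Let Fwd_sub_rectangle k : <<s Fwd_gens k >> `<=` <<s rectangle k >>.
Proof.
apply: sigma_of_sub; first exact: smallest_sigma_algebra.
case=> [c|[i t]] B Dc mB; apply: sub_gen_smallest.
  exists (fun x => if x is inr _ then wcoord w c @^-1` B else setT); split.
  - case=> [[i t]|u]; first exact: (@source_setT (inl (i, t))).
    by apply: sigma_of_preimage => //; case/andP: Dc.
  - by apply: sigma_of_preimage.
  - apply/seteqP; split => s /=; last by case.
    by move=> ws; split => // -[p|[]] //=; rewrite inr_notin_dithers.
exists (fun x => if x == inl (i, t) then dn i t @^-1` B else setT); split.
- move=> c; case: eqP => [->|_]; last exact: source_setT.
  by apply: (@sigma_of_preimage _ _ _ _ _ (fun=> dn i t) tt) => //; case/andP: Dc.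
- exact: gsigmaT.
- apply/seteqP; split => s /=.
    by move=> ds; split => // c _; case: eqP.
  by case=> _ /(_ (inl (i, t))) /=; rewrite eqxx mem_dithers; apply.
Qed.

Let dithers_indep k A (s : seq source) : uniq (s ++ dithers k) ->
  (forall c, source_algebra c (A c)) ->
  P (\bigcap_(c in [set` s]) A c `&` \bigcap_(c in [set` dithers k]) A c) =
  (\big[*%E/1%E]_(c <- s) P (A c) * \big[*%E/1%E]_(c <- dithers k) P (A c))%E.
Proof.
move=> uniq_s GA.
rewrite -big_cat /= -(@d_indep (s ++ dithers k) A uniq_s (fun c _ => GA c)) -bigcap_setU.
congr (P (\bigcap_(c in _) _)); apply/seteqP; split => c /=; rewrite mem_cat.
  by case=> ->; rewrite ?orbT.
by case/orP; [left|right].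
Qed.

Let rectangle_dn_indep j k X (B : set R) : rectangle k X -> measurable B ->
  P (X `&` dn j k.+1 @^-1` B) = (P X * P (dn j k.+1 @^-1` B))%E.
Proof.
move=> [A [GA _ ->]] mB; set D := dn j k.+1 @^-1` B.
pose A' (x : source) := if x == inl (j, k.+1) then D else A x.
have GA' x : source_algebra x (A' x).
  rewrite /A'; case: (x =P inl (j, k.+1)) => [->|_]; last exact: GA.
  exact: (@sigma_of_preimage _ _ _ _ _ (fun=> dn j k.+1) tt).
have A'E c : c \in dithers k -> A' c = A c.
  rewrite /A'; case: eqP => // ->.
  by rewrite mem_dithers ltnn andbF.
have bigcapA'E : \bigcap_(c in [set` dithers k]) A' c = \bigcap_(c in [set` dithers k]) A c.
  by apply: eq_bigcapr => c /= /A'E.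
have prodA'E : (\prod_(c <- dithers k) P (A' c) = \prod_(c <- dithers k) P (A c))%E.
  by rewrite big_seq [RHS]big_seq; apply: eq_bigr => c /A'E ->.
have uniq1 : uniq ([:: inr tt] ++ dithers k) by rewrite /= inr_notin_dithers dithers_uniq.
have uniq2 : uniq ([:: inl (j, k.+1); inr tt] ++ dithers k).
  by rewrite /= inE/= mem_dithers inr_notin_dithers dithers_uniq ltnn andbF.
have indepA := dithers_indep uniq1 GA; rewrite bigcap_seq !big_seq1 in indepA.
have indepA' := dithers_indep uniq2 GA'.
rewrite bigcapA'E prodA'E bigcap_seq !big_cons !big_nil setIT mule1 in indepA'.
have A'j : A' (inl (j, k.+1)) = D by rewrite /A' eqxx.
have A'w : A' (inr tt) = A (inr tt) by [].
rewrite A'j A'w in indepA'.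
by rewrite indepA muleC muleA -indepA' [in LHS]setIC setIA.
Qed.

Lemma dn_indep j k A (B : set R) : <<s Fwd_gens k >> A -> measurable B ->
  P (A `&` dn j k.+1 @^-1` B) = (P A * P (dn j k.+1 @^-1` B))%E.
Proof.
move=> /Fwd_sub_rectangle GA mB.
have mD : measurable (dn j k.+1 @^-1` B) by exact: measurable_preimage.
apply: (pi_system_indep (@rectangle_measurable k) (@rectangleT k) (@rectangleI k) mD _ GA).
by move=> X RX; exact: rectangle_dn_indep.
Qed.

Let Fw_all_fun_measurable (g : T -> \bar R) :
  (forall B : set (\bar R), measurable B -> Fw_all w (g @^-1` B)) -> measurable_fun setT g.
Proof. by move=> Fg _ B mB; rewrite setTI; apply: Fw_all_measurable; exact: Fg. Qed.

Let integral_dithers k (A : source -> set T) (C : set T) (g : T -> \bar R) :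
  (forall c, source_algebra c (A c)) -> Fw_all w C ->
  (forall B : set (\bar R), measurable B -> Fw_all w (g @^-1` B)) ->
  (forall t, (0 <= g t)%E) ->
  (\int[P]_(t in C `&` \bigcap_(c in [set` dithers k]) A c) g t =
   P (\bigcap_(c in [set` dithers k]) A c) * \int[P]_(t in C) g t)%E.
Proof.
move=> GA FC Fg g0; set D := \bigcap_(c in _) _.
have mg := Fw_all_fun_measurable Fg; have mC : measurable C := Fw_all_measurable FC.
rewrite integral_mkcondl [LHS]ge0_integral_indep//.
- by rewrite -integral_mkcond.
- exact: bigcap_dithers_measurable.
- exact: ((measurable_restrictT g mC).1 (measurable_funTS mg)).
- by move=> t; rewrite /patch; case: ifP.
move=> B mB; set E := _ @^-1` B.
have FE : Fw_all w E.
  have -> : E = (C `&` g @^-1` B) `|` (~` C `&` (fun=> 0%E) @^-1` B).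
    apply/seteqP; split => t; rewrite /E /patch /=.
      by case: ifPn; rewrite ?inE ?notin_setE => Ct gB; [left|right].
    by case=> -[Ct gB]; [rewrite mem_set|rewrite memNset].
  apply: gsigmaU; apply: gsigmaI => //; [exact: Fg|exact: gsigmaC|].
  rewrite preimage_cst; case: ifP => _; first exact: gsigmaT.
  by rewrite -setCT; apply: gsigmaC; exact: gsigmaT.
pose A' (x : source) := if x is inr _ then E else A x.
have GA' x : source_algebra x (A' x) by case: x => [p|u] //=; exact: (GA (inl p)).
have uniq1 : uniq ([:: inr tt] ++ dithers k) by rewrite /= inr_notin_dithers dithers_uniq.
have indepE := dithers_indep uniq1 GA'; rewrite bigcap_seq !big_seq1 /= in indepE.
have indep0 := @dithers_indep k A' [::] (dithers_uniq k) GA'.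
rewrite bigcap_seq !big_nil setTI mul1e in indep0.
have DE : \bigcap_(c in [set` dithers k]) A' c = D.
  by apply: eq_bigcapr => -[p|[]] //=; rewrite inr_notin_dithers.
by rewrite -DE indepE indep0 muleC.
Qed.

(* Conditioning on the dithers in addition to the noises does not change the
   conditional expectation of a function of the noises. *)
Lemma cond_exp_Fwd k (f Z : T -> \bar R) (B0 A : set T) :
  (forall t, (0 <= f t)%E) ->
  (forall B : set (\bar R), measurable B -> Fw_all w (f @^-1` B)) ->
  cond_exp_nonneg P (Fw w k) f Z -> Fw w k B0 -> (\int[P]_(t in B0) f t < +oo)%E ->
  <<s Fwd_gens k >> A -> (\int[P]_(t in A `&` B0) f t = \int[P]_(t in A `&` B0) Z t)%E.
Proof.
move=> f0 Ff [Z0 [FZ ZE]] FB0 f_fin /Fwd_sub_rectangle GA.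
have FZ_all B : measurable B -> Fw_all w (Z @^-1` B) by move=> /FZ; exact: Fw_sub_Fw_all.
have mB0 : measurable B0 := Fw_all_measurable (Fw_sub_Fw_all FB0).
have measurable_on_B0 (g : T -> \bar R) : measurable_fun setT g -> measurable_fun setT (g \_ B0).
  by move=> mg; exact: ((measurable_restrictT g mB0).1 (measurable_funTS mg)).
have ge0_on_B0 (g : T -> \bar R) : (forall t, 0 <= g t)%E -> forall t, (0 <= (g \_ B0) t)%E.
  by move=> g0 t; rewrite /patch; case: ifP.
rewrite !integral_mkcondr; apply: (pi_system_integral_eq (@rectangle_measurable k)
  (@rectangleT k) (@rectangleI k) _ _ (ge0_on_B0 _ f0) (ge0_on_B0 _ Z0) _ _ GA).
- exact/measurable_on_B0/Fw_all_fun_measurable.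
- exact/measurable_on_B0/Fw_all_fun_measurable.
- by rewrite -integral_mkcond.
move=> X [A0 [G0 F0 ->]]; rewrite -!integral_mkcondr setIAC.
have FA0 : Fw w k (A0 (inr tt) `&` B0) by exact: gsigmaI F0 FB0.
by rewrite !integral_dithers ?ZE//; exact: Fw_sub_Fw_all FA0.
Qed.

Lemma cond_moment_le k (f Z : T -> \bar R) (M : R) A :
  (forall t, (0 <= f t)%E) ->
  (forall B : set (\bar R), measurable B -> Fw_all w (f @^-1` B)) ->
  cond_exp_nonneg P (Fw w k) f Z ->
  <<s Fwd_gens k >> A -> A `<=` [set t | (Z t <= M%:E)%E] ->
  (\int[P]_(t in A) f t <= M%:E * P A)%E.
Proof.
move=> f0 Ff condZ FA AM; have mA : measurable A := Fwd_measurable FA.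
pose B0 := Z @^-1` [set` `]-oo, M%:E]%E].
have [Z0 [FZ ZE]] := condZ.
have FB0 : Fw w k B0 by apply: FZ; exact: emeasurable_itv.
have mZ : measurable_fun setT Z.
  by apply: Fw_all_fun_measurable => B /FZ; exact: Fw_sub_Fw_all.
have Z_le S : measurable S -> S `<=` B0 -> (\int[P]_(t in S) Z t <= M%:E * P S)%E.
  move=> mS SB0; rewrite -integral_cst//; apply: ge0_le_integral => //.
  exact: measurable_funTS.
have mB0 : measurable B0 := Fw_all_measurable (Fw_sub_Fw_all FB0).
have AB0 : A `&` B0 = A by apply: setIidl => t /AM; rewrite /B0 /= in_itv.
have -> : (\int[P]_(t in A) f t = \int[P]_(t in A) Z t)%E.
  have := cond_exp_Fwd f0 Ff condZ FB0 _ FA; rewrite AB0; apply.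
  rewrite -ZE//; apply: (le_lt_trans (Z_le _ mB0 (@subset_refl _ B0))).
  by rewrite -[P B0]fineK ?fin_num_measure// -EFinM ltry.
by apply: Z_le => //; rewrite -AB0; exact: subIsetr.
Qed.

End NoiseFiltration.

Section RealPowers.
Variable R : realType.
Implicit Types x y u s r q : R.

Lemma powR_bernoulli s q : 0 <= q <= 1 -> -1 <= s -> (1 + s) `^ q <= 1 + q * s.
Proof.
move=> /andP[q0 q1] s1; have s0 : 0 <= 1 + s by lra.
move: s0; rewrite le_eqVlt => /predU1P[s0|s0].
  rewrite -s0; have -> : s = -1 by lra.
  have [->|qn0] := eqVneq q 0; first by rewrite powRr0; lra.
  by rewrite powR0//; lra.
rewrite /powR gt_eqF//.
have := @convex_expR R (Itv01 q0 q1) (ln (1 + s)) 0.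
rewrite !convRE/= expR0 lnK ?posrE// mulr0 addr0.
by rewrite /unstable.onem; lra.
Qed.

Lemma powR_le_sqr x r : 1 <= r <= 2 -> 1 <= x -> x `^ r <= x ^+ 2.
Proof. by move=> /andP[r1 r2] x1; rewrite -powR_mulrn ?ler_powR//; lra. Qed.

Lemma powRD_le x y r : 1 <= r <= 2 -> 0 <= x -> 0 <= y ->
  (x + y) `^ r <= 4 * (x `^ r + y `^ r).
Proof.
move=> r12 x0 y0; wlog xy : x y x0 y0 / x <= y.
  by move=> le_case; have [/le_case|/ltW/le_case] := leP x y; [apply|
    rewrite addrC [x `^ r + _]addrC; apply].
apply: (@le_trans _ _ ((2 * y) `^ r)); first by rewrite ge0_ler_powR ?nnegrE//; lra.
rewrite powRM//; have : 2 `^ r <= 2 ^+ 2 :> R by apply: powR_le_sqr => //; lra.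
by have := powR_ge0 x r; have := powR_ge0 y r; nra.
Qed.

Lemma powR_sum_le (I : Type) (l : seq I) (F : I -> R) r : 1 <= r <= 2 ->
  (forall i, 0 <= F i) ->
  (\sum_(i <- l) F i) `^ r <= 4 ^+ size l * \sum_(i <- l) F i `^ r.
Proof.
move=> r12 F0; elim: l => [|i l IH].
  by rewrite !big_nil mulr0 powR0// gt_eqF//; lra.
rewrite !big_cons /= exprS; apply: le_trans (powRD_le r12 (F0 i) _) _.
  exact: sumr_ge0.
have := powR_ge0 (F i) r.
have : 1 <= 4 ^+ size l :> R by apply: exprn_ege1; lra.
by move: IH; nra.
Qed.

Lemma powR_second_order u y r : 1 < r <= 2 -> 0 < u -> 0 <= u + y ->
  (u + y) `^ r <= u `^ r + u `^ (r - 1) * (r * y + (r - 1) * (y ^+ 2 / u)).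
Proof.
move=> /andP[r1 r2] u0 uy0; set s := y / u.
have yE : y = u * s by rewrite /s mulrC divfK// gt_eqF.
have s1 : 0 <= 1 + s.
  by move: uy0; rewrite yE -{1}(mulr1 u) -mulrDr pmulr_rge0.
have -> : u + y = u * (1 + s) by rewrite mulrDr mulr1 -yE.
have powuE : u `^ r = u `^ (r - 1) * u by rewrite mulrC mulr_powRB1//; lra.
have pows_le : (1 + s) `^ r <= (1 + s) * (1 + (r - 1) * s).
  move: s1; rewrite le_eqVlt => /predU1P[<-|s1].
    by rewrite mul0r powR0// gt_eqF//; lra.
  have -> : (1 + s) `^ r = (1 + s) * (1 + s) `^ (r - 1).
    by rewrite mulr_powRB1//; lra.
  by rewrite ler_pM2l// powR_bernoulli//; lra.
rewrite powRM//; last by lra.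
have -> : y ^+ 2 / u = u * s ^+ 2 by rewrite yE; field; rewrite gt_eqF.
rewrite yE powuE; have -> : u `^ (r - 1) * u + u `^ (r - 1) * (r * (u * s) +
    (r - 1) * (u * s ^+ 2)) = u `^ (r - 1) * u * ((1 + s) * (1 + (r - 1) * s)) by ring.
by apply: ler_wpM2l => //; rewrite mulr_ge0 ?powR_ge0// ltW.
Qed.

Lemma powR_pred_le r y : 1 < r -> 0 <= y -> y `^ (r - 1) <= y `^ r + 1.
Proof.
move=> r1 y0; have [y1|y1] := leP y 1.
  apply: (@le_trans _ _ 1); last by rewrite lerDr powR_ge0.
  have := @ge0_ler_powR R (r - 1); rewrite subr_ge0 (ltW r1) => /(_ isT y 1).
  by rewrite !nnegrE powR1; apply.
by apply: (@le_trans _ _ (y `^ r)); [apply: ler_powR; lra|rewrite lerDl].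
Qed.

Lemma powR_young r y c h : 1 < r -> 0 <= y -> 0 <= c -> 0 < h ->
  y `^ (r - 1) * c <= h * y `^ r + c `^ r * h `^ (- (r - 1)).
Proof.
move=> r1 y0 c0 h0; have r0 : 0 < r by lra.
have hy_ge0 : 0 <= h * y `^ r by rewrite mulr_ge0 ?powR_ge0// ltW.
have ch_ge0 : 0 <= c `^ r * h `^ (- (r - 1)) by rewrite mulr_ge0 ?powR_ge0.
have [chy|hyc] := leP c (h * y).
  apply: (@le_trans _ _ (h * y `^ r)); last by rewrite lerDl.
  apply: (@le_trans _ _ (y `^ (r - 1) * (h * y))); first by rewrite ler_wpM2l ?powR_ge0.
  by rewrite mulrCA [_ * y]mulrC mulr_powRB1.
apply: (@le_trans _ _ (c `^ r * h `^ (- (r - 1)))); last by rewrite lerDr.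
have yc : y <= c / h by rewrite ler_pdivlMr// mulrC ltW.
apply: (@le_trans _ _ ((c / h) `^ (r - 1) * c)).
  apply: ler_wpM2r => //; apply: ge0_ler_powR; rewrite ?nnegrE ?divr_ge0 ?(ltW h0)//; lra.
rewrite powRM ?invr_ge0 ?(ltW h0)// -powR_inv1 ?(ltW h0)// -powRrM mulN1r.
by rewrite mulrAC [_ * c]mulrC mulr_powRB1.
Qed.

Lemma powR_le_1D u y q s : 0 <= u <= y -> 0 < q <= s -> u `^ q <= 1 + y `^ s.
Proof.
move=> /andP[u0 uy] /andP[q0 qs]; have y0 := le_trans u0 uy.
have [u1|u1] := leP u 1.
  apply: (@le_trans _ _ 1); last by rewrite lerDl powR_ge0.
  by have := @ge0_ler_powR R q (ltW q0) u 1; rewrite !nnegrE powR1; apply.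
apply: (@le_trans _ _ (y `^ s)); last by rewrite lerDr.
apply: (@le_trans _ _ (u `^ s)); first by apply: ler_powR => //; exact: ltW.
by apply: ge0_ler_powR; rewrite ?nnegrE//; apply: ltW; apply: lt_le_trans qs.
Qed.

End RealPowers.

Section PsdForms.
Variables (R : realType) (E : lmodType R).
Implicit Types (B : E -> E -> R) (x y z : E).

Definition psd_form B : Prop :=
  [/\ forall x y, B x y = B y x,
      forall c x y z, B (c *: x + y) z = c * B x z + B y z &
      forall x, 0 <= B x x].

Lemma psd_ge0 B x : psd_form B -> 0 <= B x x.
Proof. by case. Qed.

Lemma psd_sym B x y : psd_form B -> B x y = B y x.
Proof. by case. Qed.

Lemma psd0l B z : psd_form B -> B 0 z = 0.
Proof.
case=> _ linB _; have := linB 1 0 0 z; rewrite scale1r addr0 mul1r => B0D.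
by apply/eqP; rewrite -(subrr (B 0 z)) {2}B0D addrK.
Qed.

Lemma psdDl B x y z : psd_form B -> B (x + y) z = B x z + B y z.
Proof. by case=> _ linB _; have := linB 1 x y z; rewrite scale1r mul1r. Qed.

Lemma psdZl B c x z : psd_form B -> B (c *: x) z = c * B x z.
Proof.
by move=> psdB; case: (psdB) => _ linB _; have := linB c x 0 z; rewrite !addr0 psd0l// addr0.
Qed.

Lemma psdDr B x y z : psd_form B -> B z (x + y) = B z x + B z y.
Proof. by move=> psdB; rewrite !(psd_sym z)// psdDl. Qed.

Lemma psdZr B c x z : psd_form B -> B z (c *: x) = c * B z x.
Proof. by move=> psdB; rewrite !(psd_sym z)// psdZl. Qed.

Lemma psd_sumr B (I : Type) (l : seq I) (F : I -> E) z : psd_form B ->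
  B z (\sum_(i <- l) F i) = \sum_(i <- l) B z (F i).
Proof.
move=> psdB; elim: l => [|i l IH]; last by rewrite !big_cons psdDr// IH.
by rewrite !big_nil psd_sym// psd0l.
Qed.

Lemma psd_sqrD B x y : psd_form B -> B (x + y) (x + y) = B x x + 2 * B x y + B y y.
Proof. by move=> psdB; rewrite psdDl// !psdDr// (psd_sym y x)//; lra. Qed.

Lemma psd_cauchy B x y : psd_form B -> B x y ^+ 2 <= B x x * B y y.
Proof.
move=> psdB.
have quadratic_ge0 s : 0 <= s ^+ 2 * B x x + 2 * s * B x y + B y y.
  have := psd_ge0 (s *: x + y) psdB.
  by rewrite psd_sqrD// !psdZl// psdZr// expr2 !mulrA.
have := psd_ge0 x psdB; rewrite le_eqVlt => /predU1P[x0|x0]; last first.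
  have := quadratic_ge0 (- B x y / B x x).
  have -> : (- B x y / B x x) ^+ 2 * B x x + 2 * (- B x y / B x x) * B x y + B y y =
    B y y - B x y ^+ 2 / B x x by field; rewrite gt_eqF.
  by rewrite subr_ge0 ler_pdivrMr// mulrC.
rewrite -x0 mul0r; have [->|n0] := eqVneq (B x y) 0; first by rewrite expr0n.
have := quadratic_ge0 (- (B y y + 1) / (2 * B x y)); rewrite -x0 mulr0 add0r.
have -> : 2 * (- (B y y + 1) / (2 * B x y)) * B x y = - (B y y + 1) by field.
lra.
Qed.

Lemma psd_sqrD_le B x y : psd_form B -> B (x + y) (x + y) <= 2 * (B x x + B y y).
Proof.
move=> psdB; have := psd_ge0 (x + (-1) *: y) psdB.
by rewrite !psd_sqrD// !psdZr// psdZl//; lra.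
Qed.

Lemma psd_sum_le B (I : Type) (l : seq I) (F : I -> E) : psd_form B ->
  B (\sum_(i <- l) F i) (\sum_(i <- l) F i) <= 2 ^+ size l * \sum_(i <- l) B (F i) (F i).
Proof.
move=> psdB; elim: l => [|i l IH]; first by rewrite !big_nil psd0l// mulr0.
rewrite !big_cons /= exprS; apply: le_trans (psd_sqrD_le _ _ psdB) _.
have := psd_ge0 (F i) psdB.
have : 1 <= 2 ^+ size l :> R by apply: exprn_ege1; lra.
by move: IH; nra.
Qed.

Let psd_pow_le_large B z x r : psd_form B -> 1 < r <= 2 -> B z z <= B x x ->
  B (z + x) (z + x) `^ r <= 2 * r * B z z `^ (r - 1) * B z x + 20 * B x x `^ r.
Proof.
move=> psdB r12 zx; have /andP[r1 r2] := r12.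
have z0 := psd_ge0 z psdB; have x0 := psd_ge0 x psdB; have zx0 := psd_ge0 (z + x) psdB.
have sum_le : B (z + x) (z + x) `^ r <= 16 * B x x `^ r.
  apply: (@le_trans _ _ ((4 * B x x) `^ r)).
    rewrite ge0_ler_powR ?nnegrE//; [lra|lra|].
    by have := psd_sqrD_le z x psdB; lra.
  rewrite powRM//; apply: ler_wpM2r; first exact: powR_ge0.
  apply: (@le_trans _ _ (4 ^+ 2)); first by apply: powR_le_sqr; lra.
  lra.
have cross_le : `|B z x| <= B x x.
  rewrite -(@ler_pXn2r _ 2) ?nnegrE// real_normK ?num_real//.
  by apply: (le_trans (psd_cauchy z x psdB)); rewrite expr2 ler_wpM2r.
have pow_cross_le : B z z `^ (r - 1) * `|B z x| <= B x x `^ r.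
  have -> : B x x `^ r = B x x `^ (r - 1) * B x x by rewrite mulrC mulr_powRB1//; lra.
  apply: ler_pM => //; first exact: powR_ge0.
  by rewrite ge0_ler_powR ?nnegrE//; lra.
have cross_ge : - (B z z `^ (r - 1) * `|B z x|) <= B z z `^ (r - 1) * B z x.
  rewrite -mulrN ler_wpM2l ?powR_ge0//; have := ler_norm (- B z x); rewrite normrN; lra.
have pow_x0 := powR_ge0 (B x x) r.
have -> : 2 * r * B z z `^ (r - 1) * B z x = 2 * r * (B z z `^ (r - 1) * B z x).
  by rewrite !mulrA.
have : 0 <= r * (B z z `^ (r - 1) * B z x + B x x `^ r) by rewrite mulr_ge0//; lra.
have : 0 <= (2 - r) * B x x `^ r by rewrite mulr_ge0//; lra.
nra.
Qed.

Let psd_pow_le_small B z x r : psd_form B -> 1 < r <= 2 -> B x x <= B z z -> 0 < B z z ->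
  B (z + x) (z + x) `^ r <= B z z `^ r + 2 * r * B z z `^ (r - 1) * B z x
    + 20 * (B z z `^ (r - 1) * B x x).
Proof.
move=> psdB r12 xz z0; have /andP[r1 r2] := r12; have x0 := psd_ge0 x psdB.
rewrite psd_sqrD// -!addrA; set y := 2 * B z x + B x x.
have zy0 : 0 <= B z z + y by rewrite /y addrA -psd_sqrD// psd_ge0.
apply: (le_trans (powR_second_order r12 z0 zy0)); rewrite lerD2l.
have -> : 2 * r * B z z `^ (r - 1) * B z x + 20 * (B z z `^ (r - 1) * B x x) =
  B z z `^ (r - 1) * (2 * r * B z x + 20 * B x x) by ring.
apply: ler_wpM2l; first exact: powR_ge0.
have y2_le : y ^+ 2 / B z z <= 10 * B x x.
  rewrite ler_pdivrMr// /y; have := psd_cauchy z x psdB.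
  have : B x x ^+ 2 <= B x x * B z z by rewrite expr2 ler_wpM2l.
  have := sqr_ge0 (2 * B z x - B x x); nra.
have : (r - 1) * (y ^+ 2 / B z z) <= (r - 1) * (10 * B x x) by apply: ler_wpM2l => //; lra.
by rewrite /y; nra.
Qed.

Lemma psd_pow_le B z x r : psd_form B -> 1 < r <= 2 ->
  B (z + x) (z + x) `^ r <= B z z `^ r + 2 * r * B z z `^ (r - 1) * B z x
    + 20 * (B z z `^ (r - 1) * B x x + B x x `^ r).
Proof.
move=> psdB r12; have pow_x0 := powR_ge0 (B x x) r; have pow_z0 := powR_ge0 (B z z) r.
have prod_ge0 : 0 <= B z z `^ (r - 1) * B x x by rewrite mulr_ge0 ?powR_ge0 ?psd_ge0.
have [zx|xz] := ltP (B z z) (B x x).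
  by have := psd_pow_le_large psdB r12 (ltW zx); lra.
have := psd_ge0 z psdB; rewrite le_eqVlt => /predU1P[z0|z0]; last first.
  by have := psd_pow_le_small psdB r12 xz z0; lra.
have zx : B z z <= B x x by rewrite -z0 psd_ge0.
by have := psd_pow_le_large psdB r12 zx; lra.
Qed.

Lemma psd_formD B1 B2 : psd_form B1 -> psd_form B2 ->
  psd_form (fun x y => B1 x y + B2 x y).
Proof.
move=> [sym1 lin1 ge01] [sym2 lin2 ge02].
split => [x y|c x y z|x]; first by rewrite sym1 sym2.
  by rewrite lin1 lin2; ring.
by rewrite addr_ge0.
Qed.

Lemma psd_formZ c B : 0 <= c -> psd_form B -> psd_form (fun x y => c * B x y).
Proof.
move=> c0 [symB linB geB]; split => [x y|e x y z|x]; first by rewrite symB.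
  by rewrite linB; ring.
by rewrite mulr_ge0.
Qed.

Lemma psd_form_sum (I : Type) (l : seq I) (B : I -> E -> E -> R) :
  (forall i, psd_form (B i)) -> psd_form (fun x y => \sum_(i <- l) B i x y).
Proof.
move=> psdB; split => [x y|c x y z|x].
- by apply: eq_bigr => i _; exact: psd_sym.
- by rewrite mulr_sumr -big_split/=; apply: eq_bigr => i _; case: (psdB i) => _ ->.
- by apply: sumr_ge0 => i _; exact: psd_ge0.
Qed.

Lemma psd_form_sqr (f : E -> R) : (forall c x y, f (c *: x + y) = c * f x + f y) ->
  psd_form (fun x y => f x * f y).
Proof.
move=> linf; split => [x y|c x y z|x]; first by rewrite mulrC.
  by rewrite linf; ring.
by rewrite -expr2 sqr_ge0.
Qed.

End PsdForms.

(* One step of the recursion for [y `^ r], where [t] and [u] measure the noise. *)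
Definition power_step {R : realType} (r Kn q t u eps : R) : Prop :=
  forall y, 0 <= y ->
    (q * y) `^ r + Kn * ((q * y) `^ (r - 1) * t) + Kn * u + 1 <= (1 + eps) * (y `^ r + 1).

Section LyapunovPower.
Context {R : realType} {d : measure_display} {T : measurableType d}.
Variable P : probability T R.

Definition centered_moments (r : R) (eta : T -> R) (A : set T) (v : R) : Prop :=
  [/\ P.-integrable A (EFin \o eta) /\ \int[P]_(t in A) eta t = 0,
      P.-integrable A (EFin \o (fun t => eta t ^+ 2)) /\
      \int[P]_(t in A) (eta t ^+ 2) <= v * fine (P A) &
      P.-integrable A (EFin \o (fun t => (eta t ^+ 2) `^ r)) /\
      \int[P]_(t in A) ((eta t ^+ 2) `^ r) <= v * fine (P A)].

Variables (E : lmodType R) (J : finType).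
Variable G : nat -> set (set T).
Hypothesis G_meas : forall k, <<s G k >> `<=` measurable.
Hypothesis G_mono : forall k, <<s G k >> `<=` <<s G k.+1 >>.
Variables (e z : nat -> T -> E) (g : J -> nat -> E) (eta : J -> nat -> T -> R).
Hypothesis e_step : forall k t, e k.+1 t = z k t + \sum_q eta q k t *: g q k.
Variable Q : nat -> E -> E -> R.
Hypothesis psdQ : forall k, psd_form (Q k).
Local Notation V k t := (Q k (e k t) (e k t)).
Local Notation Vz k t := (Q k.+1 (z k t) (z k t)).
Local Notation adapted k f := (measurable_fun [set: g_sigma_algebraType (G k)] f).
Hypothesis V_adapted : forall k, adapted k (fun t => V k t).
Hypothesis Vz_adapted : forall k, adapted k (fun t => Vz k t).
Hypothesis Vzg_adapted : forall k q, adapted k (fun t => Q k.+1 (z k t) (g q k)).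
Variable B : nat -> set T.
Hypothesis B_adapted : forall k, <<s G k >> (B k).
Variable rho : nat -> R.
Hypothesis rho_ge0 : forall k, 0 <= rho k.
Hypothesis contract : forall k t, B k t -> Vz k t <= rho k * V k t.
Variable r : R.
Hypothesis r_range : 1 < r <= 2.
Variables (gam v : J -> nat -> R).
Hypothesis gam_ge0 : forall q k, 0 <= gam q k.
Hypothesis v_ge0 : forall q k, 0 <= v q k.
Hypothesis gain_le : forall q k, Q k.+1 (g q k) (g q k) <= gam q k.
Hypothesis eta_moments : forall q k A, <<s G k >> A -> A `<=` B k ->
  centered_moments r (eta q k) A (v q k).
Variable om : nat -> R.
Hypothesis om_gt0 : forall k, 0 < om k.

Definition noise_factor : R := 20 * 16 ^+ #|J|.

Variables (eps : nat -> R) (M : R).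
Hypothesis eps_ge0 : forall k, 0 <= eps k.
Hypothesis eps_prod : forall k, \prod_(i < k) (1 + eps i) <= M.
Hypothesis weight_step : forall k, power_step r noise_factor (om k.+1 * rho k / om k)
  (om k.+1 * \sum_q gam q k * v q k) (om k.+1 `^ r * \sum_q gam q k `^ r * v q k) (eps k).

Let D k t := (om k * V k t) `^ r.
Let linear_coef q k t := om k.+1 `^ r * (2 * r) * (Vz k t `^ (r - 1) * Q k.+1 (z k t) (g q k)).
Let quad_coef q k t := noise_factor * om k.+1 `^ r * gam q k * Vz k t `^ (r - 1).
Let power_coef q k := noise_factor * om k.+1 `^ r * gam q k `^ r.

Let r0 : 0 <= r. Proof. by have := r_range; lra. Qed.
Let V_ge0 k t : 0 <= V k t. Proof. exact: psd_ge0. Qed.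
Let Vz_ge0 k t : 0 <= Vz k t. Proof. exact: psd_ge0. Qed.
Let om_pow_ge0 k : 0 <= om k `^ r. Proof. exact: powR_ge0. Qed.

Lemma noise_factor_ge0 : 0 <= noise_factor.
Proof. by rewrite mulr_ge0// exprn_ge0. Qed.

Let noise_factor_ge : 20 * 2 ^+ #|J| <= noise_factor.
Proof.
rewrite /noise_factor ler_pM2l// lerXn2r ?nnegrE//.
by rewrite (_ : (16 : R) = 2 + 14); lra.
Qed.

Let quad_coef_ge0 q k t : 0 <= quad_coef q k t.
Proof. by rewrite !mulr_ge0// powR_ge0. Qed.

Let power_coef_ge0 q k : 0 <= power_coef q k.
Proof. by rewrite !mulr_ge0// powR_ge0. Qed.

Let D_adapted k : adapted k (D k).
Proof. by apply: (measurableT_comp (measurable_powR _)); apply: measurable_funM. Qed.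

Let noise k t : E := \sum_q eta q k t *: g q k.

Let size_index_enumJ : size (index_enum J) = #|J|.
Proof. by rewrite cardT enumT. Qed.

Let noise_form_le k t :
  Q k.+1 (noise k t) (noise k t) <= 2 ^+ #|J| * \sum_q gam q k * eta q k t ^+ 2.
Proof.
have := psd_sum_le (index_enum J) (fun q => eta q k t *: g q k) (psdQ k.+1).
rewrite size_index_enumJ => /le_trans; apply; apply: ler_wpM2l; first by rewrite exprn_ge0.
apply: ler_sum => q _; rewrite (psdZl _ _ _ (psdQ _)) (psdZr _ _ _ (psdQ _)) mulrA -expr2 mulrC.
by rewrite ler_wpM2r ?sqr_ge0.
Qed.

Let noise_form_pow_le k t : Q k.+1 (noise k t) (noise k t) `^ r <=
  16 ^+ #|J| * \sum_q gam q k `^ r * (eta q k t ^+ 2) `^ r.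
Proof.
have /andP[r1 r2] := r_range.
have term_ge0 q : 0 <= gam q k * eta q k t ^+ 2 by rewrite mulr_ge0// sqr_ge0.
have sum_ge0' : 0 <= \sum_q gam q k * eta q k t ^+ 2 by exact: sumr_ge0.
apply: (@le_trans _ _ ((2 ^+ #|J| * \sum_q gam q k * eta q k t ^+ 2) `^ r)).
  by rewrite ge0_ler_powR ?nnegrE ?psd_ge0// mulr_ge0// exprn_ge0.
have -> : 16 ^+ #|J| = 4 ^+ #|J| * 4 ^+ #|J| :> R by rewrite -exprMn; congr (_ ^+ _); lra.
rewrite powRM ?exprn_ge0// -mulrA; apply: ler_pM; rewrite ?powR_ge0//.
  apply: (le_trans (powR_le_sqr _ _)); [lra|by apply: exprn_ege1; lra|].
  by rewrite -exprM mulnC exprM (_ : (2 : R) ^+ 2 = 4)//; lra.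
have := @powR_sum_le R J (index_enum J) (fun q => gam q k * eta q k t ^+ 2) r.
rewrite size_index_enumJ => sum_le; apply: le_trans (sum_le _ term_ge0) _; first by lra.
apply: ler_wpM2l; first by rewrite exprn_ge0.
by apply: ler_sum => q _; rewrite powRM// sqr_ge0.
Qed.

Let lyapunov_power_le k t : D k.+1 t <= om k.+1 `^ r * Vz k t `^ r
  + \sum_q linear_coef q k t * eta q k t
  + \sum_q quad_coef q k t * eta q k t ^+ 2
  + \sum_q power_coef q k * (eta q k t ^+ 2) `^ r.
Proof.
rewrite /D powRM ?(ltW (om_gt0 _))// e_step -/(noise k t).
apply: (le_trans (ler_wpM2l (om_pow_ge0 _) (psd_pow_le _ _ (psdQ _) r_range))).
rewrite !mulrDr -!addrA; apply: lerD => //; apply: lerD.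
  rewrite /noise psd_sumr// !mulr_sumr le_eqVlt; apply/orP; left; apply/eqP.
  by apply: eq_bigr => q _; rewrite (psdZr _ _ _ (psdQ k.+1)) /linear_coef; ring.
apply: lerD.
  have -> : \sum_q quad_coef q k t * eta q k t ^+ 2 = om k.+1 `^ r * Vz k t `^ (r - 1) *
      (noise_factor * \sum_q gam q k * eta q k t ^+ 2).
    by rewrite !mulr_sumr; apply: eq_bigr => q _; rewrite /quad_coef; ring.
  rewrite (_ : om k.+1 `^ r * (20 * _) = om k.+1 `^ r * Vz k t `^ (r - 1) *
      (20 * Q k.+1 (noise k t) (noise k t))); last by ring.
  apply: ler_wpM2l; first by rewrite mulr_ge0 ?powR_ge0.
  apply: (@le_trans _ _ (20 * (2 ^+ #|J| * \sum_q gam q k * eta q k t ^+ 2))).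
    by rewrite ler_pM2l ?noise_form_le.
  rewrite mulrA; apply: ler_wpM2r; last exact: noise_factor_ge.
  by apply: sumr_ge0 => q _; rewrite mulr_ge0// sqr_ge0.
have -> : \sum_q power_coef q k * (eta q k t ^+ 2) `^ r = om k.+1 `^ r *
    (20 * (16 ^+ #|J| * \sum_q gam q k `^ r * (eta q k t ^+ 2) `^ r)).
  by rewrite !mulr_sumr; apply: eq_bigr => q _; rewrite /power_coef /noise_factor; ring.
by apply: ler_wpM2l => //; rewrite ler_pM2l ?noise_form_pow_le.
Qed.

Section OneStep.
Variables (k : nat) (L : R) (A : set T).
Hypothesis GA : <<s G k >> A.
Hypothesis AB : A `<=` B k.
Hypothesis AL : A `<=` [set t | D k t <= L].

Let mA : measurable A. Proof. exact: (G_meas GA). Qed.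

Let measurable_adapted (f : T -> R) : adapted k f -> measurable_fun A f.
Proof. exact: gsigma_measurable_fun (@G_meas k). Qed.

Let Vz_bounded : exists2 C, 0 <= C & forall t, A t -> Vz k t <= C.
Proof.
exists (rho k * (Num.max 1 L / om k)).
  by rewrite mulr_ge0 ?divr_ge0 ?(ltW (om_gt0 k))// le_max ler01.
move=> t At; apply: (le_trans (contract (AB At))); rewrite ler_wpM2l//.
rewrite ler_pdivlMr// mulrC le_max; have [//|V1] := leP (om k * V k t) 1.
apply: le_trans (AL At); apply: le1r_powR; first exact: ltW.
by have := r_range; lra.
Qed.

Let Vz_pow_bounded s : 0 <= s -> exists2 C, 0 <= C & forall t, A t -> Vz k t `^ s <= C.
Proof.
move=> s0; have [C C0 VzC] := Vz_bounded; exists (C `^ s); first exact: powR_ge0.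
by move=> t At; rewrite ge0_ler_powR ?nnegrE ?VzC.
Qed.

Let linear_coef_bounded q : exists C, forall t, A t -> `|linear_coef q k t| <= C.
Proof.
have [C C0 VzC] := Vz_bounded; have r10 : 0 <= r - 1 by have := r_range; lra.
have [C' C'0 VzpC'] := Vz_pow_bounded r10.
exists (om k.+1 `^ r * (2 * r) * (C' * (1 + C * gam q k))) => t At.
rewrite normrM ger0_norm ?mulr_ge0//; apply: ler_wpM2l; first by rewrite !mulr_ge0.
rewrite normrM ger0_norm ?powR_ge0//; apply: ler_pM; rewrite ?powR_ge0 ?VzpC'//.
set c := Q k.+1 (z k t) (g q k).
apply: (@le_trans _ _ (1 + c ^+ 2)).
  by rewrite -real_normK ?num_real//; have := sqr_ge0 (`|c| - 1); nra.
rewrite lerD2l; apply: (le_trans (psd_cauchy _ _ (psdQ k.+1))).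
by apply: ler_pM; rewrite ?VzC ?psd_ge0.
Qed.

Let quad_coef_bounded q : exists C, forall t, A t -> 0 <= quad_coef q k t <= C.
Proof.
have r10 : 0 <= r - 1 by have := r_range; lra.
have [C C0 VzpC] := Vz_pow_bounded r10.
exists (noise_factor * om k.+1 `^ r * gam q k * C) => t At.
by rewrite quad_coef_ge0 /= ler_wpM2l ?VzpC// !mulr_ge0.
Qed.

Let linear_term q : P.-integrable A (EFin \o (fun t => linear_coef q k t * eta q k t)) /\
  \int[P]_(t in A) (linear_coef q k t * eta q k t) = 0.
Proof.
have [C coefC] := linear_coef_bounded q.
have [[eta_int _] _ _] := eta_moments q GA AB.
have coef_adapted : adapted k (linear_coef q k).
  apply: measurable_funM => //; apply: measurable_funM => //.
  exact: (measurableT_comp (measurable_powR _)).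
split; first exact: (adapted_mul_integrable (@G_meas k) GA coef_adapted eta_int coefC).
apply: (integral_mul_eq0 (@G_meas k) GA coef_adapted eta_int _ coefC) => S GS SA.
by have [[_ ->]] := eta_moments q GS (subset_trans SA AB).
Qed.

Let quad_term q : [/\ P.-integrable A (EFin \o quad_coef q k),
  P.-integrable A (EFin \o (fun t => quad_coef q k t * eta q k t ^+ 2)) &
  \int[P]_(t in A) (quad_coef q k t * eta q k t ^+ 2) <=
    v q k * \int[P]_(t in A) quad_coef q k t].
Proof.
have [C coefC] := quad_coef_bounded q.
have coefCn t : A t -> `|quad_coef q k t| <= C.
  by move=> /coefC /andP[coef0 coef_le]; rewrite ger0_norm.
have [_ [eta2_int _] _] := eta_moments q GA AB.
have coef_adapted : adapted k (quad_coef q k).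
  by apply: measurable_funM => //; exact: (measurableT_comp (measurable_powR _)).
split; [|exact: (adapted_mul_integrable (@G_meas k) GA coef_adapted eta2_int coefCn)|].
  by apply: (rintegrable_bounded P mA _ coefCn); exact: measurable_adapted.
apply: (integral_mul_le (@G_meas k) GA coef_adapted eta2_int _ coefC) => S GS SA.
by have [_ [_ eta2_le] _] := eta_moments q GS (subset_trans SA AB).
Qed.

Let power_term q :
  P.-integrable A (EFin \o (fun t => power_coef q k * (eta q k t ^+ 2) `^ r)) /\
  \int[P]_(t in A) (power_coef q k * (eta q k t ^+ 2) `^ r) <=
    power_coef q k * v q k * fine (P A).
Proof.
have [_ _ [etar_int etar_le]] := eta_moments q GA AB.
by split; [exact: rintegrableZ|rewrite RintegralZl// -mulrA ler_wpM2l].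
Qed.

Let step_bound t : R := om k.+1 `^ r * Vz k t `^ r + \sum_q v q k * quad_coef q k t
  + \sum_q power_coef q k * v q k.

Let base_int : P.-integrable A (EFin \o (fun t => om k.+1 `^ r * Vz k t `^ r)).
Proof.
have [C C0 VzpC] := Vz_pow_bounded r0; apply: rintegrableZ => //.
apply: (@rintegrable_bounded _ _ _ P _ mA C); last first.
  by move=> t At; rewrite ger0_norm ?powR_ge0// VzpC.
by apply: measurable_adapted; exact: (measurableT_comp (measurable_powR _)).
Qed.

Let noise_mean_int : P.-integrable A (EFin \o (fun t => \sum_q v q k * quad_coef q k t)).
Proof.
by apply: rintegrable_sum => // q; apply: rintegrableZ => //; have [] := quad_term q.
Qed.

Let step_bound_int : P.-integrable A (EFin \o step_bound).
Proof.
by apply: rintegrableD; [|apply: rintegrableD|exact: (rintegrable_cst P mA)].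
Qed.

Let D_succ_int : P.-integrable A (EFin \o D k.+1) /\
  \int[P]_(t in A) D k.+1 t <= \int[P]_(t in A) step_bound t.
Proof.
pose lin t := \sum_q linear_coef q k t * eta q k t.
pose quad t := \sum_q quad_coef q k t * eta q k t ^+ 2.
pose pow t := \sum_q power_coef q k * (eta q k t ^+ 2) `^ r.
have lin_int : P.-integrable A (EFin \o lin).
  by apply: rintegrable_sum => // q; have [] := linear_term q.
have quad_int : P.-integrable A (EFin \o quad).
  by apply: rintegrable_sum => // q; have [] := quad_term q.
have pow_int : P.-integrable A (EFin \o pow).
  by apply: rintegrable_sum => // q; have [] := power_term q.
have lin0 : \int[P]_(t in A) lin t = 0.
  rewrite Rintegral_sum// => [|q]; last by have [] := linear_term q.
  by rewrite big1// => q _; have [] := linear_term q.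
have quad_le : \int[P]_(t in A) quad t <=
    \int[P]_(t in A) (\sum_q v q k * quad_coef q k t).
  rewrite !Rintegral_sum// => [|q|q]; first apply: ler_sum => q _.
  - by have [coef_int _ le] := quad_term q; rewrite RintegralZl.
  - by apply: rintegrableZ => //; have [] := quad_term q.
  - by have [] := quad_term q.
have pow_le : \int[P]_(t in A) pow t <= (\sum_q power_coef q k * v q k) * fine (P A).
  rewrite Rintegral_sum// => [|q]; last by have [] := power_term q.
  by rewrite mulr_suml; apply: ler_sum => q _; have [] := power_term q.
have sum_int : P.-integrable A
    (EFin \o (fun t => om k.+1 `^ r * Vz k t `^ r + lin t + quad t + pow t)).
  by do 3 apply: rintegrableD => //.
have D_int : P.-integrable A (EFin \o D k.+1).
  apply: (rintegrable_le mA _ sum_int) => [|t _]; last first.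
    by rewrite ger0_norm ?powR_ge0//; exact: lyapunov_power_le.
  exact: (gsigma_measurable_fun (@G_meas k.+1)).
split => //; apply: le_trans (le_Rintegral mA D_int sum_int _) _.
  by move=> t _; exact: lyapunov_power_le.
rewrite RintegralD//; last by do 2 apply: rintegrableD => //.
rewrite RintegralD//; last exact: rintegrableD.
rewrite RintegralD// lin0 addr0 /step_bound [leRHS]RintegralD//; last 2 first.
- exact: rintegrableD.
- exact: (rintegrable_cst P mA).
by rewrite RintegralD// Rintegral_cst//; lra.
Qed.

Let step_bound_le t : B k t -> step_bound t + 1 <= (1 + eps k) * (D k t + 1).
Proof.
move=> Bt; set y := om k * V k t.
have y0 : 0 <= y by rewrite mulr_ge0// ltW.
apply: le_trans (@weight_step k y y0).
have Vz_le : om k.+1 * Vz k t <= om k.+1 * rho k / om k * y.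
  rewrite /y mulrA divfK ?gt_eqF// -mulrA ler_pM2l//; exact: contract.
have omVz0 : 0 <= om k.+1 * Vz k t by rewrite mulr_ge0// ltW.
have bound0 : 0 <= om k.+1 * rho k / om k * y by apply: le_trans Vz_le.
have r10 : 0 <= r - 1 by have := r_range; lra.
rewrite /step_bound lerD2r; apply: lerD; [apply: lerD|].
- by rewrite -powRM ?(ltW (om_gt0 _))// ge0_ler_powR ?nnegrE.
- have -> : \sum_q v q k * quad_coef q k t = noise_factor *
      ((om k.+1 * Vz k t) `^ (r - 1) * (om k.+1 * \sum_q gam q k * v q k)).
    rewrite powRM ?(ltW (om_gt0 _))// !mulr_sumr; apply: eq_bigr => q _; rewrite /quad_coef.
    have -> : om k.+1 `^ r = om k.+1 * om k.+1 `^ (r - 1).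
      by rewrite mulr_powRB1 ?(ltW (om_gt0 _))//; have := r_range; lra.
    ring.
  apply: ler_wpM2l; first exact: noise_factor_ge0.
  apply: ler_wpM2r; last by rewrite ge0_ler_powR ?nnegrE.
  rewrite mulr_ge0 ?(ltW (om_gt0 _))//.
  by apply: sumr_ge0 => q _; rewrite mulr_ge0.
- rewrite le_eqVlt; apply/orP; left; apply/eqP.
  by rewrite !mulr_sumr; apply: eq_bigr => q _; rewrite /power_coef; ring.
Qed.

Lemma lyapunov_power_step : (\int[P]_(t in A) (D k.+1 t + 1)%:E <=
  (1 + eps k)%:E * \int[P]_(t in A) (D k t + 1)%:E)%E.
Proof.
have one_int := rintegrable_cst P mA 1.
have [D_succ D_succ_le] := D_succ_int.
have D_int : P.-integrable A (EFin \o D k).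
  apply: (@rintegrable_bounded _ _ _ P _ mA L); first exact: measurable_adapted.
  by move=> t At; rewrite ger0_norm ?powR_ge0//; exact: AL.
have D1_int : P.-integrable A (EFin \o (fun t => D k t + 1)) by exact: rintegrableD.
rewrite !EFin_Rintegral//; last exact: rintegrableD.
rewrite -EFinM lee_fin RintegralD//.
apply: (@le_trans _ _ (\int[P]_(t in A) (step_bound t + 1))).
  by rewrite RintegralD// lerD2r.
rewrite -RintegralZl//; apply: le_Rintegral => //; [exact: rintegrableD|exact: rintegrableZ|].
by move=> t /AB; exact: step_bound_le.
Qed.

End OneStep.

Lemma weighted_lyapunov_bounded :
  {ae P, forall t, (forall k, B k t) -> exists C : R, forall k, om k * V k t <= C}.
Proof.
have D_ge0 k t : 0 <= D k t by exact: powR_ge0.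
have := almost_supermartingale_bounded G_meas G_mono D_ge0 D_adapted B_adapted eps_ge0
  eps_prod lyapunov_power_step.
apply: filterS => t D_bnd /D_bnd[C DC]; exists (Num.max 1 C) => k.
rewrite le_max; have [//|V1] := leP (om k * V k t) 1.
by apply: le_trans (DC k); rewrite /D le1r_powR ?(ltW V1)//; have := r_range; lra.
Qed.

End LyapunovPower.

Section NatPowers.
Variable R : realType.
Implicit Types (k : nat) (x y u eps : R).

Lemma natpow_le1 k x : (0 < k)%N -> 0 <= x -> (k%:R : R) `^ (- x) <= 1.
Proof.
move=> k0 x0; rewrite -[leRHS](powRr0 (k%:R : R)).
by apply: ler_powR; [rewrite ler1n|rewrite oppr_le0].
Qed.

Lemma ler_natpow k x y : (0 < k)%N -> x <= y -> (k%:R : R) `^ x <= k%:R `^ y.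
Proof. by move=> k0 xy; apply: ler_powR => //; rewrite ler1n. Qed.

Lemma natpowD k x y : (0 < k)%N -> (k%:R : R) `^ (x + y) = k%:R `^ x * k%:R `^ y.
Proof. by move=> k0; rewrite powRD// pnatr_eq0 -lt0n k0 implybT. Qed.

Lemma natpowN1 k : (k%:R : R) `^ (- 1) = k%:R^-1.
Proof. by rewrite powR_inv1. Qed.

Lemma natpow_sqr k x : (0 < k)%N -> (k%:R `^ x) ^+ 2 = k%:R `^ (2 * x) :> R.
Proof. by move=> k0; rewrite expr2 -natpowD//; congr (_ `^ _); ring. Qed.

Lemma natr_succ_div k : (0 < k)%N -> k.+1%:R / k%:R = 1 + k%:R^-1 :> R.
Proof.
by move=> k0; rewrite -natr1 mulrDl divff ?mul1r// pnatr_eq0 -lt0n.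
Qed.

Lemma natpow_succ_ge k x : (0 < k)%N -> 0 <= x <= 1 ->
  k%:R `^ (- x) <= 2 * k.+1%:R `^ (- x) :> R.
Proof.
move=> k0 /andP[x0 x1]; have kp : 0 < k%:R :> R by rewrite ltr0n.
rewrite !powRN -[leLHS]mul1r ler_pdivrMr ?powR_gt0// mulrAC.
rewrite ler_pdivlMr ?powR_gt0 ?ltr0n// mul1r.
apply: (@le_trans _ _ ((2 * k%:R) `^ x)).
  apply: ge0_ler_powR; rewrite ?nnegrE// -natrM ler_nat.
  by rewrite mul2n -addnn -addn1 leq_add2l.
rewrite powRM//; apply: ler_wpM2r; first exact: powR_ge0.
by apply: ler1_powR => //; rewrite ler1n.
Qed.

Lemma invn_le_succ k : (0 < k)%N -> k%:R^-1 <= 2 * k.+1%:R^-1 :> R.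
Proof. by move=> k0; rewrite -!natpowN1; apply: natpow_succ_ge => //; rewrite ler01 lexx. Qed.

Lemma natpow_diff_bounds k x : (0 < k)%N -> 0 <= x <= 1 ->
  0 <= (k%:R : R) `^ (- x) - k.+1%:R `^ (- x) <= 2 * k.+1%:R `^ (- (1 + x)).
Proof.
move=> k0 /andP[x0 x1]; have kp : 0 < k%:R :> R by rewrite ltr0n.
have kE : k%:R `^ (- x) = k.+1%:R `^ (- x) * (k.+1%:R / k%:R) `^ x :> R.
  rewrite powRM ?invr_ge0// mulrA -natpowD// addNr powRr0 mul1r.
  by rewrite -powR_inv1// -powRrM mulN1r.
have ratio_ge1 : 1 <= k.+1%:R / k%:R :> R by rewrite ler_pdivlMr// mul1r ler_nat.
have -> : k%:R `^ (- x) - k.+1%:R `^ (- x) =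
  k.+1%:R `^ (- x) * ((k.+1%:R / k%:R) `^ x - 1) :> R by rewrite kE; ring.
rewrite opprD [- 1 - x]addrC natpowD// natpowN1.
apply/andP; split.
  apply: mulr_ge0; rewrite ?powR_ge0// subr_ge0 -[leLHS](powRr0 (k.+1%:R / k%:R)).
  exact: ler_powR.
rewrite [leRHS]mulrCA; apply: ler_wpM2l; first exact: powR_ge0.
have := ler1_powR ratio_ge1 x1; rewrite [leRHS]natr_succ_div// => pow_le.
by rewrite lerBlDl; apply: (le_trans pow_le); rewrite lerD2l invn_le_succ.
Qed.

Lemma natpow_small x u eps : 0 <= x -> 0 < u -> 0 < eps ->
  exists k1, forall k, (k1 <= k)%N -> (0 < k)%N -> x * k%:R `^ (- u) <= eps.
Proof.
move=> x0 u0 eps0; set y := (x / eps) `^ u^-1.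
exists (Num.truncn y).+1 => k yk k0; have kp : 0 < k%:R :> R by rewrite ltr0n.
rewrite powRN ler_pdivrMr ?powR_gt0// mulrC -ler_pdivrMr//.
have y_le : y <= k%:R.
  by apply: ltW; apply: (lt_le_trans (truncnS_gt y)); rewrite ler_nat.
have xeps0 : 0 <= x / eps by rewrite divr_ge0// ltW.
have -> : x / eps = y `^ u by rewrite /y -powRrM mulVf ?gt_eqF// powRr1.
by apply: ge0_ler_powR; rewrite ?nnegrE ?powR_ge0 ?(ltW u0)// ltW.
Qed.

Lemma ln_natr_gt0 k : (1 < k)%N -> 0 < ln k%:R :> R.
Proof. by move=> k1; rewrite ln_gt0// ltr1n. Qed.

Lemma exists_natr_ge x : exists n : nat, x <= n%:R.
Proof. by exists (Num.truncn x).+1; apply: ltW; exact: truncnS_gt. Qed.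

End NatPowers.

Section BoundedSums.
Variable R : realType.
Implicit Types f g : nat -> R.

Definition sum_bounded f := exists S : R, forall n, \sum_(j < n) f j <= S.

Definition tail_sum_bounded f :=
  forall k0, (1 < k0)%N -> sum_bounded (fun j => f (j + k0).+1).

Lemma sum_boundedD f g : sum_bounded f -> sum_bounded g -> sum_bounded (fun j => f j + g j).
Proof.
move=> [S fS] [S' gS']; exists (S + S') => n; rewrite big_split/=.
by apply: lerD; [exact: fS|exact: gS'].
Qed.

Lemma sum_boundedZ c f : 0 <= c -> sum_bounded f -> sum_bounded (fun j => c * f j).
Proof. by move=> c0 [S fS]; exists (c * S) => n; rewrite -mulr_sumr; apply: ler_wpM2l. Qed.

Lemma sum_bounded_le f g : (forall j, f j <= g j) -> sum_bounded g -> sum_bounded f.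
Proof. by move=> fg [S gS]; exists S => n; apply: le_trans (gS n); exact: ler_sum. Qed.

Lemma sum_bounded_telescope f (u : nat -> R) : (forall j, 0 <= u j) ->
  (forall j, f j <= u j - u j.+1) -> sum_bounded f.
Proof.
move=> u0 fu; exists (u 0%N) => n.
apply: (@le_trans _ _ (u 0%N - u n)); last by rewrite lerBlDr lerDl.
elim: n => [|n IH]; first by rewrite big_ord0 subrr.
by rewrite big_ord_recr/=; have := fu n; lra.
Qed.

Lemma prod1D_bounded f : (forall j, 0 <= f j) -> sum_bounded f ->
  exists M : R, forall n, \prod_(j < n) (1 + f j) <= M.
Proof.
move=> f0 [S fS]; exists (expR S) => n; apply: (@le_trans _ _ (expR (\sum_(j < n) f j))).
  by rewrite expR_sum; apply: ler_prod => j _; rewrite expR_ge1Dx andbT addr_ge0.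
by rewrite ler_expR.
Qed.

Lemma ln_le_subr1 (x : R) : 0 < x -> ln x <= x - 1.
Proof.
move=> x0; have xE : 1 + (x - 1) = x by lra.
by have := @le_ln1Dx R (x - 1); rewrite xE; apply; lra.
Qed.

Lemma powRN_ge (t q : R) : 0 < t -> 0 <= q -> 1 + q * (1 - t) <= t `^ (- q).
Proof.
move=> t0 q0; rewrite /powR gt_eqF//; apply: le_trans (expR_ge1Dx _).
rewrite lerD2l mulNr -mulrN ler_wpM2l//.
by have := ln_le_subr1 t0; lra.
Qed.

Lemma powRN_diff (u v q : R) : 0 < v -> v <= u -> 0 <= q ->
  q * u `^ (- (q + 1)) * (u - v) <= v `^ (- q) - u `^ (- q).
Proof.
move=> v0 vu q0; have u0 : 0 < u by apply: lt_le_trans vu.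
have -> : v = u * (v / u) by rewrite mulrC divfK// gt_eqF.
set t := v / u; have t0 : 0 < t by rewrite divr_gt0.
rewrite powRM ?(ltW u0) ?(ltW t0)//.
have -> : u `^ (- (q + 1)) = u `^ (- q) / u.
  rewrite opprD powRD; last by apply/implyP => _; rewrite gt_eqF.
  by rewrite powR_inv1// ltW.
have -> : q * (u `^ (- q) / u) * (u - u * t) = u `^ (- q) * (q * (1 - t)).
  by field; rewrite gt_eqF.
have -> : u `^ (- q) * t `^ (- q) - u `^ (- q) = u `^ (- q) * (t `^ (- q) - 1) by ring.
apply: ler_wpM2l; first exact: powR_ge0.
by have := powRN_ge t0 q0; lra.
Qed.

Lemma tail_sum_bounded_pow (s : R) : 0 < s ->
  tail_sum_bounded (fun k => k%:R `^ (- (1 + s))).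
Proof.
move=> s0 k0 k01.
apply: (@sum_bounded_le _ (fun j => s^-1 * (s * (j + k0).+1%:R `^ (- (s + 1))))).
  by move=> j; rewrite mulrA mulVf ?mul1r ?gt_eqF// [1 + s]addrC.
apply: sum_boundedZ; first by rewrite invr_ge0 ltW.
apply: (@sum_bounded_telescope _ (fun j => (j + k0)%:R `^ (- s))).
  by move=> j; exact: powR_ge0.
move=> j; have jk0 : (0 < j + k0)%N by rewrite addn_gt0 (ltnW k01) orbT.
have := @powRN_diff (j + k0).+1%:R (j + k0)%:R s.
rewrite ltr0n jk0 ler_nat leqnSn => /(_ isT isT (ltW s0)).
by rewrite -natrB// subSnn mulr1.
Qed.

Lemma tail_sum_bounded_ln (q : R) : 1 < q ->
  tail_sum_bounded (fun k => k%:R^-1 * (ln k%:R) `^ (- q)).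
Proof.
move=> q1 k0 k01; have q0 : 0 < q - 1 by lra.
apply: (@sum_bounded_le _ (fun j => (q - 1)^-1 *
   ((q - 1) * ln (j + k0).+1%:R `^ (- (q - 1 + 1)) * (j + k0).+1%:R^-1))).
  move=> j; rewrite le_eqVlt; apply/orP; left; apply/eqP.
  by rewrite subrK !mulrA mulVf ?mul1r ?gt_eqF// mulrC.
apply: sum_boundedZ; first by rewrite invr_ge0 ltW.
apply: (@sum_bounded_telescope _ (fun j => ln (j + k0)%:R `^ (- (q - 1)))).
  by move=> j; exact: powR_ge0.
move=> j; set k := (j + k0)%N; have k1 : (1 < k)%N by rewrite ltn_addl.
have kp : 0 < k%:R :> R by rewrite ltr0n ltnW.
have kSp : 0 < k.+1%:R :> R by rewrite ltr0n.
have lnk : ln k%:R <= ln k.+1%:R :> R by rewrite ler_ln ?posrE// ler_nat.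
have := @powRN_diff (ln k.+1%:R) (ln k%:R) (q - 1) (ln_natr_gt0 R k1) lnk (ltW q0).
apply: le_trans; apply: ler_wpM2l; first by rewrite mulr_ge0 ?powR_ge0// ltW.
have := @ln_le_subr1 (k%:R / k.+1%:R); rewrite divr_gt0// => /(_ isT).
rewrite ln_div ?posrE// -natr1.
have -> : k%:R / (k%:R + 1) - 1 = - (k%:R + 1)^-1 :> R.
  by field; rewrite natr1 gt_eqF.
lra.
Qed.

Lemma eventually_bounded f k0 (C : R) : (forall k, (k0 <= k)%N -> f k <= C) ->
  exists C', forall k, f k <= C'.
Proof.
move=> fC; exists (`|C| + \sum_(j < k0) `|f j|) => k.
have abs_sum_ge0 (n : nat) (g : 'I_n -> R) : 0 <= \sum_j `|g j| by apply: sumr_ge0.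
have [kk|kk] := leqP k0 k.
  by apply: (le_trans (fC k kk)); apply: (le_trans (ler_norm C)); rewrite lerDl.
rewrite (bigD1 (Ordinal kk))//=; apply: (le_trans (ler_norm _)).
by rewrite addrCA lerDl addr_ge0// sumr_ge0.
Qed.

End BoundedSums.

Section Weights.
Variable R : realType.
Implicit Types (a b s C c h p q r y Kn : R) (ell tau sig : nat -> R) (k : nat).

Definition weight b ell k : R := k%:R `^ b * ell k.

Definition contraction_factor a C s k : R := 1 - 2 * a / k%:R + C * k%:R `^ (- (1 + s)).

Definition weight_factor ell := forall k, (1 < k)%N -> 0 < ell k /\ ell k.+1 <= ell k.

(* With [b] the exponent of the weight and [a] the rate of contraction, a noise of size
   [tau k] is harmless if it is summable, or if it is of order [1/(k ln k)] and the
   contraction leaves a margin. *)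
Definition noise_negligible a b tau :=
  tail_sum_bounded tau \/
  (b < 2 * a /\ exists2 c, 0 <= c & forall k, (1 < k)%N -> tau k <= c / (k%:R * ln k%:R)).

Lemma noise_negligibleZ a b c tau : 0 <= c ->
  noise_negligible a b tau -> noise_negligible a b (fun k => c * tau k).
Proof.
move=> c0 [tau_sum|[ba [c' c'0 tau_le]]]; [left|right; split=> //].
  by move=> k0 k01; apply: sum_boundedZ => //; exact: tau_sum.
exists (c * c') => [|k k1]; first exact: mulr_ge0.
by rewrite -mulrA ler_wpM2l// tau_le.
Qed.

Lemma weight_factor_le ell k : weight_factor ell -> (1 < k)%N -> ell k <= ell 2.
Proof.
move=> ell_decr; elim: k => // k IH; rewrite ltnS leq_eqVlt => /predU1P[<-//|k1].
by apply: le_trans (IH k1); have [] := ell_decr k k1.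
Qed.

Lemma weight_gt0 b ell k : weight_factor ell -> (1 < k)%N -> 0 < weight b ell k.
Proof.
by move=> ell_decr k1; have [ell0 _] := ell_decr k k1; rewrite mulr_gt0// powR_gt0// ltr0n ltnW.
Qed.

Lemma succ_ratio_pow_le b s k : 0 <= b -> 0 < s <= 1 -> 2 * b <= k%:R -> (0 < k)%N ->
  (k.+1%:R / k%:R) `^ b <=
    1 + b / k.+1%:R + (2 * b + 8 * b ^+ 2) * k.+1%:R `^ (- (1 + s)).
Proof.
move=> b0 /andP[s0 s1] bk k0; have kp : 0 < k%:R :> R by rewrite ltr0n.
set K1 : R := k.+1%:R^-1; have K1_gt0 : 0 < K1 by rewrite invr_gt0.
set x := b / k%:R; have x0 : 0 <= x by rewrite divr_ge0.
have x_half : x <= 1 / 2 by rewrite /x ler_pdivrMr//; lra.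
have pow_le : (k.+1%:R / k%:R) `^ b <= (1 - x)^-1.
  rewrite natr_succ_div// /powR gt_eqF; last by rewrite addr_gt0// invr_gt0.
  apply: (@le_trans _ _ (expR x)).
    rewrite ler_expR /x; apply: ler_wpM2l => //; apply: le_ln1Dx.
    by apply: (@lt_trans _ _ 0); rewrite ?invr_gt0// ltrN10.
  rewrite -[expR x]invrK -expRN lef_pV2 ?posrE ?expR_gt0//; last by lra.
  by have := expR_ge1Dx (- x).
have inv_le : (1 - x)^-1 <= 1 + x + 2 * x ^+ 2.
  rewrite -[leLHS]mul1r ler_pdivrMr; last by lra.
  have : 0 <= x ^+ 2 * (1 - 2 * x) by rewrite mulr_ge0 ?sqr_ge0//; lra.
  nra.
have K1_sqr : K1 ^+ 2 <= k.+1%:R `^ (- (1 + s)).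
  have -> : K1 ^+ 2 = k.+1%:R `^ (- (1 + 1)) by rewrite opprD natpowD// natpowN1 expr2.
  by apply: ler_natpow => //; lra.
have k_inv : k%:R^-1 <= 2 * K1 by exact: invn_le_succ.
have k_inv_split : k%:R^-1 = K1 + K1 * k%:R^-1.
  by rewrite /K1 -natr1; field; rewrite natr1 !gt_eqF.
have x_le : x <= b * K1 + 2 * b * K1 ^+ 2.
  rewrite /x k_inv_split mulrDr lerD2l -mulrA.
  have : b * (K1 * k%:R^-1) <= b * (K1 * (2 * K1)) by do 2 apply: ler_wpM2l => //; exact: ltW.
  nra.
have x_sqr_le : x ^+ 2 <= 4 * b ^+ 2 * K1 ^+ 2.
  have -> : 4 * b ^+ 2 * K1 ^+ 2 = (2 * b * K1) ^+ 2 by ring.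
  rewrite lerXn2r ?nnegrE ?mulr_ge0 ?(ltW K1_gt0)//.
  by rewrite /x; have := ler_wpM2l b0 k_inv; lra.
apply: (le_trans pow_le); apply: (le_trans inv_le).
have : (2 * b + 8 * b ^+ 2) * K1 ^+ 2 <= (2 * b + 8 * b ^+ 2) * k.+1%:R `^ (- (1 + s)).
  by apply: ler_wpM2l => //; rewrite addr_ge0 ?mulr_ge0// sqr_ge0.
by rewrite -/K1; nra.
Qed.

Definition weight_ratio_const b C : R := (2 * b + 8 * b ^+ 2) * (1 + C) + C * (1 + b).

Lemma weight_ratio_const_ge0 b C : 0 <= b -> 0 <= C -> 0 <= weight_ratio_const b C.
Proof.
by move=> b0 C0; rewrite !addr_ge0// !mulr_ge0// ?addr_ge0 ?mulr_ge0 ?sqr_ge0.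
Qed.

Lemma succ_ratio_contraction_le a b s C k : 0 <= b -> b <= 2 * a -> 0 < s <= 1 -> 0 <= C ->
  2 * b <= k%:R -> (0 < k)%N -> 0 <= contraction_factor a C s k.+1 ->
  (k.+1%:R / k%:R) `^ b * contraction_factor a C s k.+1 <=
  1 - (2 * a - b) / k.+1%:R + weight_ratio_const b C * k.+1%:R `^ (- (1 + s)).
Proof.
move=> b0 ba s_range C0 bk k0; rewrite /contraction_factor.
have ratio_le := succ_ratio_pow_le b0 s_range bk k0; have /andP[s0 s1] := s_range.
set p := k.+1%:R `^ (- (1 + s)) in ratio_le *; set K1 : R := k.+1%:R^-1 in ratio_le *.
have p_le1 : p <= 1 by apply: natpow_le1 => //; lra.
have p0 : 0 <= p by exact: powR_ge0.
have K1_gt0 : 0 < K1 by rewrite invr_gt0.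
have K1_le1 : K1 <= 1 by rewrite invf_le1 ?ler1n.
set rho := 1 - 2 * a * K1 + C * p => rho0.
apply: (le_trans (ler_wpM2r rho0 ratio_le)).
have rho_le : rho <= 1 + C.
  have : C * p <= C * 1 by exact: ler_wpM2l.
  have : 0 <= a * K1 by rewrite mulr_ge0 ?(ltW K1_gt0)//; lra.
  by rewrite /rho; lra.
set c := 2 * b + 8 * b ^+ 2.
have c0 : 0 <= c by rewrite addr_ge0 ?mulr_ge0// sqr_ge0.
have rho_term : c * p * rho <= c * p * (1 + C) by apply: ler_wpM2l => //; exact: mulr_ge0.
have abK1_ge0 : 0 <= a * b * K1 ^+ 2 by rewrite !mulr_ge0 ?sqr_ge0//; lra.
have CpK1_le : C * p * (b * K1) <= C * p * (b * 1).
  by apply: ler_wpM2l; [exact: mulr_ge0|exact: ler_wpM2l].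
have -> : (1 + b * K1 + c * p) * rho =
    1 - (2 * a - b) * K1 + C * p + C * p * (b * K1) - 2 * (a * b * K1 ^+ 2) + c * p * rho.
  by rewrite /rho; ring.
by rewrite /weight_ratio_const -/c; lra.
Qed.

Lemma weight_quotient_le a b s C ell k : weight_factor ell ->
  0 <= b -> b <= 2 * a -> 0 < s <= 1 -> 0 <= C ->
  2 * b <= k%:R -> (1 < k)%N -> 0 <= contraction_factor a C s k.+1 ->
  weight b ell k.+1 * contraction_factor a C s k.+1 / weight b ell k <=
  1 - (2 * a - b) / k.+1%:R + weight_ratio_const b C * k.+1%:R `^ (- (1 + s)).
Proof.
move=> ell_decr b0 ba s_range C0 bk k1 contr0; have k0 := ltnW k1.
apply: le_trans (succ_ratio_contraction_le b0 ba s_range C0 bk k0 contr0).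
rewrite mulrAC; apply: ler_wpM2r => //; have [ell0 ellS] := ell_decr k k1.
rewrite ler_pdivrMr; last exact: weight_gt0.
have kp : 0 < k%:R :> R by rewrite ltr0n.
rewrite /weight mulrA -powRM ?divr_ge0// divfK ?gt_eqF//.
by apply: ler_wpM2l; first exact: powR_ge0.
Qed.

Lemma power_recursion_le r q h p C y Kn (tau sig t : R) : 1 < r <= 2 -> 0 <= q ->
  q <= 1 - h + C * p -> 0 <= h -> 0 <= p <= 1 -> 0 <= C -> 0 <= y -> 0 <= Kn ->
  0 <= tau -> 0 <= sig ->
  y `^ (r - 1) * (Kn * (1 + C) * tau) <= h * y `^ r + t * (y `^ r + 1) ->
  (q * y) `^ r + Kn * ((q * y) `^ (r - 1) * tau) + Kn * sig + 1 <=
  (1 + ((2 * C + C ^+ 2) * p + t + Kn * sig)) * (y `^ r + 1).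
Proof.
move=> /andP[r1 r2] q0 q_le h0 /andP[p0 p1] C0 y0 Kn0 tau0 sig0 absorbed.
have Cp0 : 0 <= C * p by exact: mulr_ge0.
have CpC : C * p <= C * 1 by exact: ler_wpM2l.
have q_le1D : q <= 1 + C * p by lra.
have q_pow1 : q `^ (r - 1) <= 1 + C * p.
  apply: (@le_trans _ _ ((1 + C * p) `^ (r - 1))).
    by apply: ge0_ler_powR; rewrite ?nnegrE//; lra.
  by apply: ler1_powR; lra.
have q_pow : q `^ r <= 1 - h + (2 * C + C ^+ 2) * p.
  rewrite -(@mulr_powRB1 _ q r) //; last by lra.
  apply: (@le_trans _ _ (q * (1 + C * p))); first exact: ler_wpM2l.
  apply: (@le_trans _ _ ((1 - h + C * p) * (1 + C * p))); first by apply: ler_wpM2r => //; lra.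
  have : C * p * (C * p) <= C * p * C by apply: ler_wpM2l => //; lra.
  have : 0 <= h * (C * p) by exact: mulr_ge0.
  nra.
rewrite !powRM//; have yr0 := powR_ge0 y r; have yr10 := powR_ge0 y (r - 1).
have main_le : q `^ r * y `^ r <= (1 - h + (2 * C + C ^+ 2) * p) * y `^ r by exact: ler_wpM2r.
have tau_le : Kn * (q `^ (r - 1) * y `^ (r - 1) * tau) <= y `^ (r - 1) * (Kn * (1 + C) * tau).
  have -> : Kn * (q `^ (r - 1) * y `^ (r - 1) * tau) =
    q `^ (r - 1) * (Kn * tau * y `^ (r - 1)) by ring.
  have -> : y `^ (r - 1) * (Kn * (1 + C) * tau) = (1 + C) * (Kn * tau * y `^ (r - 1)) by ring.
  by apply: ler_wpM2r; [rewrite !mulr_ge0|lra].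
have sig_ge0 : 0 <= Kn * sig * y `^ r by rewrite !mulr_ge0.
have p_ge0 : 0 <= (2 * C + C ^+ 2) * p.
  by rewrite mulr_ge0// addr_ge0 ?mulr_ge0 ?sqr_ge0.
nra.
Qed.

Definition absorbable r h c tau (k0 : nat) : Prop :=
  exists eps : nat -> R, [/\ forall j, 0 <= eps j, sum_bounded eps &
    forall j y t, 0 <= y -> 0 <= t <= tau (j + k0).+1 ->
      y `^ (r - 1) * (c * t) <= h / (j + k0).+1%:R * y `^ r + eps j * (y `^ r + 1)].

Lemma absorbable_summable r h c tau k0 : 1 < r -> 0 <= h -> 0 <= c -> (1 < k0)%N ->
  (forall k, (1 < k)%N -> 0 <= tau k) -> tail_sum_bounded tau -> absorbable r h c tau k0.
Proof.
move=> r1 h0 c0 k01 tau0 tau_sum; exists (fun j => c * tau (j + k0).+1); split.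
- by move=> j; rewrite mulr_ge0// tau0// ltnS ltn_addl// ltnW.
- by apply: sum_boundedZ => //; exact: tau_sum.
move=> j y t y0 /andP[t0 t_le] /=.
apply: (@le_trans _ _ (c * tau (j + k0).+1 * (y `^ r + 1))).
  rewrite [leRHS]mulrC; apply: ler_pM; [exact: powR_ge0|exact: mulr_ge0| |].
    exact: powR_pred_le.
  exact: ler_wpM2l.
by rewrite lerDr !mulr_ge0 ?invr_ge0 ?powR_ge0.
Qed.

Lemma absorbable_log r h c c' tau k0 : 1 < r -> 0 < h -> 0 <= c -> 0 <= c' -> (1 < k0)%N ->
  (forall k, (1 < k)%N -> tau k <= c' / (k%:R * ln k%:R)) -> absorbable r h c tau k0.
Proof.
move=> r1 h0 c0 c'0 k01 tau_le; pose C : R := (c * c') `^ r * h `^ (- (r - 1)).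
have C0 : 0 <= C by rewrite mulr_ge0 ?powR_ge0.
exists (fun j => C * ((j + k0).+1%:R^-1 * ln (j + k0).+1%:R `^ (- r))); split.
- by move=> j; rewrite !mulr_ge0// ?powR_ge0 ?invr_ge0.
- by apply: sum_boundedZ => //; exact: tail_sum_bounded_ln.
move=> j y t y0 /andP[t0 t_le]; set k := (j + k0).+1 in t_le *.
have k1 : (1 < k)%N by rewrite ltnS ltn_addl// ltnW.
have kp : 0 < k%:R :> R by rewrite ltr0n.
have lnk : 0 < ln k%:R :> R by exact: ln_natr_gt0.
pose x := c * c' / (k%:R * ln k%:R).
have ct_le : c * t <= x.
  by rewrite /x -mulrA; apply: ler_wpM2l => //; apply: (le_trans t_le); exact: tau_le.
have x0 : 0 <= x by apply: le_trans ct_le; exact: mulr_ge0.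
apply: (le_trans (ler_wpM2l (powR_ge0 _ _) ct_le)).
apply: (le_trans (powR_young r1 y0 x0 (divr_gt0 h0 kp))); rewrite lerD2l.
have inv_pow (u v : R) : 0 <= u -> u^-1 `^ v = u `^ (- v).
  by move=> u0; rewrite -powR_inv1// -powRrM mulN1r.
have -> : x `^ r * (h / k%:R) `^ (- (r - 1)) = C * (k%:R^-1 * ln k%:R `^ (- r)).
  have -> : x `^ r = (c * c') `^ r * (k%:R `^ (- r) * ln k%:R `^ (- r)).
    rewrite /x (powRM _ (mulr_ge0 c0 c'0)) ?invr_ge0 ?mulr_ge0 ?(ltW lnk)//.
    by rewrite inv_pow ?mulr_ge0 ?(ltW lnk)// powRM ?(ltW lnk).
  have -> : (h / k%:R) `^ (- (r - 1)) = h `^ (- (r - 1)) * k%:R `^ (r - 1).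
    by rewrite powRM ?invr_ge0 ?(ltW h0)// inv_pow// opprK.
  rewrite -[k%:R^-1]natpowN1.
  have -> : k%:R `^ (-1) = k%:R `^ (- r) * k%:R `^ (r - 1) :> R.
    by rewrite -natpowD//; congr (_ `^ _); lra.
  by rewrite /C; ring.
rewrite -{1}[C * _]mulr1; apply: ler_wpM2l; last by rewrite lerDr powR_ge0.
by rewrite !mulr_ge0// ?powR_ge0 ?invr_ge0.
Qed.

Lemma noise_negligible_absorbable a b r c tau k0 : 1 < r -> b <= 2 * a -> 0 <= c ->
  (1 < k0)%N -> (forall k, (1 < k)%N -> 0 <= tau k) ->
  noise_negligible a b tau -> absorbable r (2 * a - b) c tau k0.
Proof.
move=> r1 ba c0 k01 tau0 [tau_sum|[ba_lt [c' c'0 tau_le]]].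
  by apply: absorbable_summable => //; lra.
by apply: absorbable_log tau_le => //; lra.
Qed.

Lemma weight_recursion r a b s C Kn ell tau sig k1 :
  1 < r <= 2 -> 0 <= b -> b <= 2 * a -> 0 < s <= 1 -> 0 <= C -> 0 <= Kn ->
  weight_factor ell ->
  (forall k, (1 < k)%N -> 0 <= tau k) -> (forall k, (1 < k)%N -> 0 <= sig k) ->
  noise_negligible a b tau -> tail_sum_bounded sig ->
  exists k0, [/\ (k1 <= k0)%N, (1 < k0)%N,
    forall j, 0 <= contraction_factor a C s (j + k0).+1 &
    exists (eps : nat -> R) (M : R), [/\ forall j, 0 <= eps j,
      forall n, \prod_(j < n) (1 + eps j) <= M &
      forall j t u, 0 <= t <= tau (j + k0).+1 -> 0 <= u <= sig (j + k0).+1 ->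
        power_step r Kn (weight b ell (j + k0).+1 * contraction_factor a C s (j + k0).+1
                         / weight b ell (j + k0)) t u (eps j)]].
Proof.
move=> r_range b0 ba s_range C0 Kn0 ell_decr tau0 sig0 tau_negl sig_sum.
have /andP[r1 r2] := r_range; have /andP[s0 s1] := s_range; have a0 : 0 <= a by lra.
have [k' k'_ge] := exists_natr_ge (2 * b + 2 * a).
pose k0 := (k1 + k'.+2)%N.
have k01 : (1 < k0)%N by rewrite /k0 !addnS.
have jk0_ge j : 2 * b + 2 * a <= (j + k0)%:R.
  by apply: (le_trans k'_ge); rewrite ler_nat /k0 addnA ltnW// ltnW// leq_addl.
have jk0_gt1 j : (1 < j + k0)%N by rewrite ltn_addl.
have jk0S_gt1 j : (1 < (j + k0).+1)%N by rewrite ltnW// ltnS.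
have contr0 j : 0 <= contraction_factor a C s (j + k0).+1.
  rewrite /contraction_factor addr_ge0 ?mulr_ge0 ?powR_ge0// subr_ge0 ler_pdivrMr// mul1r.
  by have := jk0_ge j; rewrite -natr1; lra.
pose C1 := weight_ratio_const b C.
have C1_ge0 : 0 <= C1 by exact: weight_ratio_const_ge0.
have KnC1_ge0 : 0 <= Kn * (1 + C1) by rewrite mulr_ge0// addr_ge0.
have [eps1 [eps1_ge0 eps1_sum absorbed]] :=
  noise_negligible_absorbable r1 ba KnC1_ge0 k01 tau0 tau_negl.
pose p j : R := (j + k0).+1%:R `^ (- (1 + s)).
pose eps j := (2 * C1 + C1 ^+ 2) * p j + eps1 j + Kn * sig (j + k0).+1.
have C2_ge0 : 0 <= 2 * C1 + C1 ^+ 2 by rewrite addr_ge0 ?mulr_ge0 ?sqr_ge0.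
have eps_ge0 j : 0 <= eps j by rewrite !addr_ge0 ?mulr_ge0 ?powR_ge0// sig0.
have eps_sum : sum_bounded eps.
  apply: sum_boundedD; last by apply: sum_boundedZ => //; exact: sig_sum.
  by apply: sum_boundedD => //; apply: sum_boundedZ => //; exact: tail_sum_bounded_pow.
have [M M_ge] := prod1D_bounded eps_ge0 eps_sum.
exists k0; split; [exact: leq_addr|by []|exact: contr0|].
exists eps, M; split => // j t u t_range /andP[u0 u_le] y y0; set q := _ / _.
have q0 : 0 <= q.
  apply: divr_ge0; last exact/ltW/weight_gt0.
  by apply: mulr_ge0 => //; exact/ltW/weight_gt0.
have q_le : q <= 1 - (2 * a - b) / (j + k0).+1%:R + C1 * p j.
  by apply: weight_quotient_le => //; have := jk0_ge j; lra.
have p_range : 0 <= p j <= 1 by rewrite powR_ge0/=; apply: natpow_le1 => //; lra.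
have h0 : 0 <= (2 * a - b) / (j + k0).+1%:R by rewrite divr_ge0//; lra.
have t0 : 0 <= t by case/andP: t_range.
have := power_recursion_le r_range q0 q_le h0 p_range C1_ge0 y0 Kn0 t0 u0
  (absorbed j y t y0 t_range).
move/le_trans; apply; apply: ler_wpM2r; first by rewrite addr_ge0 ?powR_ge0.
by rewrite lerD2l /eps lerD2l ler_wpM2l.
Qed.

Lemma weight_factor1 : weight_factor (fun=> 1).
Proof. by move=> k _; rewrite ltr01. Qed.

Lemma weight_factor_ln n : weight_factor (fun k => (ln k%:R ^+ n)^-1).
Proof.
move=> k k1; have lnk := ln_natr_gt0 R k1; have lnkS := ln_natr_gt0 R (leqW k1).
rewrite invr_gt0 exprn_gt0// lef_pV2 ?posrE ?exprn_gt0//; split => //.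
apply: lerXn2r; rewrite ?nnegrE ?(ltW lnk) ?(ltW lnkS)//.
by rewrite ler_ln ?posrE ?ltr0n ?ler_nat// ltnW.
Qed.

End Weights.

Section Window.
Variable R : realType.
Implicit Types (p k n : nat) (f : nat -> R).

Definition window p f k : R := \sum_(s < p) (p - s)%:R / p%:R * f (k + s.+1)%N.

Definition window_average p f k : R := p%:R^-1 * \sum_(s < p) f (k + s.+1)%N.

(* The weights are chosen so that replacing [f k.+1] by its average over the
   next [p] values costs exactly a telescoping term. *)
Lemma window_succ p f k : (0 < p)%N ->
  window p f k.+1 - window p f k = window_average p f k.+1 - f k.+1.
Proof.
move=> p0; have pn0 : p%:R != 0 :> R by rewrite pnatr_eq0 -lt0n.
have -> : window p f k = f k.+1 + \sum_(s < p) (p.-1 - s)%:R / p%:R * f (k.+1 + s.+1)%N.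
  rewrite /window; case: p p0 pn0 => // p _ pn0.
  rewrite big_ord_recl big_ord_recr /= subn0 subnn mul0r mul0r addr0 divff// mul1r addn1.
  by congr (_ + _); apply: eq_bigr => s _; rewrite /bump /= add1n subSS addSn !addnS.
have -> : window p f k.+1 = \sum_(s < p) ((p.-1 - s)%:R / p%:R * f (k.+1 + s.+1)%N
    + p%:R^-1 * f (k.+1 + s.+1)%N).
  apply: eq_bigr => s _; rewrite -mulrDl; congr (_ * _).
  have -> : (p - s)%N = (p.-1 - s).+1.
    case: p s p0 pn0 => [[]//|p] s _ _ /=; rewrite subSn//.
    by rewrite -ltnS ltn_ord.
  by rewrite -natr1 mulrDl mul1r.
rewrite big_split/= /window_average mulr_sumr; lra.
Qed.

Lemma window_le p f k C : (0 < p)%N -> (forall j, (0 < j)%N -> 0 <= f j <= C) ->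
  window p f k <= p%:R * C.
Proof.
move=> p0 fC; apply: (@le_trans _ _ (\sum_(s < p) C)).
  apply: ler_sum => s _; have /andP[f0 f_le] := fC (k + s.+1)%N (ltn_addl _ (ltn0Sn _)).
  apply: (@le_trans _ _ (1 * f (k + s.+1)%N)); last by rewrite mul1r.
  by apply: ler_wpM2r => //; rewrite ler_pdivrMr ?ltr0n// mul1r ler_nat leq_subr.
by rewrite sumr_const card_ord mulr_natl.
Qed.

Lemma sum_modn_shift n c f : (0 < n)%N ->
  \sum_(s < n) f ((c + s) %% n)%N = \sum_(l < n) f l.
Proof.
move=> n0; elim: c => [|c IH].
  by apply: eq_bigr => s _; rewrite add0n modn_small.
rewrite -IH; case: n n0 {IH} => // n _.
rewrite big_ord_recr big_ord_recl/= addn0 addSnnS modnDr addrC; congr (_ + _).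
by apply: eq_bigr => s _; rewrite /bump/= add1n addSnnS.
Qed.

End Window.

Section FiniteFamilies.
Variables (R : realType) (I : finType) (Q : pred I).

Lemma finite_lower_bound (f : I -> R) (c C : R) : c < C -> (forall i, Q i -> c < f i) ->
  exists g, c < g <= C /\ forall i, Q i -> g <= f i.
Proof.
move=> cC cf; exists (\big[Num.min/C]_(i | Q i) f i); split.
  by rewrite bigmin_le_id andbT; apply/lt_bigmin.
by move=> i Qi; exact: bigmin_le_cond.
Qed.

Lemma finite_upper_bound (f : I -> R) : exists2 C, 0 <= C & forall i, f i <= C.
Proof.
exists (\sum_i `|f i|); first by apply: sumr_ge0.
move=> i; rewrite (bigD1 i)//=; apply: (le_trans (ler_norm _)).
by rewrite lerDl sumr_ge0.
Qed.

Lemma finite_eventually (A : I -> nat -> Prop) :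
  (forall i, Q i -> exists k, forall K, (k <= K)%N -> A i K) ->
  exists k, forall i K, Q i -> (k <= K)%N -> A i K.
Proof.
move=> evA; have /choice[f Af] : forall i, exists k, Q i -> forall K, (k <= K)%N -> A i K.
  by move=> i; case: (boolP (Q i)) => [/evA[k Ak]|nQ]; [exists k|exists 0%N].
exists (\max_(i | Q i) f i)%N => i K Qi fK; apply: Af => //.
by apply: leq_trans fK; exact: leq_bigmax_cond.
Qed.

End FiniteFamilies.

Section EuclideanNorm.
Variable R : realType.

Lemma sum_sqr_ge0 k (v : 'cV[R]_k) : 0 <= \sum_l v l 0 ^+ 2.
Proof. by apply: sumr_ge0 => l _; exact: sqr_ge0. Qed.

Lemma sqr_entry_le k (v : 'cV[R]_k) l : v l 0 ^+ 2 <= \sum_l v l 0 ^+ 2.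
Proof.
by rewrite [leRHS](bigD1 l)//= lerDl; apply: sumr_ge0 => ? _; exact: sqr_ge0.
Qed.

Lemma entry_le_enorm k (v : 'cV[R]_k) l : `|v l 0| <= enorm v.
Proof. by rewrite -sqrtr_sqr ler_sqrt ?sum_sqr_ge0// sqr_entry_le. Qed.

Lemma enorm_dim0 k (v : 'cV[R]_k) : k = 0%N -> enorm v = 0.
Proof.
by move=> k0; rewrite /enorm big1 ?sqrtr0// => -[l l_lt]; exfalso; rewrite k0 in l_lt.
Qed.

Lemma sum_sqr_delta k (l : 'I_k) : \sum_i (delta_mx l 0 : 'cV[R]_k) i 0 ^+ 2 = 1.
Proof.
rewrite (bigD1 l)//= mxE !eqxx expr1n big1 ?addr0// => i /negPf il.
by rewrite mxE il expr0n.
Qed.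

Lemma opnorm_le_sqr p q (M : 'M[R]_(p, q)) c (v : 'cV[R]_q) : 0 <= c -> opnorm_le M c ->
  \sum_l (M *m v) l 0 ^+ 2 <= c ^+ 2 * \sum_l v l 0 ^+ 2.
Proof.
move=> c0 /(_ v) Mv_le.
rewrite -[leLHS]sqr_sqrtr ?sum_sqr_ge0// -[X in _ * X]sqr_sqrtr ?sum_sqr_ge0// -exprMn.
by rewrite lerXn2r ?nnegrE ?mulr_ge0 ?sqrtr_ge0.
Qed.

Lemma opnorm_le_entry p q (M : 'M[R]_(p, q)) c i j : 0 <= c -> opnorm_le M c -> `|M i j| <= c.
Proof.
move=> c0 M_le; have := opnorm_le_sqr (delta_mx j 0) c0 M_le.
rewrite sum_sqr_delta mulr1 -colE => col_le.
rewrite -(@ler_pXn2r _ 2) ?nnegrE// real_normK ?num_real//.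
by apply: le_trans col_le; have := sqr_entry_le (col j M) i; rewrite mxE.
Qed.

Lemma measurable_enorm d (T : measurableType d) k (g : T -> 'cV[R]_k) :
  (forall l, measurable_fun setT (fun t => g t l 0)) ->
  measurable_fun setT (fun t => enorm (g t)).
Proof.
move=> mg; rewrite /enorm (_ : (fun _ => _) = fun t => (\sum_l g t l 0 ^+ 2) `^ 2^-1).
  apply: (measurableT_comp (measurable_powR _)).
  by apply: measurable_sum => l; exact: measurable_funX.
by apply/funext => t; rewrite powR12_sqrt// sum_sqr_ge0.
Qed.

End EuclideanNorm.

Section CenteredMoments.
Context {R : realType} {d : measure_display} {T : measurableType d}.
Variables (P : probability T R) (r : R) (A : set T).
Hypothesis r_range : 1 < r <= 2.
Hypothesis mA : measurable A.

Let measurable_sqr_pow (eta : T -> R) s : measurable_fun setT eta ->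
  measurable_fun A (fun t => (eta t ^+ 2) `^ s).
Proof.
move=> meta; apply: measurable_funTS; apply: (measurableT_comp (measurable_powR _)).
exact: measurable_funX.
Qed.

Lemma centered_moments0 v : 0 <= v -> centered_moments P r (fun=> 0) A v.
Proof.
move=> v0; have /andP[r1 r2] := r_range; have rn0 : r != 0 by rewrite gt_eqF//; lra.
have sqr0E : (fun _ : T => (0 : R) ^+ 2) = fun=> 0 by apply/funext => t; rewrite expr0n.
have pow0E : (fun _ : T => ((0 : R) ^+ 2) `^ r) = fun=> 0.
  by apply/funext => t; rewrite expr0n powR0.
have int0 : \int[P]_(t in A) (0 : R) = 0 by rewrite Rintegral_cst// mul0r.
have zero_int := rintegrable_cst P mA 0.
by rewrite /centered_moments sqr0E pow0E int0; split; split => //; rewrite mulr_ge0 ?fine_ge0.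
Qed.

Lemma centered_moments_bounded (eta : T -> R) v : measurable_fun setT eta ->
  (forall t, `|eta t| <= 2) -> \int[P]_(t in A) eta t = 0 ->
  \int[P]_(t in A) (eta t ^+ 2) <= v * fine (P A) -> 0 <= v ->
  centered_moments P r eta A (4 * v).
Proof.
move=> meta eta_le2 mean0 var_le v0; have /andP[r1 r2] := r_range.
have eta_sqr t : 0 <= eta t ^+ 2 <= 4.
  have := lerXn2r 2 _ _ (eta_le2 t); rewrite !nnegrE real_normK ?num_real// sqr_ge0 => sqr_le.
  by apply: le_trans (sqr_le _ _) _ => //; lra.
have pow_le t : (eta t ^+ 2) `^ r <= 4 * eta t ^+ 2.
  have /andP[sqr0 sqr4] := eta_sqr t; have r10 : 0 <= r - 1 by lra.
  rewrite -(mulr_powRB1 sqr0) ?(lt_trans _ r1)// mulrC ler_wpM2r//.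
  apply: (@le_trans _ _ (4 `^ (r - 1))); first by apply: ge0_ler_powR; rewrite ?nnegrE.
  by rewrite -[leRHS]powRr1//; apply: ler_powR; lra.
have eta_int := rintegrable_bounded P mA (measurable_funTS meta) (fun t _ => eta_le2 t).
have sqr_int : P.-integrable A (EFin \o (fun t => eta t ^+ 2)).
  apply: (@rintegrable_bounded _ _ _ P _ mA 4); first exact/measurable_funTS/measurable_funX.
  by move=> t _; have /andP[sqr0 sqr4] := eta_sqr t; rewrite ger0_norm.
have sqr4_int := rintegrableZ mA 4 sqr_int.
have pow_int : P.-integrable A (EFin \o (fun t => (eta t ^+ 2) `^ r)).
  apply: (rintegrable_le mA _ sqr4_int); first exact: measurable_sqr_pow.
  by move=> t _; rewrite ger0_norm ?powR_ge0.
split; split => //.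
  have : 0 <= v * fine (P A) by rewrite mulr_ge0 ?fine_ge0.
  by move: var_le; rewrite -mulrA; lra.
apply: le_trans (le_Rintegral mA pow_int sqr4_int _) _; first by move=> t _.
by rewrite RintegralZl// -mulrA ler_pM2l.
Qed.

Lemma centered_moments_dominated (eta g : T -> R) rho M : measurable_fun setT eta ->
  P.-integrable A (EFin \o eta) -> \int[P]_(t in A) eta t = 0 ->
  measurable_fun setT g -> (forall t, `|eta t| <= g t) -> 2 * r <= rho ->
  (\int[P]_(t in A) (g t `^ rho)%:E <= M%:E * P A)%E ->
  centered_moments P r eta A (1 + M).
Proof.
move=> meta eta_int mean0 mg eta_le rrho g_le; have /andP[r1 r2] := r_range.
have PA_fin : (P A)%E \is a fin_num by exact: fin_num_measure.
have g_int : P.-integrable A (EFin \o (fun t => g t `^ rho)).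
  apply/integrableP; split.
    apply/measurable_EFinP/measurable_funTS.
    exact: (measurableT_comp (measurable_powR _)).
  rewrite (eq_integral (fun t => (g t `^ rho)%:E)); last first.
    by move=> t _ /=; rewrite ger0_norm ?powR_ge0.
  by apply: (le_lt_trans g_le); rewrite -[P A]fineK// -EFinM ltry.
have one_int := rintegrable_cst P mA 1.
have bound_int : P.-integrable A (EFin \o (fun t => 1 + g t `^ rho)) by exact: rintegrableD.
have bound_le : \int[P]_(t in A) (1 + g t `^ rho) <= (1 + M) * fine (P A).
  rewrite RintegralD// Rintegral_cst// mulrDl lerD2l -lee_fin fineK.
    by apply: (le_trans g_le); rewrite EFinM fineK.
  exact: integrable_fin_num.
have pow_moment s : 1 <= s -> 2 * s <= rho ->
    P.-integrable A (EFin \o (fun t => (eta t ^+ 2) `^ s)) /\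
    \int[P]_(t in A) ((eta t ^+ 2) `^ s) <= (1 + M) * fine (P A).
  move=> s1 srho.
  have pow_le t : (eta t ^+ 2) `^ s <= 1 + g t `^ rho.
    rewrite -real_normK ?num_real// -powR_mulrn// -powRrM.
    by apply: powR_le_1D; [rewrite normr_ge0 eta_le|lra].
  have pow_int : P.-integrable A (EFin \o (fun t => (eta t ^+ 2) `^ s)).
    apply: (rintegrable_le mA (measurable_sqr_pow _ meta) bound_int) => t _.
    by rewrite ger0_norm ?powR_ge0.
  by split => //; apply: le_trans bound_le; apply: le_Rintegral.
have sqrE : (fun t => (eta t ^+ 2) `^ 1) = fun t => eta t ^+ 2.
  by apply/funext => t; rewrite powRr1// sqr_ge0.
have := pow_moment 1; rewrite sqrE => sqr_moment.
by split; [by []|apply: sqr_moment; lra|apply: pow_moment; lra].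
Qed.

End CenteredMoments.

Section Channel.
Variables (R : realType) (N : nat) (nu b : 'I_N -> 'I_N -> R) (i j : 'I_N) (k : nat).
Local Notation C := (Cthr nu b i j k).
Local Notation G := (Gfun nu b i j k).

Definition trigger_prob (x : R) : R := lapF ((x - C) / b i j) + lapF ((- x - C) / b i j).

Definition channel_slope (K : R) : R := k%:R `^ (- nu i j) * (expR (- K / b i j) / b i j).

Lemma trigger_prob_ge0 x : 0 <= trigger_prob x.
Proof. by rewrite addr_ge0// lapF_ge0. Qed.

Lemma trigger_prob_le2 x : trigger_prob x <= 2.
Proof.
have := lapF_le1 ((x - C) / b i j); have := lapF_le1 ((- x - C) / b i j).
by rewrite /trigger_prob; lra.
Qed.

Lemma Gfun_normr_le1 x : `|G x| <= 1.
Proof.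
have := lapF_le1 ((x - C) / b i j); have := lapF_le1 ((- x - C) / b i j).
have := lapF_ge0 ((x - C) / b i j); have := lapF_ge0 ((- x - C) / b i j).
by rewrite ler_norml /Gfun; lra.
Qed.

Let measurable_lapF_shift (f : R -> R) : measurable_fun setT f ->
  measurable_fun setT (fun x => lapF ((f x - C) / b i j)).
Proof.
move=> mf; apply: measurableT_comp; first exact: measurable_lapF.
by apply: measurable_funM => //; exact: measurable_funB.
Qed.

Lemma measurable_Gfun : measurable_fun setT G.
Proof. by apply: measurable_funB; exact: measurable_lapF_shift. Qed.

Lemma measurable_trigger_prob : measurable_fun setT trigger_prob.
Proof. by apply: measurable_funD; exact: measurable_lapF_shift. Qed.

Hypothesis b_gt0 : 0 < b i j.

Lemma Gfun_lipschitz x y : `|G x - G y| <= `|x - y| / b i j.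
Proof.
have -> : G x - G y = (lapF ((x - C) / b i j) - lapF ((y - C) / b i j)) +
   (lapF ((- y - C) / b i j) - lapF ((- x - C) / b i j)) by rewrite /Gfun; ring.
apply: (le_trans (ler_normD _ _)).
have := lapF_lipschitz ((x - C) / b i j) ((y - C) / b i j).
have := lapF_lipschitz ((- y - C) / b i j) ((- x - C) / b i j).
have -> : (- y - C) / b i j - (- x - C) / b i j = (x - y) / b i j by field; rewrite gt_eqF.
have -> : (x - C) / b i j - (y - C) / b i j = (x - y) / b i j by field; rewrite gt_eqF.
rewrite normrM [`|(b i j)^-1|]ger0_norm ?invr_ge0 ?(ltW b_gt0)//; lra.
Qed.

Hypothesis k_gt0 : (0 < k)%N.

Lemma expR_Cthr (y : R) : expR ((y - C) / b i j) = k%:R `^ (- nu i j) * expR (y / b i j).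
Proof.
rewrite /powR gt_eqF ?ltr0n// -expRD; congr expR.
by rewrite /Cthr; field; rewrite gt_eqF.
Qed.

Lemma trigger_prob_le x : trigger_prob x <= k%:R `^ (- nu i j) * expR (`|x| / b i j).
Proof.
have exp_le (u : R) : u <= `|x| -> expR ((u - C) / b i j) <=
    k%:R `^ (- nu i j) * expR (`|x| / b i j).
  move=> ux; rewrite expR_Cthr; apply: ler_wpM2l; first exact: powR_ge0.
  by rewrite ler_expR ler_pM2r ?invr_gt0.
have := lapF_le_expR ((x - C) / b i j); have := lapF_le_expR ((- x - C) / b i j).
have := ler_norm (- x); rewrite normrN => /exp_le; have := exp_le x (ler_norm _).
by rewrite /trigger_prob; lra.
Qed.

Hypothesis nu_ge0 : 0 <= nu i j.

Lemma Cthr_ge0 : 0 <= C.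
Proof. by rewrite !mulr_ge0 ?ln_ge0 ?ler1n// ltW. Qed.

Lemma Gfun_increment_ge (K x y : R) : y <= x -> `|x| <= K -> `|y| <= K ->
  channel_slope K * (x - y) <= G x - G y.
Proof.
move=> yx xK yK; have C0 := Cthr_ge0.
have arg_le u : `|u| <= K -> `|(u - C) / b i j| <= (K + C) / b i j.
  move=> uK; rewrite normrM [X in _ * X]ger0_norm ?invr_ge0 ?(ltW b_gt0)//.
  rewrite ler_pM2r ?invr_gt0//; apply: (le_trans (ler_normB _ _)).
  by rewrite (ger0_norm C0) lerD2r.
have := @lapF_increment_ge R ((K + C) / b i j) ((x - C) / b i j) ((y - C) / b i j).
rewrite ler_pM2r ?invr_gt0// lerD2r => /(_ yx (arg_le _ xK) (arg_le _ yK)).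
have := @lapF_increment_ge R ((K + C) / b i j) ((- y - C) / b i j) ((- x - C) / b i j).
rewrite ler_pM2r ?invr_gt0// lerD2r lerN2.
move=> /(_ yx (arg_le _ _) (arg_le _ _)); rewrite !normrN => /(_ yK xK).
have -> : expR (- ((K + C) / b i j)) = k%:R `^ (- nu i j) * expR (- K / b i j).
  by rewrite -expR_Cthr; congr expR; rewrite -mulNr opprD.
rewrite /Gfun.
have -> : channel_slope K * (x - y) =
  k%:R `^ (- nu i j) * expR (- K / b i j) / 2 * ((x - C) / b i j - (y - C) / b i j) +
  k%:R `^ (- nu i j) * expR (- K / b i j) / 2 * ((- y - C) / b i j - (- x - C) / b i j).
  by rewrite /channel_slope; field; rewrite gt_eqF.
lra.
Qed.

Lemma Gfun_coercive (K x y : R) : `|x| <= K -> `|y| <= K ->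
  channel_slope K * (x - y) ^+ 2 <= (x - y) * (G x - G y).
Proof.
wlog yx : x y / y <= x.
  move=> le_case; have [|/ltW yx] := leP y x; first exact: le_case.
  by move=> xK yK; have := le_case y x yx yK xK; move: (G x) (G y) => *; lra.
move=> xK yK; rewrite expr2 mulrA [leRHS]mulrC; apply: ler_wpM2r; first by rewrite subr_ge0.
exact: Gfun_increment_ge.
Qed.

End Channel.

Lemma edge_card_gt1 (R : realType) (N : nat) (aw : 'I_N -> 'I_N -> R) (i j : 'I_N) :
  (forall l, aw l l = 0) -> 0 < aw i j -> (1 < N)%N.
Proof.
move=> noloop; case: N aw i j noloop => [|[|//]] aw i j noloop; first by case: i.
by rewrite (ord1 i) (ord1 j) noloop ltxx.
Qed.

Section SensorNetwork.
Variables (R : realType) (N n : nat) (m : 'I_N -> nat).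
Variable aw : 'I_N -> 'I_N -> R.
Variable H : forall i : 'I_N, nat -> 'M[R]_(m i, n).
Hypothesis n_gt0 : (0 < n)%N.
Hypothesis N_gt1 : (1 < N)%N.
Hypothesis aw_ge0 : forall i j, 0 <= aw i j.
Hypothesis aw_sym : forall i j, aw i j = aw j i.
Hypothesis conn : \rank (laplacian aw) = N.-1.
Variables (Hbar delta bmin : R) (p : nat).
Hypothesis Hbar_gt0 : 0 < Hbar.
Hypothesis H_bnd : forall i k, (0 < k)%N -> opnorm_le (H i k) Hbar.
Hypothesis p_gt0 : (0 < p)%N.
Hypothesis delta_gt0 : 0 < delta.
Hypothesis PE : forall k, (0 < k)%N ->
     loewner_ge (p%:R^-1 *: \sum_(k <= t < k + p) \sum_(i < N) (H i t)^T *m H i t)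
                (delta%:M).
Hypothesis bmin_gt0 : 0 < bmin.
(* row [i] of such a matrix is the estimation error of sensor [i] *)
Local Notation E := 'M[R]_(N, n).
Local Notation lam2 := (lambda2 (laplacian aw)).

Implicit Types (x y f : E) (k : nat) (kap : R).

Let N_pos : 0 < N%:R :> R. Proof. by rewrite ltr0n ltnW. Qed.
Let n_pos : 0 < n%:R :> R. Proof. by rewrite ltr0n. Qed.
Let p_pos : 0 < p%:R :> R. Proof. by rewrite ltr0n. Qed.
Let Hbar_ge0 : 0 <= Hbar. Proof. exact: ltW. Qed.
Let lam2_gt0 : 0 < lam2.
Proof. by have [] := laplacian_spectral_gap aw_ge0 aw_sym N_gt1 conn. Qed.

Definition rowT (x : E) (i : 'I_N) : 'cV[R]_n := (row i x)^T.

Lemma rowTE x i l : rowT x i l 0 = x i l.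
Proof. by rewrite !mxE. Qed.

Lemma rowT_linear c x y i : rowT (c *: x + y) i = c *: rowT x i + rowT y i.
Proof. by apply/colP => l; rewrite !mxE. Qed.

Definition active_coord k : 'I_n := Ordinal (ltn_pmod k.-1 n_gt0).
Local Notation tc := active_coord.

Lemma phi_mul k (v : 'cV[R]_n) : ((phi R n k)^T *m v) 0 0 = v (tc k) 0.
Proof.
rewrite mxE (bigD1 (tc k))//= !mxE eqxx mul1r big1 ?addr0// => l lk.
by rewrite !mxE; case: eqP => [e|]; [case/eqP: lk; exact: val_inj|rewrite mul0r].
Qed.

Definition inner x y : R := \sum_i \sum_l x i l * y i l.

Definition obs_form k x y : R :=
  \sum_i \sum_l (H i k *m rowT x i) l 0 * (H i k *m rowT y i) l 0.

Definition link_form k x y : R :=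
  \sum_i \sum_j aw i j / 2 * ((x i (tc k) - x j (tc k)) * (y i (tc k) - y j (tc k))).

Lemma inner_psd : psd_form inner.
Proof.
apply: psd_form_sum => i; apply: psd_form_sum => l.
by apply: psd_form_sqr => c x y; rewrite !mxE.
Qed.

Lemma obs_form_psd k : psd_form (obs_form k).
Proof.
apply: psd_form_sum => i; apply: psd_form_sum => l.
by apply: psd_form_sqr => c x y; rewrite rowT_linear mulmxDr -scalemxAr !mxE.
Qed.

Lemma link_form_psd k : psd_form (link_form k).
Proof.
apply: psd_form_sum => i; apply: psd_form_sum => j.
apply: psd_formZ; first by rewrite divr_ge0.
by apply: psd_form_sqr => c x y; rewrite !mxE; ring.
Qed.

Lemma innerE x : inner x x = \sum_i \sum_l x i l ^+ 2.
Proof. by apply: eq_bigr => i _; apply: eq_bigr => l _; rewrite expr2. Qed.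

Lemma inner_ge0 x : 0 <= inner x x.
Proof. exact: (psd_ge0 x inner_psd). Qed.

Lemma sqr_row_le_inner x i : \sum_l x i l ^+ 2 <= inner x x.
Proof.
rewrite innerE (bigD1 i)//= lerDl.
by do 2 (apply: sumr_ge0 => ? _); exact: sqr_ge0.
Qed.

Lemma sqr_entry_le_inner x i l : x i l ^+ 2 <= inner x x.
Proof.
apply: le_trans (sqr_row_le_inner x i).
by have := sqr_entry_le (rowT x i) l; under eq_bigr do rewrite rowTE; rewrite rowTE.
Qed.

Lemma obs_formE k x : obs_form k x x = \sum_i \sum_l (H i k *m rowT x i) l 0 ^+ 2.
Proof. by apply: eq_bigr => i _; apply: eq_bigr => l _; rewrite expr2. Qed.

Lemma obs_row_le k x i : (0 < k)%N ->
  \sum_l (H i k *m rowT x i) l 0 ^+ 2 <= Hbar ^+ 2 * \sum_l x i l ^+ 2.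
Proof.
move=> k0; have := opnorm_le_sqr (rowT x i) Hbar_ge0 (H_bnd i k0).
by under [X in _ <= _ * X]eq_bigr do rewrite rowTE.
Qed.

Lemma obs_form_le k x : (0 < k)%N -> obs_form k x x <= Hbar ^+ 2 * inner x x.
Proof.
move=> k0; rewrite obs_formE innerE mulr_sumr; apply: ler_sum => i _.
exact: obs_row_le.
Qed.

Definition link_bound : R := \sum_i \sum_j 2 * aw i j.

Lemma link_bound_ge0 : 0 <= link_bound.
Proof. by do 2 (apply: sumr_ge0 => ? _); rewrite mulr_ge0. Qed.

Lemma link_form_le k x : link_form k x x <= link_bound * inner x x.
Proof.
rewrite mulr_suml; apply: ler_sum => i _; rewrite mulr_suml; apply: ler_sum => j _.
have -> : 2 * aw i j * inner x x = aw i j / 2 * (4 * inner x x) by field.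
apply: ler_wpM2l; first by rewrite divr_ge0.
have := sqr_entry_le_inner x i (tc k); have := sqr_entry_le_inner x j (tc k).
by move: (x i _) (x j _) => u v; have := sqr_ge0 (u + v); nra.
Qed.

Lemma excitation_sum k (v : 'cV[R]_n) : (0 < k)%N ->
  delta * \sum_l v l 0 ^+ 2 <=
  p%:R^-1 * \sum_(s < p) \sum_i \sum_l (H i (k + s)%N *m v) l 0 ^+ 2.
Proof.
move=> k0; have := PE k0 v; rewrite mulmxBr mulmxBl mxE.
have -> : (v^T *m (p%:R^-1 *: \sum_(k <= t < k + p) \sum_(i < N) (H i t)^T *m H i t) *m v) 0 0
  = p%:R^-1 * \sum_(s < p) \sum_i \sum_l (H i (k + s)%N *m v) l 0 ^+ 2.
  rewrite -scalemxAr -scalemxAl mxE; congr (_ * _).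
  rewrite -{1}[k]add0n big_addn addnC addnK big_mkord.
  rewrite mulmx_sumr mulmx_suml summxE; apply: eq_bigr => s _.
  rewrite mulmx_sumr mulmx_suml summxE; apply: eq_bigr => i _.
  rewrite mulmxA -trmx_mul -mulmxA mxE; apply: eq_bigr => l _.
  by rewrite mxE expr2 addnC.
have -> : ((- (v^T *m delta%:M *m v)) 0 0) = - (delta * \sum_l v l 0 ^+ 2).
  rewrite mxE; congr (- _); rewrite -mulmxA mul_scalar_mx -scalemxAr mxE; congr (_ * _).
  by rewrite mxE; apply: eq_bigr => l _; rewrite mxE expr2.
by rewrite subr_ge0.
Qed.

Lemma excitation_le : delta <= N%:R * Hbar ^+ 2.
Proof.
have := excitation_sum (delta_mx (tc 1) 0) (ltn0Sn 0).
rewrite sum_sqr_delta mulr1 => /le_trans; apply; rewrite mulrC ler_pdivrMr//.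
apply: (@le_trans _ _ (\sum_(s < p) \sum_(i < N) Hbar ^+ 2)).
  apply: ler_sum => s _; apply: ler_sum => i _.
  have := opnorm_le_sqr (delta_mx (tc 1) 0) Hbar_ge0 (@H_bnd i (1 + s)%N isT).
  by rewrite sum_sqr_delta mulr1.
by rewrite !sumr_const !card_ord -[_ *+ p]mulr_natl -[_ *+ N]mulr_natl mulrC.
Qed.

Definition obs_average k x : R := window_average p (fun j => obs_form j x x) k.
Definition link_average k x : R := window_average n (fun j => link_form j x x) k.

Definition mean x : 'cV[R]_n := \col_l (N%:R^-1 * \sum_i x i l).
Definition deviation x : R := \sum_i \sum_l (x i l - mean x l 0) ^+ 2.

Lemma deviation_ge0 x : 0 <= deviation x.
Proof. by do 2 (apply: sumr_ge0 => ? _); exact: sqr_ge0. Qed.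

Lemma sum_col_mean x l : \sum_i x i l = N%:R * mean x l 0.
Proof. by rewrite mxE mulVKf// gt_eqF. Qed.

Lemma inner_mean_deviation x : inner x x = N%:R * \sum_l mean x l 0 ^+ 2 + deviation x.
Proof.
rewrite innerE /deviation exchange_big [X in _ + X]exchange_big/= mulr_sumr -big_split/=.
apply: eq_bigr => l _; set c := mean x l 0.
have -> : \sum_i (x i l - c) ^+ 2 = \sum_i x i l ^+ 2 - 2 * c * \sum_i x i l + N%:R * c ^+ 2.
  transitivity (\sum_i (x i l ^+ 2 - 2 * c * x i l + c ^+ 2)).
    by apply: eq_bigr => i _; ring.
  by rewrite big_split/= sumrB -mulr_sumr sumr_const card_ord [N%:R * _]mulr_natl.
by rewrite sum_col_mean -/c; ring.
Qed.

(* Over [n] consecutive times every coordinate is exchanged exactly once. *)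
Lemma sum_link_form k x : \sum_(s < n) link_form (k + s.+1) x x =
  \sum_l (\sum_i \sum_j aw i j * (x i l - x j l) ^+ 2) / 2.
Proof.
pose F (l : nat) : R := if insub l is Some l' then
  (\sum_i \sum_j aw i j * (x i l' - x j l') ^+ 2) / 2 else 0.
transitivity (\sum_(l < n) F l); last by apply: eq_bigr => l _; rewrite /F valK.
rewrite -(sum_modn_shift k F n_gt0); apply: eq_bigr => s _.
rewrite /F insubT ?ltn_pmod// => ltsn; rewrite mulr_suml; apply: eq_bigr => i _.
rewrite mulr_suml; apply: eq_bigr => j _.
have -> : tc (k + s.+1) = Ordinal ltsn by apply: val_inj; rewrite /= addnS.
by rewrite /=; field.
Qed.

Lemma link_average_ge k x : lam2 / n%:R * deviation x <= link_average k x.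
Proof.
have [_ gap] := laplacian_spectral_gap aw_ge0 aw_sym N_gt1 conn.
rewrite /link_average /window_average sum_link_form mulrAC mulrC.
apply: ler_wpM2l; first by rewrite invr_ge0.
rewrite /deviation exchange_big/= mulr_sumr; apply: ler_sum => l _.
have := gap (fun i => x i l - mean x l 0).
rewrite sumrB sum_col_mean sumr_const card_ord mulr_natl subrr => /(_ erefl).
move/le_trans; apply; rewrite le_eqVlt; apply/orP; left; apply/eqP; congr (_ / _).
by apply: eq_bigr => i _; apply: eq_bigr => j _; congr (_ * _ ^+ _); ring.
Qed.

(* [|u + z|^2 >= (1 - c) |u|^2 - (1/c - 1) |z|^2] separates the consensus part from the
   deviations. *)
Lemma obs_form_ge k x c : (0 < k)%N -> 0 < c <= 1 ->
  (1 - c) * (\sum_i \sum_l (H i k *m mean x) l 0 ^+ 2)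
    - (c^-1 - 1) * Hbar ^+ 2 * deviation x <= obs_form k x x.
Proof.
move=> k0 /andP[c0 c1]; set u := mean x; pose z i := rowT x i - u.
rewrite obs_formE /deviation !mulr_sumr -sumrB; apply: ler_sum => i _.
have -> : \sum_l (x i l - u l 0) ^+ 2 = \sum_l z i l 0 ^+ 2.
  by apply: eq_bigr => l _; rewrite !mxE.
have c_inv : 0 <= c^-1 - 1 by rewrite subr_ge0 invf_ge1.
apply: (@le_trans _ _ ((1 - c) * \sum_l (H i k *m u) l 0 ^+ 2 -
   (c^-1 - 1) * \sum_l (H i k *m z i) l 0 ^+ 2)).
  rewrite lerD2l lerN2 -[leRHS]mulrA; apply: ler_wpM2l => //.
  exact: opnorm_le_sqr (H_bnd i k0).
rewrite !mulr_sumr -sumrB; apply: ler_sum => l _.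
have -> : (H i k *m rowT x i) l 0 = (H i k *m u) l 0 + (H i k *m z i) l 0.
  by rewrite -[rowT x i](subrK u) addrC mulmxDr mxE.
move: ((H i k *m u) l 0) ((H i k *m z i) l 0) => s t; rewrite -subr_ge0.
have -> : (s + t) ^+ 2 - ((1 - c) * s ^+ 2 - (c^-1 - 1) * t ^+ 2) =
   c * (s + c^-1 * t) ^+ 2 by field; rewrite gt_eqF.
by rewrite mulr_ge0 ?sqr_ge0// ltW.
Qed.

Lemma obs_average_ge k x c : 0 < c <= 1 ->
  (1 - c) * delta * \sum_l mean x l 0 ^+ 2 - (c^-1 - 1) * Hbar ^+ 2 * deviation x
    <= obs_average k x.
Proof.
move=> c_range; have c1 : 0 <= 1 - c by rewrite subr_ge0; case/andP: c_range.
apply: (@le_trans _ _ (p%:R^-1 * \sum_(s < p)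
    ((1 - c) * (\sum_i \sum_l (H i (k.+1 + s)%N *m mean x) l 0 ^+ 2)
     - (c^-1 - 1) * Hbar ^+ 2 * deviation x))).
  rewrite sumrB -mulr_sumr sumr_const card_ord mulrBr -[X in _ <= _ - _ * X]mulr_natl.
  rewrite [X in _ <= _ - X]mulrA mulVf ?gt_eqF// mul1r lerD2r.
  rewrite [leRHS]mulrCA -[leLHS]mulrA; apply: ler_wpM2l => //.
  exact: excitation_sum.
apply: ler_wpM2l; first by rewrite invr_ge0 ltW.
by apply: ler_sum => s _; rewrite addSnnS; apply: obs_form_ge; rewrite // addnS.
Qed.

Definition rate kap : R :=
  delta * lam2 * bmin * kap / (2 * N%:R * n%:R * Hbar ^+ 2 * bmin + N%:R * lam2 * kap).

Let obs_weight : R := 2 * n%:R * Hbar ^+ 2 * bmin.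
Let obs_weight_gt0 : 0 < obs_weight.
Proof. by rewrite !mulr_gt0// exprn_gt0. Qed.

Let rateE kap : rate kap =
  delta * bmin * (lam2 * kap) / (N%:R * (obs_weight + lam2 * kap)).
Proof. by rewrite /rate /obs_weight; congr (_ / _); ring. Qed.

Let rate_le_deviation kap : 0 <= kap -> rate kap <= lam2 * kap / (2 * n%:R).
Proof.
move=> kap0; set mu := lam2 * kap; have mu0 : 0 <= mu by rewrite mulr_ge0// ltW.
have q0 := obs_weight_gt0.
rewrite rateE -/mu ler_pdivrMr; last by rewrite mulr_gt0//; lra.
have -> : mu / (2 * n%:R) * (N%:R * (obs_weight + mu)) =
    mu * (N%:R * (obs_weight + mu) / (2 * n%:R)) by field; rewrite gt_eqF.
rewrite [leLHS]mulrC; apply: ler_wpM2l => //; rewrite ler_pdivlMr ?mulr_gt0//.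
have := ler_wpM2r (ltW (mulr_gt0 (mulr_gt0 bmin_gt0 (ltr0n R 2)) n_pos)) excitation_le.
have : 0 <= N%:R * mu by rewrite mulr_ge0// ltW.
by rewrite /obs_weight; nra.
Qed.

Lemma rate_coercive k x kap : 0 <= kap ->
  rate kap * inner x x <= bmin * obs_average k x + kap * link_average k x.
Proof.
move=> kap0; set mu := lam2 * kap; have mu0 : 0 <= mu by rewrite mulr_ge0// ltW.
have q0 := obs_weight_gt0; have den0 : 0 < obs_weight + mu by lra.
pose c := obs_weight / (obs_weight + mu).
have c01 : 0 < c <= 1 by rewrite divr_gt0//= ler_pdivrMr// mul1r lerDl.
have obs_ge := obs_average_ge k x c01; have link_ge := link_average_ge k x.
have cB1 : 1 - c = mu / (obs_weight + mu) by rewrite /c; field; rewrite gt_eqF.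
have cV : c^-1 - 1 = mu / obs_weight by rewrite /c; field; rewrite !gt_eqF.
rewrite cB1 cV in obs_ge; rewrite inner_mean_deviation.
set A := \sum_l mean x l 0 ^+ 2 in obs_ge *; set Z := deviation x in obs_ge link_ge *.
apply: le_trans (lerD (ler_wpM2l (ltW bmin_gt0) obs_ge) (ler_wpM2l kap0 link_ge)).
have mean_part : bmin * (mu / (obs_weight + mu) * delta * A) = rate kap * (N%:R * A).
  by rewrite rateE -/mu; field; rewrite !gt_eqF.
have obs_part : bmin * (mu / obs_weight * Hbar ^+ 2 * Z) = mu / (2 * n%:R) * Z.
  by rewrite /obs_weight; field; rewrite !gt_eqF.
have link_part : kap * (lam2 / n%:R * Z) = 2 * (mu / (2 * n%:R) * Z).
  by rewrite /mu; field; rewrite gt_eqF.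
have := ler_wpM2r (deviation_ge0 x) (rate_le_deviation kap0).
by rewrite mulrBr mean_part obs_part link_part -/Z -/mu; lra.
Qed.

Lemma rate_gt0 kap : 0 < kap -> 0 < rate kap.
Proof.
move=> kap0; have := obs_weight_gt0; have : 0 < lam2 * kap by exact: mulr_gt0.
by move=> mu0 q0; rewrite rateE divr_gt0// !mulr_gt0//; lra.
Qed.

Definition rate_deficit : R := delta * bmin * obs_weight / (N%:R * lam2).

Lemma rate_deficit_ge0 : 0 <= rate_deficit.
Proof. by apply/ltW; rewrite divr_gt0 ?(mulr_gt0 _ obs_weight_gt0) ?mulr_gt0. Qed.

Lemma rate_ge kap : 0 < kap -> delta * bmin / N%:R - rate_deficit / kap <= rate kap.
Proof.
move=> kap0; have mu0 : 0 < lam2 * kap by exact: mulr_gt0.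
have q0 := obs_weight_gt0.
have -> : rate kap = delta * bmin / N%:R -
    delta * bmin * obs_weight / N%:R / (obs_weight + lam2 * kap).
  by rewrite rateE; field; rewrite !gt_eqF//; lra.
have -> : rate_deficit / kap = delta * bmin * obs_weight / N%:R / (lam2 * kap).
  by rewrite /rate_deficit; field; rewrite !gt_eqF.
rewrite lerD2l lerN2; apply: ler_wpM2l.
  by rewrite divr_ge0 ?ltW// !mulr_gt0.
by rewrite lef_pV2 ?posrE//; lra.
Qed.

Section LyapunovForm.
Variables (kap eps : R).
Hypothesis kap_ge0 : 0 <= kap.
Hypothesis eps_range : 0 <= eps <= 4^-1.

Definition coupling k : R := kap * k%:R `^ (- (1 - eps)).

Definition obs_window k x y : R := window p (fun j => obs_form j x y) k.
Definition link_window k x y : R := window n (fun j => link_form j x y) k.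
Definition correction k x y : R :=
  bmin / k%:R * obs_window k x y + coupling k * link_window k x y.
Definition lyapunov k x y : R := inner x y - 2 * correction k x y.

Definition correction_bound : R := bmin * (p%:R * Hbar ^+ 2) + kap * (n%:R * link_bound).

Lemma coupling_ge0 k : 0 <= coupling k.
Proof. by rewrite mulr_ge0 ?powR_ge0. Qed.

Lemma correction_bound_ge0 : 0 <= correction_bound.
Proof. by rewrite addr_ge0// !mulr_ge0 ?link_bound_ge0 ?sqr_ge0// ltW. Qed.

Lemma obs_window_psd k : psd_form (obs_window k).
Proof.
apply: psd_form_sum => s; apply: psd_formZ; first by rewrite divr_ge0.
exact: obs_form_psd.
Qed.

Lemma link_window_psd k : psd_form (link_window k).
Proof.
apply: psd_form_sum => s; apply: psd_formZ; first by rewrite divr_ge0.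
exact: link_form_psd.
Qed.

Lemma correction_psd k : psd_form (correction k).
Proof.
apply: psd_formD; apply: psd_formZ.
- by rewrite divr_ge0// ltW.
- exact: obs_window_psd.
- exact: coupling_ge0.
- exact: link_window_psd.
Qed.

Lemma window_sum_le k x :
  bmin * obs_window k x x + kap * link_window k x x <= correction_bound * inner x x.
Proof.
rewrite mulrDl -[bmin * _ * _]mulrA -[kap * _ * _]mulrA.
apply: lerD; apply: ler_wpM2l => //; first exact: ltW.
  rewrite -mulrA; apply: window_le => // j j0.
  by rewrite (psd_ge0 x (obs_form_psd j)) obs_form_le.
rewrite -mulrA; apply: window_le => // j j0.
by rewrite (psd_ge0 x (link_form_psd j)) link_form_le.
Qed.

Lemma correction_le k x : (0 < k)%N ->
  correction k x x <= correction_bound * k%:R `^ (- (1 - eps)) * inner x x.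
Proof.
move=> k0; rewrite mulrAC.
apply: le_trans (ler_wpM2r (powR_ge0 _ _) (window_sum_le k x)).
rewrite mulrDl; apply: lerD; last by rewrite /coupling mulrAC.
rewrite [leRHS]mulrAC; apply: ler_wpM2r; first exact: (psd_ge0 x (obs_window_psd k)).
apply: ler_wpM2l; first exact: ltW.
by rewrite -natpowN1; apply: ler_natpow => //; have := eps_range; lra.
Qed.

Lemma lyapunov_le k x : lyapunov k x x <= inner x x.
Proof. by rewrite lerBlDr lerDl mulr_ge0// (psd_ge0 x (correction_psd k)). Qed.

Definition correction_small k := correction_bound * k%:R `^ (- (1 - eps)) <= 4^-1.

Lemma lyapunov_ge k x : (0 < k)%N -> correction_small k -> inner x x <= 2 * lyapunov k x x.
Proof.
move=> k0 small; have := ler_wpM2r (inner_ge0 x) small.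
by move=> /(le_trans (correction_le x k0)); rewrite /lyapunov; lra.
Qed.

Lemma lyapunov_psd k : (0 < k)%N -> correction_small k -> psd_form (lyapunov k).
Proof.
move=> k0 small; have [inner_sym inner_lin inner_nneg] := inner_psd.
have [corr_sym corr_lin corr_nneg] := correction_psd k.
split => [x y|c x y z|x]; first by rewrite /lyapunov inner_sym corr_sym.
  by rewrite /lyapunov inner_lin corr_lin; ring.
by have := lyapunov_ge x k0 small; have := inner_ge0 x; lra.
Qed.

Lemma coupling_diff k : (0 < k)%N ->
  coupling k - coupling k.+1 <= 2 * kap * k.+1%:R `^ (- (2 - eps)).
Proof.
move=> k0; have e_range : 0 <= 1 - eps <= 1 by have := eps_range; lra.
have /andP[_ diff_le] := natpow_diff_bounds k0 e_range.
rewrite -mulrBr [2 * kap]mulrC -mulrA (_ : 2 - eps = 1 + (1 - eps)); last by ring.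
exact: ler_wpM2l.
Qed.

Lemma obs_coef_diff k : (0 < k)%N ->
  bmin / k%:R - bmin / k.+1%:R <= 2 * bmin * k.+1%:R `^ (- (2 - eps)).
Proof.
move=> k0; have unit_range : 0 <= (1 : R) <= 1 by rewrite ler01 /=.
have /andP[_ diff_le] := natpow_diff_bounds k0 unit_range.
rewrite -mulrBr [2 * bmin]mulrC -mulrA -!natpowN1; apply: ler_wpM2l; first exact: ltW.
apply: (le_trans diff_le); apply: ler_wpM2l => //.
by apply: ler_natpow => //; have := eps_range; lra.
Qed.

Lemma correction_cross_le k x f (F : R) : (0 < k)%N -> 0 <= F ->
  inner f f <= F ^+ 2 * inner x x ->
  - correction k x f <= correction_bound * k%:R `^ (- (1 - eps)) * F * inner x x.
Proof.
move=> k0 F0 f_le; set L := correction_bound * _; set J := inner x x in f_le *.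
have J0 : 0 <= J by exact: inner_ge0.
have L0 : 0 <= L by rewrite mulr_ge0 ?correction_bound_ge0 ?powR_ge0.
have LFJ0 : 0 <= L * F * J by apply: mulr_ge0 => //; exact: mulr_ge0.
suff abs_le : `|correction k x f| <= L * F * J.
  by apply: le_trans abs_le; rewrite -normrN ler_norm.
rewrite -(@ler_pXn2r _ 2) ?nnegrE ?LFJ0// real_normK ?num_real//.
apply: (le_trans (psd_cauchy x f (correction_psd k))).
have -> : (L * F * J) ^+ 2 = (L * J) * (L * (F ^+ 2 * J)) by ring.
apply: ler_pM; [exact: (psd_ge0 x (correction_psd _))|
  exact: (psd_ge0 f (correction_psd _))|exact: correction_le|].
by apply: (le_trans (correction_le f k0)); exact: ler_wpM2l.
Qed.

Definition dissipation k x : R :=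
  bmin / k%:R * obs_form k x x + coupling k * link_form k x x.

Definition average_dissipation k x : R :=
  bmin / k%:R * obs_average k x + coupling k * link_average k x.

Lemma correction_succ k x : (0 < k)%N ->
  correction k x x + average_dissipation k.+1 x <=
  correction k.+1 x x + dissipation k.+1 x
    + 2 * correction_bound * k.+1%:R `^ (- (2 - eps)) * inner x x.
Proof.
move=> k0; set q := k.+1%:R `^ (- (2 - eps)); have q0 : 0 <= q by exact: powR_ge0.
have obs_succ : obs_window k.+1 x x - obs_window k x x =
    obs_average k.+1 x - obs_form k.+1 x x by exact: (window_succ (fun j => obs_form j x x)).
have link_succ : link_window k.+1 x x - link_window k x x =
    link_average k.+1 x - link_form k.+1 x x by exact: (window_succ (fun j => link_form j x x)).
have obs_ge0 := psd_ge0 x (obs_window_psd k).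
have link_ge0 := psd_ge0 x (link_window_psd k).
have coef_le : (bmin / k%:R - bmin / k.+1%:R) * obs_window k x x
    + (coupling k - coupling k.+1) * link_window k x x <= 2 * correction_bound * q * inner x x.
  apply: (@le_trans _ _ (2 * q * (bmin * obs_window k x x + kap * link_window k x x))).
    apply: (le_trans (lerD (ler_wpM2r obs_ge0 (obs_coef_diff k0))
                           (ler_wpM2r link_ge0 (coupling_diff k0)))).
    by rewrite le_eqVlt; apply/orP; left; apply/eqP; rewrite -/q; ring.
  have -> : 2 * correction_bound * q * inner x x = 2 * q * (correction_bound * inner x x).
    by ring.
  by apply: ler_wpM2l; [exact: mulr_ge0|exact: window_sum_le].
have -> : correction k.+1 x x + dissipation k.+1 x =
   bmin / k.+1%:R * obs_window k x x + coupling k.+1 * link_window k x x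
     + average_dissipation k.+1 x.
  have -> : obs_window k x x = obs_window k.+1 x x - obs_average k.+1 x + obs_form k.+1 x x.
    by lra.
  have -> : link_window k x x =
    link_window k.+1 x x - link_average k.+1 x + link_form k.+1 x x by lra.
  by rewrite /correction /dissipation /average_dissipation; ring.
by move: coef_le; rewrite !mulrBl /correction -/q;
  move: (_ * obs_window k x x) (_ * obs_window k x x) (_ * link_window k x x)
    (_ * link_window k x x) => *; lra.
Qed.

Lemma average_dissipation_ge k x (c : R) : (0 < k)%N ->
  c <= rate (k%:R * coupling k) -> c / k%:R * inner x x <= average_dissipation k x.
Proof.
move=> k0 c_le; have kp : 0 < k%:R :> R by rewrite ltr0n.
have -> : average_dissipation k x =
  k%:R^-1 * (bmin * obs_average k x + k%:R * coupling k * link_average k x).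
  by rewrite /average_dissipation; field; rewrite gt_eqF.
rewrite mulrAC mulrC; apply: ler_wpM2l; first by rewrite invr_ge0 ltW.
apply: le_trans (rate_coercive k x _); last by rewrite mulr_ge0 ?coupling_ge0.
by apply: ler_wpM2r => //; exact: inner_ge0.
Qed.

Definition step_error k (link_slack F rate_slack : R) : R :=
  2 * link_slack * link_bound + F ^+ 2 + 4 * (correction_bound * k%:R `^ (- (1 - eps))) * F
    + 4 * correction_bound * k%:R `^ (- (2 - eps)) + 2 * rate_slack / k%:R.

Lemma lyapunov_step k x f (link_slack F a rate_slack : R) :
  (0 < k)%N -> 0 <= link_slack -> 0 <= F ->
  inner x f <= - (bmin / k.+1%:R * obs_form k.+1 x x)
    - (coupling k.+1 - link_slack) * link_form k.+1 x x ->
  inner f f <= F ^+ 2 * inner x x ->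
  a - rate_slack <= rate (k.+1%:R * coupling k.+1) ->
  lyapunov k.+1 (x + f) (x + f) <= lyapunov k x x - 2 * a / k.+1%:R * inner x x
    + step_error k.+1 link_slack F rate_slack * inner x x.
Proof.
move=> k0 link_slack0 F0 drift_le f_le a_le; set J := inner x x in f_le *.
have cross := correction_cross_le (ltn0Sn k) F0 f_le; rewrite -/J in cross.
have f_corr := psd_ge0 f (correction_psd k.+1).
have link_le : link_slack * link_form k.+1 x x <= link_slack * (link_bound * J).
  by apply: ler_wpM2l => //; exact: link_form_le.
have averaged := average_dissipation_ge x (ltn0Sn k) a_le; rewrite -/J in averaged.
have corr_succ := correction_succ x k0; rewrite -/J in corr_succ.
rewrite /lyapunov (psd_sqrD _ _ inner_psd) (psd_sqrD _ _ (correction_psd _)) -/J /step_error.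
have -> : 2 * a / k.+1%:R * J =
  2 * ((a - rate_slack) / k.+1%:R * J) + 2 * rate_slack / k.+1%:R * J by ring.
set L := correction_bound * _ in cross *.
set S := correction_bound * k.+1%:R `^ (- (2 - eps)).
have -> : (2 * link_slack * link_bound + F ^+ 2 + 4 * L * F
    + 4 * correction_bound * k.+1%:R `^ (- (2 - eps)) + 2 * rate_slack / k.+1%:R) * J =
  2 * (link_slack * (link_bound * J)) + F ^+ 2 * J + 4 * (L * F * J) + 4 * (S * J)
    + 2 * rate_slack / k.+1%:R * J by rewrite /S; ring.
rewrite -[2 * correction_bound * _]mulrA -/S -[2 * S * J]mulrA in corr_succ.
rewrite mulrBl in drift_le; rewrite /dissipation in corr_succ.
move: (bmin / k.+1%:R * obs_form k.+1 x x) (coupling k.+1 * link_form k.+1 x x)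
  drift_le corr_succ => obs_part link_part drift_le corr_succ.
move: ((a - rate_slack) / k.+1%:R * J) (2 * rate_slack / k.+1%:R * J) (S * J) (L * F * J)
  (F ^+ 2 * J) averaged corr_succ cross f_le => *.
lra.
Qed.

Definition contraction_const (F Clink Crate : R) : R :=
  2 * (2 * Clink * link_bound + F ^+ 2 + 4 * correction_bound * F + 4 * correction_bound
       + 2 * Crate).

Lemma contraction_const_ge0 (F Clink Crate : R) :
  0 <= F -> 0 <= Clink -> 0 <= Crate -> 0 <= contraction_const F Clink Crate.
Proof.
have := correction_bound_ge0; have := link_bound_ge0 => *.
by rewrite mulr_ge0// !addr_ge0 ?mulr_ge0// sqr_ge0.
Qed.

Let step_error_le k (F g s Clink Crate : R) : (0 < k)%N -> 0 <= F -> s <= 4^-1 ->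
  1 + s <= 2 * g -> 0 <= Crate ->
  2 * step_error k (Clink * k%:R `^ (- (1 + s))) (F * k%:R `^ (- g)) (Crate * k%:R `^ (- s))
    <= contraction_const F Clink Crate * k%:R `^ (- (1 + s)).
Proof.
move=> k0 F0 s_le sg Crate0; have := eps_range => e_range; have cb0 := correction_bound_ge0.
rewrite /contraction_const -mulrA ler_pM2l// /step_error.
set q : R := k%:R `^ (- (1 + s)).
have sqr_le : (F * k%:R `^ (- g)) ^+ 2 <= F ^+ 2 * q.
  rewrite exprMn natpow_sqr//; apply: ler_wpM2l; first exact: sqr_ge0.
  by apply: ler_natpow => //; lra.
have cross_le : correction_bound * k%:R `^ (- (1 - eps)) * (F * k%:R `^ (- g))
    <= correction_bound * F * q.
  rewrite mulrACA; apply: ler_wpM2l; first exact: mulr_ge0.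
  by rewrite -natpowD//; apply: ler_natpow => //; lra.
have corr_le : correction_bound * k%:R `^ (- (2 - eps)) <= correction_bound * q.
  by apply: ler_wpM2l => //; apply: ler_natpow => //; lra.
have -> : 2 * (Crate * k%:R `^ (- s)) / k%:R = 2 * Crate * q.
  by rewrite /q opprD natpowD// natpowN1; ring.
by move: (k%:R `^ (- (1 - eps))) (k%:R `^ (- g)) (k%:R `^ (- (2 - eps))) q sqr_le cross_le
  corr_le => A B C q; lra.
Qed.

Lemma lyapunov_contracts (a F g s Clink Crate : R) k x f : (0 < k)%N ->
  0 <= a -> 0 <= F -> s <= 4^-1 -> 1 + s <= 2 * g -> 0 <= Clink -> 0 <= Crate ->
  correction_small k ->
  inner x f <= - (bmin / k.+1%:R * obs_form k.+1 x x)
    - (coupling k.+1 - Clink * k.+1%:R `^ (- (1 + s))) * link_form k.+1 x x ->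
  inner f f <= (F * k.+1%:R `^ (- g)) ^+ 2 * inner x x ->
  a - Crate * k.+1%:R `^ (- s) <= rate (k.+1%:R * coupling k.+1) ->
  lyapunov k.+1 (x + f) (x + f) <=
  contraction_factor a (contraction_const F Clink Crate) s k.+1 * lyapunov k x x.
Proof.
move=> k0 a0 F0 s_le sg Clink0 Crate0 small drift_le f_le a_le.
have pow0 (e : R) : 0 <= k.+1%:R `^ e by exact: powR_ge0.
apply: (le_trans (lyapunov_step k0 (mulr_ge0 Clink0 (pow0 _)) (mulr_ge0 F0 (pow0 _))
  drift_le f_le a_le)).
have J_le := lyapunov_ge x k0 small; have J_ge := lyapunov_le k x; have J0 := inner_ge0 x.
have error_le := step_error_le Clink (ltn0Sn k) F0 s_le sg Crate0.
set c := contraction_const F Clink Crate * k.+1%:R `^ (- (1 + s)) in error_le *.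
have -> : contraction_factor a (contraction_const F Clink Crate) s k.+1 * lyapunov k x x =
  lyapunov k x x - 2 * a / k.+1%:R * lyapunov k x x + c * lyapunov k x x.
  by rewrite /contraction_factor -/c; ring.
have c0 : 0 <= c by rewrite mulr_ge0// contraction_const_ge0.
have rate_le : 2 * a / k.+1%:R * lyapunov k x x <= 2 * a / k.+1%:R * inner x x.
  by apply: ler_wpM2l => //; rewrite divr_ge0// mulr_ge0.
have := ler_wpM2r J0 error_le; have := ler_wpM2l c0 J_le; move: rate_le.
by move: (2 * a / k.+1%:R * _) (2 * a / k.+1%:R * _) (step_error _ _ _ _) => *; lra.
Qed.

End LyapunovForm.

Variables (nu b alpha1 gam : 'I_N -> 'I_N -> R) (beta1 : 'I_N -> R).
Variables (theta : 'cV[R]_n) (theta0 : 'I_N -> 'cV[R]_n).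
Hypothesis nu_ge0 : forall i j, 0 < aw i j -> 0 <= nu i j.
Hypothesis nu_sym : forall i j, 0 < aw i j -> nu i j = nu j i.
Hypothesis b_gt0 : forall i j, 0 < aw i j -> 0 < b i j.
Hypothesis b_sym : forall i j, 0 < aw i j -> b i j = b j i.
Hypothesis alpha1_gt0 : forall i j, 0 < aw i j -> 0 < alpha1 i j.
Hypothesis alpha1_sym : forall i j, 0 < aw i j -> alpha1 i j = alpha1 j i.
Hypothesis beta1_gt0 : forall i, 0 < beta1 i.
Hypothesis bmin_le : forall i, bmin <= beta1 i.
Hypothesis gam_range : forall i j, 0 < aw i j -> 1 / 2 < gam i j <= 1.
Hypothesis gam_sym : forall i j, 0 < aw i j -> gam i j = gam j i.

Local Notation alpha := (fun i j (k : nat) => alpha1 i j / (k%:R `^ gam i j)).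
Local Notation beta := (fun i (k : nat) => beta1 i / k%:R).
Local Notation G := (Gfun nu b).
Local Notation noise_index := (('I_N * 'I_N) + {i : 'I_N & 'I_(m i)})%type.

Let aw_swap i j : 0 < aw i j -> 0 < aw j i.
Proof. by rewrite aw_sym. Qed.

Definition gam_min : R := \big[Num.min/1]_(q : 'I_N * 'I_N | 0 < aw q.1 q.2) gam q.1 q.2.

Lemma gam_min_le i j : 0 < aw i j -> gam_min <= gam i j.
Proof. by move=> aij; exact: (@bigmin_le_cond _ _ _ 1 (i, j)). Qed.

Lemma gam_min_gt : 2^-1 < gam_min.
Proof.
apply: lt_bigmin => [|[i j] /= /gam_range]; last by rewrite div1r => /andP[].
by rewrite invf_lt1 ?ltr1n ?ltr0n.
Qed.

Lemma gam_min_le1 : gam_min <= 1.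
Proof. exact: bigmin_le_id. Qed.

Definition fnorm x : R := Num.sqrt (inner x x).

Lemma fnorm_ge0 x : 0 <= fnorm x.
Proof. exact: sqrtr_ge0. Qed.

Lemma sqr_fnorm x : fnorm x ^+ 2 = inner x x.
Proof. by rewrite sqr_sqrtr// inner_ge0. Qed.

Lemma entry_le_fnorm x i l : `|x i l| <= fnorm x.
Proof. by rewrite -sqrtr_sqr ler_sqrt ?inner_ge0// sqr_entry_le_inner. Qed.

Lemma Gfun_sym i j k u : 0 < aw i j -> G i j k u = G j i k u.
Proof. by move=> aij; rewrite /Gfun /Cthr nu_sym// b_sym. Qed.

Definition exchange k x (i : 'I_N) : R :=
  \sum_(j < N | 0 < aw i j) alpha i j k * aw i j *
    (G i j k (x j (tc k) + theta (tc k) 0) - G i j k (x i (tc k) + theta (tc k) 0)).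

Definition drift k x : E :=
  \matrix_(i, l) ((l == tc k)%:R * exchange k x i
    - beta i k * ((H i k)^T *m (H i k *m rowT x i)) l 0).

Definition link_coercive k x (c : R) := forall i j, 0 < aw i j ->
  c * (x i (tc k) - x j (tc k)) ^+ 2 <= alpha i j k * ((x i (tc k) - x j (tc k)) *
    (G i j k (x i (tc k) + theta (tc k) 0) - G i j k (x j (tc k) + theta (tc k) 0))).

(* Symmetrizing in [i] and [j] uses that the weights, the gains and the channels agree in both
   directions. *)
Lemma exchange_dissipative k x (c : R) : link_coercive k x c ->
  \sum_i x i (tc k) * exchange k x i <= - (c * link_form k x x).
Proof.
move=> coercive; pose g i j := if 0 < aw i j then alpha i j k * aw i j else 0.
pose X i := x i (tc k); pose Y i := X i + theta (tc k) 0.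
have g_sym i j : g i j = g j i.
  by rewrite /g (aw_sym j i); case: ifP => // aij; rewrite (alpha1_sym aij) (gam_sym aij).
have exchangeE : \sum_i x i (tc k) * exchange k x i =
    \sum_i \sum_j g i j * (X i * (G i j k (Y j) - G i j k (Y i))).
  apply: eq_bigr => i _; rewrite /exchange big_mkcond mulr_sumr; apply: eq_bigr => j _.
  by rewrite /g; case: ifP => _; rewrite ?mulr0 ?mul0r// /X /Y /X; ring.
have swapE : \sum_i \sum_j g i j * (X i * (G i j k (Y j) - G i j k (Y i))) =
    \sum_i \sum_j g i j * (X j * (G i j k (Y i) - G i j k (Y j))).
  rewrite exchange_big/=; apply: eq_bigr => i _; apply: eq_bigr => j _.
  rewrite g_sym /g; case: ifP => aij; last by rewrite !mul0r.
  by rewrite !(Gfun_sym _ _ aij).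
rewrite exchangeE -(ler_pM2l (ltr0n R 2)) mulr2n mulrDl mul1r [X in _ + X <= _]swapE.
rewrite -big_split/= /link_form mulrN !mulr_sumr -sumrN.
apply: ler_sum => i _; rewrite -big_split/= !mulr_sumr -sumrN; apply: ler_sum => j _.
rewrite -/(X i) -/(X j) /g; case: ifPn => aij; last first.
  have -> : aw i j = 0 by apply/eqP; rewrite eq_le aw_ge0 andbT leNgt.
  by rewrite !mul0r !mulr0 addr0 oppr0.
have := ler_wpM2l (ltW aij) (coercive i j aij); rewrite -/(X i) -/(X j) -/(Y i) -/(Y j).
move: (X i) (X j) (G i j k (Y i)) (G i j k (Y j)) => *; lra.
Qed.

Lemma inner_drift_split k x : inner x (drift k x) =
  \sum_i x i (tc k) * exchange k x i - \sum_i beta i k * \sum_l (H i k *m rowT x i) l 0 ^+ 2.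
Proof.
rewrite -sumrB; apply: eq_bigr => i _.
have -> : \sum_l x i l * drift k x i l =
   \sum_l (x i l * ((l == tc k)%:R * exchange k x i)
          - beta i k * (x i l * ((H i k)^T *m (H i k *m rowT x i)) l 0)).
  by apply: eq_bigr => l _; rewrite [drift k x i l]mxE; ring.
rewrite sumrB -mulr_sumr; congr (_ - _ * _).
  rewrite (bigD1 (tc k))//= eqxx mul1r big1 ?addr0// => l /negPf ->.
  by rewrite mul0r mulr0.
transitivity (((rowT x i)^T *m ((H i k)^T *m (H i k *m rowT x i))) 0 0).
  by rewrite mxE; apply: eq_bigr => l _; rewrite [in RHS]mxE rowTE.
rewrite mulmxA -trmx_mul mxE; apply: eq_bigr => l _.
by rewrite [(_ ^T) _ _]mxE expr2.
Qed.

Lemma inner_drift_le k x (c : R) : (0 < k)%N -> link_coercive k x c ->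
  inner x (drift k x) <= - (bmin / k%:R * obs_form k x x) - c * link_form k x x.
Proof.
move=> k0 coercive; rewrite inner_drift_split [leRHS]addrC.
apply: lerB; first exact: exchange_dissipative.
rewrite obs_formE mulr_sumr; apply: ler_sum => i _.
by apply: ler_wpM2r; [exact: sum_sqr_ge0|rewrite ler_pM2r ?invr_gt0 ?ltr0n].
Qed.

Lemma obs_entry_le i k x q : (0 < k)%N -> `|(H i k *m rowT x i) q 0| <= Hbar * fnorm x.
Proof.
move=> k0; rewrite -(@ler_pXn2r _ 2) ?nnegrE ?mulr_ge0 ?fnorm_ge0// real_normK ?num_real//.
rewrite exprMn sqr_fnorm; apply: (le_trans (sqr_entry_le _ _)).
apply: (le_trans (obs_row_le x i k0)); apply: ler_wpM2l; first exact: sqr_ge0.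
exact: sqr_row_le_inner.
Qed.

Definition exchange_const (i : 'I_N) : R :=
  \sum_(j < N | 0 < aw i j) alpha1 i j * aw i j * (2 / b i j).

Definition obs_const (i : 'I_N) : R := beta1 i * (m i)%:R * Hbar ^+ 2.

Definition drift_const : R :=
  Num.sqrt (\sum_(i < N) \sum_(l < n) (exchange_const i + obs_const i) ^+ 2).

Lemma exchange_normr_le k x i : (0 < k)%N ->
  `|exchange k x i| <= exchange_const i * k%:R `^ (- gam_min) * fnorm x.
Proof.
move=> k0; apply: (le_trans (ler_norm_sum _ _ _)); rewrite !mulr_suml; apply: ler_sum => j aij.
have b0 := b_gt0 aij; have al0 := alpha1_gt0 aij.
rewrite normrM ger0_norm; last by rewrite !mulr_ge0 ?invr_ge0 ?powR_ge0// ltW.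
have -> : alpha1 i j * aw i j * (2 / b i j) * k%:R `^ (- gam_min) * fnorm x =
  (alpha1 i j * k%:R `^ (- gam_min) * aw i j) * (2 * fnorm x / b i j) by ring.
apply: ler_pM => //; first by rewrite !mulr_ge0 ?invr_ge0 ?powR_ge0// ltW.
  apply: ler_wpM2r => //; apply: ler_wpM2l; first exact: ltW.
  by rewrite -powRN; apply: ler_natpow => //; rewrite lerN2; exact: gam_min_le.
apply: (le_trans (Gfun_lipschitz nu k b0 _ _)); rewrite ler_pM2r ?invr_gt0//.
have -> : x j (tc k) + theta (tc k) 0 - (x i (tc k) + theta (tc k) 0) =
  x j (tc k) - x i (tc k) by ring.
apply: (le_trans (ler_normB _ _)).
by have := entry_le_fnorm x j (tc k); have := entry_le_fnorm x i (tc k); lra.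
Qed.

Lemma obs_gradient_normr_le k x i l : (0 < k)%N ->
  `|beta i k * ((H i k)^T *m (H i k *m rowT x i)) l 0| <=
  obs_const i * k%:R `^ (- gam_min) * fnorm x.
Proof.
move=> k0; rewrite normrM ger0_norm; last by rewrite divr_ge0// ltW.
have -> : obs_const i * k%:R `^ (- gam_min) * fnorm x =
  (beta1 i * k%:R `^ (- gam_min)) * ((m i)%:R * (Hbar * (Hbar * fnorm x))).
  by rewrite /obs_const; ring.
apply: ler_pM => //; first by rewrite divr_ge0// ltW.
  apply: ler_wpM2l; first exact: ltW.
  by rewrite -natpowN1; apply: ler_natpow => //; rewrite lerN2 gam_min_le1.
rewrite mxE; apply: (le_trans (ler_norm_sum _ _ _)).
apply: (@le_trans _ _ (\sum_(q < m i) Hbar * (Hbar * fnorm x))).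
  apply: ler_sum => q _; rewrite mxE normrM; apply: ler_pM => //.
    exact: opnorm_le_entry (H_bnd i k0).
  exact: obs_entry_le.
by rewrite sumr_const card_ord mulr_natl.
Qed.

Lemma drift_const_ge0 : 0 <= drift_const.
Proof. exact: sqrtr_ge0. Qed.

Lemma drift_le k x : (0 < k)%N ->
  inner (drift k x) (drift k x) <= (drift_const * k%:R `^ (- gam_min)) ^+ 2 * inner x x.
Proof.
move=> k0; rewrite innerE exprMn sqr_sqrtr; last first.
  by do 2 (apply: sumr_ge0 => ? _); exact: sqr_ge0.
rewrite -mulrA mulr_suml; apply: ler_sum => i _; rewrite mulr_suml; apply: ler_sum => l _.
rewrite -sqr_fnorm -!exprMn -[leLHS]real_normK ?num_real// mulrA.
have entry_le : `|drift k x i l| <=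
    (exchange_const i + obs_const i) * k%:R `^ (- gam_min) * fnorm x.
  rewrite mxE !mulrDl; apply: (le_trans (ler_normB _ _)); apply: lerD.
    apply: le_trans (exchange_normr_le x i k0).
    by rewrite normrM; case: (l == _); rewrite ?normr1 ?normr0 ?mul1r ?mul0r.
  exact: obs_gradient_normr_le.
by rewrite lerXn2r ?nnegrE// (le_trans _ entry_le).
Qed.

Definition gain (q : noise_index) k : E :=
  match q with
  | inl (i, j) => (if 0 < aw i j then alpha i j k * aw i j else 0) *: delta_mx i (tc k)
  | inr q' => \matrix_(i', l) ((i' == projT1 q')%:R *
                (beta (projT1 q') k * H (projT1 q') k (projT2 q') l))
  end.

Definition gain_coef (q : noise_index) : R :=
  match q with
  | inl (i, j) => if 0 < aw i j then (alpha1 i j * aw i j) ^+ 2 else 0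
  | inr q' => beta1 (projT1 q') ^+ 2 * (n%:R * Hbar ^+ 2)
  end.

Definition gain_exponent (q : noise_index) : R :=
  match q with inl (i, j) => 2 * gam i j | inr _ => 2 end.

Definition gain_bound (q : noise_index) k : R := gain_coef q * k%:R `^ (- gain_exponent q).

Lemma gain_coef_ge0 q : 0 <= gain_coef q.
Proof.
case: q => [[i j]|q'] /=; first by case: ifP => // _; rewrite sqr_ge0.
by rewrite mulr_ge0 ?sqr_ge0// mulr_ge0 ?sqr_ge0.
Qed.

Lemma gain_bound_ge0 q k : 0 <= gain_bound q k.
Proof. by rewrite mulr_ge0 ?gain_coef_ge0 ?powR_ge0. Qed.

Let sum_single_row (f : E) i : (forall i' l, i' != i -> f i' l = 0) ->
  inner f f = \sum_l f i l ^+ 2.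
Proof.
move=> f_row; rewrite innerE (bigD1 i)//= [X in _ + X]big1 ?addr0// => i' ii'.
by apply: big1 => l _; rewrite f_row// expr0n.
Qed.

Lemma gain_le q k : (0 < k)%N -> inner (gain q k) (gain q k) <= gain_bound q k.
Proof.
move=> k0; rewrite /gain_bound; case: q => [[i j]|[i q]] /=.
  rewrite (sum_single_row (i := i)) => [|i' l /negPf ii']; last by rewrite !mxE ii' mulr0.
  rewrite (bigD1 (tc k))//= [X in _ + X]big1 ?addr0; last first.
    by move=> l /negPf lk; rewrite !mxE lk andbF mulr0 expr0n.
  rewrite !mxE !eqxx mulr1; case: ifP => aij; last by rewrite expr0n mul0r.
  by rewrite -mulrN -natpow_sqr// -exprMn powRN mulrAC.
rewrite (sum_single_row (i := i)) => [|i' l /negPf ii']; last by rewrite !mxE /= ii' mul0r.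
have -> : k%:R `^ (- 2) = k%:R^-1 ^+ 2 :> R.
  by rewrite -natpowN1 natpow_sqr// mulrN1.
apply: (@le_trans _ _ (\sum_(l < n) (beta1 i / k%:R) ^+ 2 * Hbar ^+ 2)).
  apply: ler_sum => l _; rewrite !mxE /= eqxx mul1r exprMn.
  apply: ler_wpM2l; first exact: sqr_ge0.
  rewrite -real_normK ?num_real// lerXn2r ?nnegrE//.
  exact: opnorm_le_entry (H_bnd i k0).
rewrite sumr_const card_ord -[leLHS]mulr_natl exprMn.
by rewrite le_eqVlt; apply/orP; left; apply/eqP; ring.
Qed.

Section EntryMeasurability.
Context {d : measure_display} {T : measurableType d}.
Implicit Types X Y : T -> E.

Definition measurable_entries X := forall i l, measurable_fun setT (fun t => X t i l).

Lemma measurable_entriesD X Y : measurable_entries X -> measurable_entries Y ->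
  measurable_entries (fun t => X t + Y t).
Proof.
move=> mX mY i l; rewrite (_ : (fun _ => _) = (fun t => X t i l + Y t i l)).
  exact: measurable_funD.
by apply/funext => t; rewrite mxE.
Qed.

Lemma measurable_inner X Y : measurable_entries X -> measurable_entries Y ->
  measurable_fun setT (fun t => inner (X t) (Y t)).
Proof.
by move=> mX mY; apply: measurable_sum => i; apply: measurable_sum => l; apply: measurable_funM.
Qed.

Lemma measurable_mul_rowT X i k q : measurable_entries X ->
  measurable_fun setT (fun t => (H i k *m rowT (X t) i) q 0).
Proof.
move=> mX; rewrite (_ : (fun _ => _) = (fun t => \sum_l H i k q l * X t i l)).
  by apply: measurable_sum => l; apply: measurable_funM.
by apply/funext => t; rewrite mxE; apply: eq_bigr => l _; rewrite rowTE.
Qed.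

Lemma measurable_lyapunov kap eps k X Y : measurable_entries X -> measurable_entries Y ->
  measurable_fun setT (fun t => lyapunov kap eps k (X t) (Y t)).
Proof.
move=> mX mY; apply: measurable_funB; first exact: measurable_inner.
apply: measurable_funM => //; apply: measurable_funD; apply: measurable_funM => //;
  apply: measurable_sum => s; apply: measurable_funM => //; apply: measurable_sum => i;
  apply: measurable_sum => j.
  by apply: measurable_funM; exact: measurable_mul_rowT.
by apply: measurable_funM => //; apply: measurable_funM; apply: measurable_funB.
Qed.

Lemma measurable_drift k X : measurable_entries X -> measurable_entries (fun t => drift k (X t)).
Proof.
move=> mX i l; under eq_fun do rewrite mxE.
apply: measurable_funB; apply: measurable_funM => //.
  rewrite /exchange; under eq_fun do rewrite big_mkcond.
  apply: measurable_sum => j; case: (0 < aw i j) => //; apply: measurable_funM => //.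
  by apply: measurable_funB; apply: (measurableT_comp (measurable_Gfun _ _ _ _ _));
    apply: measurable_funD.
rewrite (_ : (fun _ => _) = (fun t => \sum_q (H i k)^T l q * (H i k *m rowT (X t) i) q 0)).
  by apply: measurable_sum => q; apply: measurable_funM => //; exact: measurable_mul_rowT.
by apply/funext => t; rewrite mxE.
Qed.

End EntryMeasurability.

Context {d : measure_display} {T : measurableType d}.
Variable P : probability T R.
Variable w : forall i : 'I_N, nat -> T -> 'cV[R]_(m i).
Variable dn : 'I_N -> nat -> T -> R.
Hypothesis w_meas : forall i k (l : 'I_(m i)), measurable_fun setT (fun t => w i k t l 0).
Hypothesis d_meas : forall i k, measurable_fun setT (dn i k).

Local Notation estimate k t := (SC_est aw nu b alpha beta H theta theta0
  (fun i s => w i s t) (fun i s => dn i s t) k).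
Local Notation Fk k := (Fwd_gens w dn k).
Local Notation adapted k f := (measurable_fun [set: g_sigma_algebraType (Fk k)] f).

Definition error k (t : T) : E := \matrix_(i, l) (estimate k t i l 0 - theta l 0).

Definition state k (i : 'I_N) (t : T) : R := error k t i (tc k.+1) + theta (tc k.+1) 0.

Lemma xval_state k i t : xval (estimate k t) k.+1 i = state k i t.
Proof. by rewrite /xval phi_mul /state mxE subrK. Qed.

Definition innovation (q : noise_index) k (t : T) : R :=
  match q with
  | inl (i, j) => if 0 < aw i j then
      onebit (Cthr nu b j i k.+1) (state k j t + b j i * dn j k.+1 t)
        - G j i k.+1 (state k j t) else 0
  | inr q' => w (projT1 q') k.+1 t (projT2 q') 0
  end.

Lemma shat_onebit k i j t : shat nu b (fun i k => dn i k t) (estimate k t) j i k.+1 =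
  onebit (Cthr nu b j i k.+1) (state k j t + b j i * dn j k.+1 t).
Proof. by rewrite /shat /sbit /onebit xval_state. Qed.

Lemma edge_innovation_sum k i l t :
  (\sum_(q : 'I_N * 'I_N) innovation (inl q) k t *: gain (inl q) k.+1) i l =
  (l == tc k.+1)%:R * \sum_(j < N | 0 < aw i j) alpha i j k.+1 * aw i j *
    (onebit (Cthr nu b j i k.+1) (state k j t + b j i * dn j k.+1 t) - G i j k.+1 (state k j t)).
Proof.
pose F i' j := (innovation (inl (i', j)) k t *: gain (inl (i', j)) k.+1) i l.
rewrite summxE (eq_bigr (fun q => F q.1 q.2)); last by case.
rewrite -(pair_bigA _ F)/= /F.
rewrite (bigD1 i)//= [X in _ + X]big1 ?addr0; last first.
  move=> i' /negPf ii'; apply: big1 => j _.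
  by rewrite !mxE [i == _]eq_sym ii' !mulr0.
rewrite mulr_sumr [RHS]big_mkcond; apply: eq_bigr => j _.
rewrite !mxE eqxx /=; case: ifPn => aij; last by rewrite mul0r.
by rewrite (Gfun_sym _ _ aij); ring.
Qed.

Lemma obs_innovation_sum k i l t :
  (\sum_(q : {i : 'I_N & 'I_(m i)}) innovation (inr q) k t *: gain (inr q) k.+1) i l =
  beta i k.+1 * ((H i k.+1)^T *m w i k.+1 t) l 0.
Proof.
pose F i' q := (innovation (inr (existT _ i' q)) k t *: gain (inr (existT _ i' q)) k.+1) i l.
rewrite summxE (eq_bigr (fun q => F (tag q) (tagged q))); last by case.
rewrite -(sig_big_dep xpredT (fun _ _ => true) F)/= /F.
rewrite (bigD1 i)//= [X in _ + X]big1 ?addr0; last first.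
  move=> i' /negPf ii'; apply: big1 => q _.
  by rewrite !mxE /= [i == _]eq_sym ii' mul0r mulr0.
rewrite mxE mulr_sumr; apply: eq_bigr => q _.
by rewrite !mxE /= eqxx mul1r; ring.
Qed.

Lemma error_step k t : error k.+1 t =
  error k t + drift k.+1 (error k t) + \sum_q innovation q k t *: gain q k.+1.
Proof.
rewrite big_sumType/=; apply/matrixP => i l.
have addE (r c : nat) (A B : 'M[R]_(r, c)) i' j' : (A + B) i' j' = A i' j' + B i' j'.
  by rewrite mxE.
have scaleE (r c : nat) (s : R) (A : 'M[R]_(r, c)) i' j' : (s *: A) i' j' = s * A i' j'.
  by rewrite mxE.
rewrite [RHS]addE [X in _ = X + _]addE [X in _ = _ + X]addE edge_innovation_sum
  obs_innovation_sum.
rewrite [error k.+1 t i l]mxE [error k t i l]mxE [drift _ _ i l]mxE.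
set K := k.+1; set e := estimate k t.
have -> : estimate K t i = SC_step aw nu b alpha beta H theta (fun i k => w i k t)
  (fun i k => dn i k t) K e i by [].
have obsE : yobs H theta (fun i k => w i k t) i K - H i K *m e i =
    w i K t - H i K *m rowT (error k t) i.
  have -> : rowT (error k t) i = e i - theta by apply/colP => l'; rewrite !mxE.
  by rewrite /yobs mulmxBr; apply/colP => l'; rewrite !mxE; ring.
have phiE : phi R n K l 0 = (l == tc K)%:R by rewrite mxE.
rewrite /SC_step !addE !scaleE phiE obsE mulmxBr addE [(- _ : 'cV_n) l 0]mxE.
rewrite (eq_bigr (fun j => alpha i j K * aw i j *
    (G i j K (state k j t) - G i j K (state k i t)) + alpha i j K * aw i j *
    (onebit (Cthr nu b j i K) (state k j t + b j i * dn j K t) - G i j K (state k j t)))).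
  by rewrite big_split -/(exchange K (error k t) i) /=; ring.
by move=> j _; rewrite xval_state shat_onebit; ring.
Qed.

Lemma measurable_innovation k q :
  measurable_entries (T := g_sigma_algebraType (Fk k)) (error k) ->
  adapted k.+1 (innovation q k).
Proof.
move=> me; case: q => [[i j]|[i q]]; last exact: wcoord_adapted.
case: (boolP (0 < aw i j)) => [aij|/negPf aij]; last first.
  by rewrite (_ : innovation _ k = fun=> 0)//; apply/funext => t; rewrite /innovation aij.
rewrite (_ : innovation _ k = (fun t => onebit (Cthr nu b j i k.+1)
    (state k j t + b j i * dn j k.+1 t) - G j i k.+1 (state k j t))); last first.
  by apply/funext => t; rewrite /innovation aij.
have mstate : adapted k.+1 (state k j).
  apply: (gsigma_sub (Fwd_nondecreasing (leqnSn k))).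
  by apply: measurable_funD => //; exact: me.
apply: measurable_funB; last exact: measurableT_comp (measurable_Gfun _ _ _ _ _) mstate.
apply: (measurableT_comp (measurable_onebit _)).
by apply: measurable_funD => //; apply: measurable_funM => //; exact: dn_adapted.
Qed.

Lemma error_adapted k : measurable_entries (T := g_sigma_algebraType (Fk k)) (error k).
Proof.
elim: k => [i l|k IH].
  rewrite (_ : (fun _ => _) = cst (theta0 i l 0 - theta l 0)); first exact: measurable_cst.
  by apply/funext => t; rewrite mxE.
have me : measurable_entries (T := g_sigma_algebraType (Fk k.+1)) (error k).
  by move=> i l; apply: (gsigma_sub (Fwd_nondecreasing (leqnSn k))); exact: IH.
rewrite (_ : error k.+1 = fun t => error k t + drift k.+1 (error k t)
    + \sum_q innovation q k t *: gain q k.+1); last by apply/funext => t; exact: error_step.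
apply: measurable_entriesD; first by apply: measurable_entriesD => //; exact: measurable_drift.
move=> i l; rewrite (_ : (fun _ => _) = fun t => \sum_q innovation q k t * gain q k.+1 i l).
  by apply: measurable_sum => q; apply: measurable_funM => //; exact: measurable_innovation.
by apply/funext => t; rewrite summxE; apply: eq_bigr => q _; rewrite mxE.
Qed.

Lemma state_adapted k i : adapted k (state k i).
Proof. by apply: measurable_funD => //; exact: error_adapted. Qed.

Let F_meas k : <<s Fk k >> `<=` measurable.
Proof. exact: Fwd_measurable. Qed.

Lemma measurable_innovationT q k : measurable_fun setT (innovation q k).
Proof.
apply: (gsigma_measurable_fun (@F_meas k.+1)).
by apply: measurable_innovation; exact: error_adapted.
Qed.

Lemma measurable_stateT k i : measurable_fun setT (state k i).
Proof. exact: (gsigma_measurable_fun (@F_meas k) (@state_adapted k i)). Qed.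

Variable rho : R.
Hypothesis rho_gt2 : 2 < rho.
Hypothesis w_int : forall i k (l : 'I_(m i)), (0 < k)%N ->
  P.-integrable setT (fun t => (w i k t l 0)%:E).
Hypothesis w_mds : forall i k (l : 'I_(m i)) A, (0 < k)%N -> Fwd w dn k.-1 A ->
  (\int[P]_(t in A) (w i k t l 0)%:E = 0)%E.
Variable Z : 'I_N -> nat -> T -> \bar R.
Hypothesis w_mom : forall i k, (0 < k)%N ->
  cond_exp_nonneg P (Fw w k.-1) (fun t => (enorm (w i k t) `^ rho)%:E) (Z i k).
Hypothesis d_lap : forall i k (B : set R), (0 < k)%N -> measurable B ->
  P (dn i k @^-1` B) = (\int[lebesgue_measure]_(x in B) (lap_density x)%:E)%E.
Hypothesis d_indep : mutually_independent P
  (fun c : ('I_N * nat) + unit =>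
     match c with inl (i, k) => Fd dn i k | inr _ => Fw_all w end).

Definition moment_order : R := Num.min 2 (rho / 2).
Local Notation r := moment_order.

Lemma moment_order_range : 1 < r <= 2.
Proof. by rewrite lt_min ge_min lexx ltr1n /= andbT; have := rho_gt2; lra. Qed.

Lemma moment_order_le : 2 * r <= rho.
Proof.
have : r <= rho / 2 by rewrite ge_min lexx orbT.
by lra.
Qed.

Lemma edge_innovation_mean_variance i j k A : <<s Fk k >> A -> 0 < aw i j ->
  \int[P]_(t in A) innovation (inl (i, j)) k t = 0 /\
  \int[P]_(t in A) (innovation (inl (i, j)) k t ^+ 2) <=
    4 * \int[P]_(t in A) trigger_prob nu b j i k.+1 (state k j t).
Proof.
move=> FA aij; have mA := F_meas FA; set C := Cthr nu b j i k.+1; have aji := aw_swap aij.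
have C0 : 0 <= C by apply: Cthr_ge0 => //; [exact: b_gt0|exact: nu_ge0].
pose dithered t := state k j t + b j i * dn j k.+1 t.
have -> : innovation (inl (i, j)) k =
    fun t => onebit C (dithered t) - G j i k.+1 (state k j t).
  by apply/funext => t; rewrite /innovation aij.
have indep B S : <<s Fk k >> B -> measurable S ->
    P (B `&` dn j k.+1 @^-1` S) = (P B * P (dn j k.+1 @^-1` S))%E.
  by move=> FB mS; exact: dn_indep.
have laplace S : measurable S -> P (dn j k.+1 @^-1` S) =
    (\int[lebesgue_measure]_(x in S) (lap_density x)%:E)%E by move=> mS; exact: d_lap.
have mean := onebit_mean (@F_meas k) (d_meas j k.+1) indep laplace (@state_adapted k j) FA
  (b_gt0 aji) C0.
split; last exact: (onebit_variance (@F_meas k) (d_meas j k.+1) indep laplace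
  (@state_adapted k j) FA (b_gt0 aji) C0).
rewrite RintegralB//; first by rewrite mean subrr.
  apply: (rintegrable_bounded P mA (K := 1)) => [|t _]; last exact: onebit_normr_le1.
  apply/measurable_funTS/(measurableT_comp (measurable_onebit _)).
  apply: measurable_funD; [exact: measurable_stateT|exact: measurable_funM].
apply: (rintegrable_bounded P mA (K := 1)) => [|t _]; last exact: Gfun_normr_le1.
apply/measurable_funTS/(measurableT_comp (measurable_Gfun _ _ _ _ _)).
exact: measurable_stateT.
Qed.

Lemma innovation_edge_le2 i j k t : `|innovation (inl (i, j)) k t| <= 2.
Proof.
rewrite /innovation; case: ifP => // _; last by rewrite normr0.
apply: (le_trans (ler_normB _ _)); have := Gfun_normr_le1 nu b j i k.+1 (state k j t).
have := onebit_normr_le1 (Cthr nu b j i k.+1) (state k j t + b j i * dn j k.+1 t); lra.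
Qed.

Lemma edge_moments i j k A v : <<s Fk k >> A -> 0 <= v ->
  (0 < aw i j -> forall t, A t -> trigger_prob nu b j i k.+1 (state k j t) <= v) ->
  centered_moments P r (innovation (inl (i, j)) k) A (16 * v).
Proof.
move=> FA v0 trigger_le; have mA := F_meas FA.
case: (boolP (0 < aw i j)) => [aij|/negPf aij]; last first.
  rewrite (_ : innovation _ k = fun=> 0); last by apply/funext => t; rewrite /innovation aij.
  by apply: centered_moments0 => //; [exact: moment_order_range|rewrite mulr_ge0].
have [mean0 variance] := edge_innovation_mean_variance FA aij.
have -> : 16 * v = 4 * (4 * v) by ring.
apply: (centered_moments_bounded moment_order_range mA) => //; last by rewrite mulr_ge0.
- exact: measurable_innovationT.
- exact: innovation_edge_le2.
apply: (le_trans variance); rewrite -mulrA ler_pM2l// -Rintegral_cst//.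
apply: le_Rintegral => //; [|exact: rintegrable_cst|by move=> t At; exact: trigger_le].
apply: (rintegrable_bounded P mA (K := 2)) => [|t _].
  apply/measurable_funTS/(measurableT_comp (measurable_trigger_prob _ _ _ _ _)).
  exact: measurable_stateT.
by rewrite ger0_norm ?trigger_prob_ge0// trigger_prob_le2.
Qed.

Lemma Fw_all_enorm_pow i k (B : set (\bar R)) : measurable B ->
  Fw_all w ((fun t => (enorm (w i k.+1 t) `^ rho)%:E) @^-1` B).
Proof.
move=> mB; pose gens := sigma_of_gens [set c | (1 <= c.2)%N] (wcoord w).
apply: (@gsigma_preimage _ _ gens) mB; apply/measurable_EFinP.
apply: (measurableT_comp (measurable_powR _)); apply: measurable_enorm => l.
exact: (@sigma_of_adapted _ _ _ _ _ (wcoord w) (existT _ i l, k.+1)).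
Qed.

Lemma obs_moments i (q : 'I_(m i)) k A (M : R) : <<s Fk k >> A ->
  (forall t, A t -> (Z i k.+1 t <= M%:E)%E) ->
  centered_moments P r (innovation (inr (existT _ i q)) k) A (1 + M).
Proof.
move=> FA Z_le; have mA := F_meas FA.
apply: (centered_moments_dominated (g := fun t => enorm (w i k.+1 t)) (rho := rho)
  moment_order_range mA).
- exact: w_meas.
- by apply: (@integrableS _ _ _ P setT) => //; exact: w_int.
- by rewrite /Rintegral /= w_mds.
- by apply: measurable_enorm => l; exact: w_meas.
- by move=> t; exact: entry_le_enorm.
- exact: moment_order_le.
have pow_ge0 t : (0 <= (enorm (w i k.+1 t) `^ rho)%:E)%E by rewrite lee_fin powR_ge0.
exact: (cond_moment_le w_meas d_meas d_indep pow_ge0 (@Fw_all_enorm_pow i k)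
  (w_mom i (ltn0Sn k)) FA Z_le).
Qed.

Hypothesis nu_gam : forall i j, 0 < aw i j -> nu i j + gam i j <= 1.
Local Notation l1 := (l1norm theta).

Definition pair_coef i j (K : R) : R := alpha1 i j * expR (- K / b i j) / b i j.

Definition pair_coupling i j k (K : R) : R := pair_coef i j K * k%:R `^ (- (gam i j + nu i j)).

Lemma pair_coef_gt0 i j (K : R) : 0 < aw i j -> 0 < pair_coef i j K.
Proof. by move=> aij; rewrite divr_gt0 ?b_gt0// mulr_gt0 ?expR_gt0 ?alpha1_gt0. Qed.

Lemma pair_coupling_nonincreasing i j k (K K' : R) : 0 < aw i j -> K <= K' ->
  pair_coupling i j k K' <= pair_coupling i j k K.
Proof.
move=> aij KK'; apply: ler_wpM2r; first exact: powR_ge0.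
rewrite ler_pM2r ?invr_gt0 ?b_gt0//; apply: ler_wpM2l; first exact/ltW/alpha1_gt0.
by rewrite ler_expR ler_pM2r ?invr_gt0 ?b_gt0// lerN2.
Qed.

Lemma link_coercive_pair_coupling k x (c K : R) : (0 < k)%N ->
  (forall i, `|x i (tc k) + theta (tc k) 0| <= K) ->
  (forall i j, 0 < aw i j -> c <= pair_coupling i j k K) -> link_coercive k x c.
Proof.
move=> k0 xK c_le i j aij.
have := Gfun_coercive (b_gt0 aij) k0 (nu_ge0 aij) (xK i) (xK j).
rewrite (_ : x i (tc k) + theta (tc k) 0 - (x j (tc k) + theta (tc k) 0) =
  x i (tc k) - x j (tc k)); last by ring.
set u := x i (tc k) - x j (tc k) => coercive.
apply: (@le_trans _ _ (pair_coupling i j k K * u ^+ 2)).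
  by apply: ler_wpM2r; [exact: sqr_ge0|exact: c_le].
have -> : pair_coupling i j k K * u ^+ 2 =
    alpha i j k * (channel_slope nu b i j k K * u ^+ 2).
  rewrite /pair_coupling /pair_coef /channel_slope opprD natpowD// [_ `^ (- gam i j)]powRN.
  by ring.
by apply: ler_wpM2l => //; rewrite divr_ge0 ?powR_ge0// ltW// alpha1_gt0.
Qed.

(* As long as the error is at most [radius k], all couplings are at least
   [kap k^(-(1 - eps))] and the Lyapunov function contracts at rate [a], both up to
   summable corrections. *)
Definition couples_at_rate (a : R) (radius : nat -> \bar R) : Prop :=
  exists (kap eps s Clink Crate : R) (k1 : nat), [/\ 0 <= kap, 0 <= eps <= 4^-1,
    0 < s <= 4^-1 /\ 1 + s <= 2 * gam_min, 0 <= Clink /\ 0 <= Crate &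
    forall k, (k1 <= k)%N -> (1 < k)%N ->
      a - Crate * k%:R `^ (- s) <= rate (k%:R * coupling kap eps k) /\
      forall i j (y : R), 0 < aw i j -> 0 <= y -> (y%:E <= radius k)%E ->
        coupling kap eps k - Clink * k%:R `^ (- (1 + s)) <= pair_coupling i j k (l1 + y)].

Lemma margin_exists (c : R) : 0 < c ->
  exists s, [/\ 0 < s <= 4^-1, s <= c & 1 + s <= 2 * gam_min].
Proof.
move=> c0; have g_gt := gam_min_gt; have g_pos : 0 < 2 * gam_min - 1 by lra.
exists (Num.min 4^-1 (Num.min c (2 * gam_min - 1))); split.
- by rewrite !lt_min c0 g_pos invr_gt0 ltr0n ge_min lexx.
- by rewrite !ge_min lexx orbT.
by rewrite -lerBrDl !ge_min lexx !orbT.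
Qed.

Lemma coupling0E kap k : (0 < k)%N -> k%:R * coupling kap 0 k = kap.
Proof.
by move=> k0; rewrite /coupling subr0 natpowN1 mulrCA divff ?mulr1// pnatr_eq0 -lt0n.
Qed.

Lemma couples_at_rate0 radius : couples_at_rate 0 radius.
Proof.
have [s [s_range _ s_g]] := margin_exists ltr01.
exists 0, 0, s, 0, 0, 0%N; split => //; first by rewrite lexx invr_ge0 ler0n.
move=> k _ k1; split; first by rewrite mul0r subr0 coupling0E ?(ltnW k1)// /rate !mulr0 mul0r.
move=> i j y aij _ _; rewrite /coupling !mul0r subr0.
by rewrite mulr_ge0 ?powR_ge0// ltW// pair_coef_gt0.
Qed.

Lemma couples_at_rate_bounded (M : R) :
  exists2 a, 0 < a <= (2 * gam_min - 1) / 4 & couples_at_rate a (fun=> M%:E).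
Proof.
have g_gt : 0 < (2 * gam_min - 1) / 4 by have := gam_min_gt; lra.
have [|[i j] /= aij|kap [/andP[kap0 _] kap_le]] := @finite_lower_bound R _
    (fun q : 'I_N * 'I_N => 0 < aw q.1 q.2) (fun q => pair_coef q.1 q.2 (l1 + M)) 0 1.
- exact: ltr01.
- exact: pair_coef_gt0.
have [s [s_range _ s_g]] := margin_exists ltr01.
exists (Num.min (rate kap) ((2 * gam_min - 1) / 4)).
  by rewrite lt_min rate_gt0// g_gt ge_min lexx orbT.
exists kap, 0, s, 0, 0, 0%N; split => //; [exact: ltW|by rewrite lexx invr_ge0 ler0n|].
move=> k _ k1; have k0 := ltnW k1; rewrite mul0r subr0 coupling0E// ge_min lexx; split=> //.
move=> i j y aij _; rewrite lee_fin mul0r subr0 => yM.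
apply: (@le_trans _ _ (pair_coupling i j k (l1 + M))); last first.
  by apply: pair_coupling_nonincreasing; rewrite ?lerD2l.
rewrite /coupling /pair_coupling; apply: ler_pM; [exact: ltW|exact: powR_ge0| |].
  exact: (kap_le (i, j)).
by apply: ler_natpow => //; have := nu_gam aij; lra.
Qed.

Lemma decaying_radius_le k (M e y : R) : (0 < k)%N -> 0 <= M -> 0 < e ->
  (y%:E <= (M * k%:R `^ (- e))%:E)%E -> y <= M.
Proof.
move=> k0 M0 e0; rewrite lee_fin => /le_trans; apply.
by rewrite -[leRHS]mulr1; apply: ler_wpM2l => //; apply: natpow_le1 => //; exact: ltW.
Qed.

Lemma couples_at_rate_noncritical (M e : R) : 0 <= M -> 0 < e ->
  (forall i j, 0 < aw i j -> nu i j + gam i j <> 1) ->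
  couples_at_rate (delta * bmin / N%:R) (fun k => (M * k%:R `^ (- e))%:E).
Proof.
move=> M0 e0 noncritical; pose Q (q : 'I_N * 'I_N) := 0 < aw q.1 q.2.
have [|[i j] /= aij|kap [/andP[kap0 _] kap_le]] :=
    @finite_lower_bound R _ Q (fun q => pair_coef q.1 q.2 (l1 + M)) 0 1.
- exact: ltr01.
- exact: pair_coef_gt0.
have [||eps [/andP[eps0 eps_le] eps_gap]] :=
    @finite_lower_bound R _ Q (fun q => 1 - (nu q.1 q.2 + gam q.1 q.2)) 0 4^-1.
- by rewrite invr_gt0.
- by move=> [i j] /= aij; rewrite subr_gt0 lt_neqAle nu_gam// andbT; apply/eqP/noncritical.
have [s [s_range s_eps s_g]] := margin_exists eps0.
exists kap, eps, s, 0, (rate_deficit / kap), 2%N; split => //.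
- exact: ltW.
- by rewrite (ltW eps0).
- by split => //; rewrite divr_ge0 ?rate_deficit_ge0 ?ltW.
move=> k _ k1; have k0 := ltnW k1; split.
  have -> : k%:R * coupling kap eps k = kap * k%:R `^ eps.
    rewrite /coupling mulrCA -{1}[k%:R]powRr1// -natpowD//.
    by congr (_ * _ `^ _); ring.
  apply: le_trans (rate_ge _); last by rewrite mulr_gt0 ?powR_gt0 ?ltr0n.
  rewrite lerD2l lerN2 [(kap * _)^-1]invfM mulrA -powRN.
  apply: ler_wpM2l; first by rewrite divr_ge0 ?rate_deficit_ge0 ?ltW.
  by apply: ler_natpow => //; rewrite lerN2.
move=> i j y aij y0 /(decaying_radius_le k0 M0 e0) yM; rewrite mul0r subr0.
apply: (@le_trans _ _ (pair_coupling i j k (l1 + M))); last first.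
  by apply: pair_coupling_nonincreasing; rewrite ?lerD2l.
rewrite /coupling /pair_coupling; apply: ler_pM; [exact: ltW|exact: powR_ge0| |].
  exact: (kap_le (i, j)).
by apply: ler_natpow => //; have := eps_gap (i, j) aij; rewrite /=; lra.
Qed.

Lemma noncritical_coupling_eventually (kap K : R) : 0 <= kap ->
  exists k1, forall i j k, 0 < aw i j -> nu i j + gam i j != 1 -> (k1 <= k)%N -> (0 < k)%N ->
    coupling kap 0 k <= pair_coupling i j k K.
Proof.
move=> kap0; pose Q (q : 'I_N * 'I_N) := (0 < aw q.1 q.2) && (nu q.1 q.2 + gam q.1 q.2 != 1).
have [|k1 eventually] := @finite_eventually _ Q (fun q k => (0 < k)%N ->
    coupling kap 0 k <= pair_coupling q.1 q.2 k K); last first.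
  by exists k1 => i j k aij ij_ne1 k1k; apply: (eventually (i, j)); rewrite /Q /= ?aij.
move=> [i j] /andP[/= aij ij_ne1].
have gap : 0 < 1 - (nu i j + gam i j) by rewrite subr_gt0 lt_neqAle nu_gam// ij_ne1.
have [k1 small] := natpow_small kap0 gap (pair_coef_gt0 K aij).
exists k1 => k k1k k0; rewrite /coupling /pair_coupling.
have -> : - (1 - 0) = - (1 - (nu i j + gam i j)) + - (gam i j + nu i j) by ring.
by rewrite natpowD// mulrA; apply: ler_wpM2r; [exact: powR_ge0|exact: small].
Qed.

Lemma critical_coupling_ge i j k (M e s y : R) : 0 < aw i j -> nu i j + gam i j = 1 ->
  (0 < k)%N -> s <= e -> 0 <= y <= M * k%:R `^ (- e) ->
  pair_coef i j l1 * k%:R^-1 - pair_coef i j l1 * (M / b i j) * k%:R `^ (- (1 + s))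
    <= pair_coupling i j k (l1 + y).
Proof.
move=> aij critical k0 s_le /andP[y0 y_le]; have b0 := b_gt0 aij.
have c0 := ltW (pair_coef_gt0 l1 aij); have k_inv : 0 <= k%:R^-1 :> R by rewrite invr_ge0.
rewrite /pair_coupling [gam i j + _]addrC critical natpowN1.
have -> : pair_coef i j (l1 + y) = pair_coef i j l1 * expR (- (y / b i j)).
  by rewrite /pair_coef opprD mulrDl expRD [- y / _]mulNr; ring.
apply: (@le_trans _ _ (pair_coef i j l1 * (1 - y / b i j) * k%:R^-1)); last first.
  by apply: ler_wpM2r => //; apply: ler_wpM2l => //; exact: expR_ge1Dx.
move: (pair_coef i j l1) c0 => c c0.
rewrite mulrBr mulr1 mulrBl lerD2l lerN2 -!mulrA; apply: ler_wpM2l => //.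
have -> : M * ((b i j)^-1 * k%:R `^ (- (1 + s))) = (M * k%:R `^ (- (1 + s))) / b i j by ring.
rewrite mulrCA [leRHS]mulrC ler_pM2l ?invr_gt0//.
have M0 : 0 <= M by have := powR_gt0 (- e) (_ : 0 < k%:R :> R); rewrite ltr0n => /(_ k0); nra.
apply: (le_trans (ler_wpM2r k_inv y_le)); rewrite -mulrA; apply: ler_wpM2l => //.
by rewrite -natpowN1 -natpowD//; apply: ler_natpow => //; lra.
Qed.

Lemma couples_at_rate_critical (M e kap : R) : 0 <= M -> 0 < e -> 0 <= kap ->
  (forall i j, 0 < aw i j -> nu i j + gam i j = 1 -> kap <= pair_coef i j l1) ->
  couples_at_rate (rate kap) (fun k => (M * k%:R `^ (- e))%:E).
Proof.
move=> M0 e0 kap0 kap_le.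
have [Clink Clink0 Clink_ge] := finite_upper_bound
  (fun q : 'I_N * 'I_N => pair_coef q.1 q.2 l1 * (M / b q.1 q.2)).
have [k1 noncritical] := noncritical_coupling_eventually (l1 + M) kap0.
have [s [s_range s_e s_g]] := margin_exists e0.
exists kap, 0, s, Clink, 0, k1; split => //; first by rewrite lexx invr_ge0 ler0n.
move=> k k1k k_gt1; have k0 := ltnW k_gt1; rewrite mul0r subr0 coupling0E//; split=> //.
move=> i j y aij y0 y_le; have yM := decaying_radius_le k0 M0 e0 y_le.
have Clink_term : 0 <= Clink * k%:R `^ (- (1 + s)) by rewrite mulr_ge0 ?powR_ge0.
have [critical|ij_ne1] := eqVneq (nu i j + gam i j) 1; last first.
  apply: (@le_trans _ _ (coupling kap 0 k)); first by rewrite lerBlDr lerDl.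
  apply: le_trans (noncritical i j k aij ij_ne1 k1k k0) _.
  by apply: pair_coupling_nonincreasing; rewrite ?lerD2l.
have y_range : 0 <= y <= M * k%:R `^ (- e) by rewrite y0 -lee_fin.
apply: le_trans (critical_coupling_ge aij critical k0 s_e y_range).
rewrite /coupling subr0 natpowN1; apply: lerB.
  by apply: ler_wpM2r; [rewrite invr_ge0|exact: kap_le].
by apply: ler_wpM2r; [exact: powR_ge0|exact: (Clink_ge (i, j))].
Qed.

Lemma state_le k i t : `|state k i t| <= l1 + fnorm (error k t).
Proof.
apply: (le_trans (ler_normD _ _)); rewrite addrC; apply: lerD; last exact: entry_le_fnorm.
rewrite /l1norm (bigD1 (tc k.+1))//= lerDl; exact: sumr_ge0.
Qed.

Definition moment_event (M : R) k : set T := [set t | forall i, (Z i k.+1 t <= M%:E)%E].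

Definition error_event (radius : nat -> \bar R) k : set T :=
  [set t | ((fnorm (error k t))%:E <= radius k.+1)%E].

Lemma moment_event_adapted M k : <<s Fk k >> (moment_event M k).
Proof.
rewrite (_ : moment_event M k =
    \bigcap_(i in [set: 'I_N]) (Z i k.+1 @^-1` `]-oo, M%:E]%classic)).
  apply: (@fin_bigcap_measurable _ (g_sigma_algebraType (Fk k))); first exact: finite_finset.
  move=> i _; apply: (Fw_sub_Fwd (k := k)).
  by have [_ [Z_adapted _]] := w_mom i (ltn0Sn k); apply: Z_adapted; exact: emeasurable_itv.
by apply/seteqP; split => t /= Z_le i; [move=> _|]; have := Z_le i; rewrite /= in_itv/=;
  [|apply].
Qed.

Lemma error_event_adapted radius k : <<s Fk k >> (error_event radius k).
Proof.
rewrite (_ : error_event radius k =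
    (fun t => (fnorm (error k t))%:E) @^-1` `]-oo, radius k.+1]%classic); last first.
  by apply/seteqP; split => t /=; rewrite in_itv.
apply: gsigma_preimage; last exact: emeasurable_itv.
apply/measurable_EFinP; rewrite /fnorm (_ : (fun _ => _) = fun t =>
  inner (error k t) (error k t) `^ 2^-1).
  apply: (measurableT_comp (measurable_powR _)).
  by apply: measurable_inner; exact: error_adapted.
by apply/funext => t; rewrite powR12_sqrt// inner_ge0.
Qed.

Definition trigger_decays (decay : 'I_N -> 'I_N -> R) (prob_coef : R) (radius : nat -> \bar R) :=
  forall i j k (u y : R), 0 < aw i j -> (1 < k)%N -> 0 <= y -> (y%:E <= radius k)%E ->
    `|u| <= l1 + y -> trigger_prob nu b j i k u <= prob_coef * k%:R `^ (- decay i j).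

Lemma trigger_decays0 radius : trigger_decays (fun _ _ => 0) 2 radius.
Proof. by move=> i j k u y _ _ _ _ _; rewrite oppr0 powRr0 mulr1 trigger_prob_le2. Qed.

Lemma trigger_decays_nu (M : R) (radius : nat -> \bar R) :
  (forall k (y : R), (1 < k)%N -> (y%:E <= radius k)%E -> y <= M) ->
  exists2 prob_coef, 0 <= prob_coef & trigger_decays nu prob_coef radius.
Proof.
move=> radius_le; have [prob_coef prob_coef0 prob_coef_ge] := finite_upper_bound
  (fun q : 'I_N * 'I_N => expR ((l1 + M) / b q.2 q.1)).
exists prob_coef => // i j k u y aij k1 y0 /(radius_le k y k1) yM u_le.
have b0 := b_gt0 (aw_swap aij).
apply: (le_trans (trigger_prob_le nu b0 (ltnW k1) u)); rewrite (nu_sym aij) mulrC.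
apply: ler_wpM2r; first exact: powR_ge0.
apply: le_trans (prob_coef_ge (i, j)); rewrite ler_expR /= ler_pM2r ?invr_gt0//.
by apply: (le_trans u_le); rewrite lerD2l.
Qed.

Section Stage.
Variables (a h wexp prob_coef M : R) (ell : nat -> R).
Variables (decay : 'I_N -> 'I_N -> R) (radius : nat -> \bar R).
Hypothesis decay_range : forall i j, 0 < aw i j -> 0 <= decay i j <= 2^-1.
Hypothesis h_le : forall i j, 0 < aw i j -> 2 * h <= 2 * gam i j + decay i j.
Hypothesis h_le1 : h <= 1.
Hypothesis wexp_ge0 : 0 <= wexp.
Hypothesis wexp_le_rate : wexp <= 2 * a.
Hypothesis wexp_le_noise : wexp <= 2 * h - 1.
Hypothesis ell_factor : weight_factor ell.
Hypothesis noise_small : noise_negligible a wexp (fun k => k%:R `^ (wexp - 2 * h) * ell k).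
Hypothesis prob_coef_ge0 : 0 <= prob_coef.
Hypothesis M_ge0 : 0 <= M.
Hypothesis trigger_le : trigger_decays decay prob_coef radius.

Definition stage_event k : set T := moment_event M k `&` error_event radius k.

Lemma stage_event_adapted k : <<s Fk k >> (stage_event k).
Proof. by apply: gsigmaI; [exact: moment_event_adapted|exact: error_event_adapted]. Qed.

Let noise_coef (q : noise_index) : R := match q with inl _ => 16 * prob_coef | inr _ => 1 + M end.
Let noise_exponent (q : noise_index) : R :=
  match q with inl (i, j) => decay i j | inr _ => 0 end.
Let noise_bound (q : noise_index) k : R := noise_coef q * k%:R `^ (- noise_exponent q).

Let noise_coef_ge0 q : 0 <= noise_coef q.
Proof. by case: q => [[i j]|q'] /=; rewrite ?mulr_ge0 ?addr_ge0. Qed.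

Let noise_bound_ge0 q k : 0 <= noise_bound q k.
Proof. by rewrite mulr_ge0 ?noise_coef_ge0 ?powR_ge0. Qed.

Let exponents_ge q : gain_coef q = 0 \/
  2 * h <= gain_exponent q + noise_exponent q /\ 0 <= noise_exponent q <= 2^-1.
Proof.
case: q => [[i j]|q'] /=.
  by case: ifP => aij; [right; split; [exact: h_le|exact: decay_range]|left].
by right; have := h_le1; rewrite lexx invr_ge0 ler0n; split => //; lra.
Qed.

Lemma innovation_moments q k A : (0 < k)%N -> <<s Fk k >> A -> A `<=` stage_event k ->
  centered_moments P r (innovation q k) A (noise_bound q k.+1).
Proof.
move=> k0 FA A_event; case: q => [[i j]|[i q]]; rewrite /noise_bound /=.
  rewrite -mulrA; apply: edge_moments => //; first by rewrite mulr_ge0 ?powR_ge0.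
  move=> aij t /A_event[_ error_le].
  exact: (trigger_le aij _ (fnorm_ge0 _) error_le (state_le _ _ _)).
by rewrite oppr0 powRr0 mulr1; apply: obs_moments => // t /A_event[].
Qed.

Let variance_const : R := \sum_q gain_coef q * noise_coef q.

Let gain_variance_le k : (0 < k)%N ->
  \sum_q gain_bound q k * noise_bound q k <= variance_const * k%:R `^ (- (2 * h)).
Proof.
move=> k0; rewrite mulr_suml; apply: ler_sum => q _; rewrite /gain_bound /noise_bound.
have [->|[exp_ge _]] := exponents_ge q; first by rewrite !mul0r.
rewrite mulrACA -natpowD//; apply: ler_wpM2l; first by rewrite mulr_ge0 ?gain_coef_ge0.
by apply: ler_natpow => //; lra.
Qed.

Let moment_const : R := \sum_q ell 2 `^ r * (gain_coef q `^ r * noise_coef q).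

Let gain_moment_le k : (1 < k)%N ->
  weight wexp ell k `^ r * \sum_q gain_bound q k `^ r * noise_bound q k <=
  moment_const * k%:R `^ (- (1 + (r - 1) / 2)).
Proof.
move=> k1; have k0 := ltnW k1; have [ell0 _] := ell_factor k1.
have /andP[r1 r2] := moment_order_range; have r0 : 0 <= r by lra.
rewrite /weight powRM ?powR_ge0 ?(ltW ell0)// mulr_sumr mulr_suml; apply: ler_sum => q _.
rewrite /gain_bound /noise_bound; have [->|[exp_ge /andP[noise0 noise_half]]] := exponents_ge q.
  by rewrite mul0r powR0 ?mul0r ?mulr0 ?mul0r// gt_eqF//; lra.
rewrite powRM ?powR_ge0 ?gain_coef_ge0// -!powRrM.
have -> : k%:R `^ (wexp * r) * ell k `^ r * (gain_coef q `^ r *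
    k%:R `^ (- gain_exponent q * r) * (noise_coef q * k%:R `^ (- noise_exponent q))) =
  ell k `^ r * (gain_coef q `^ r * noise_coef q) *
    (k%:R `^ (wexp * r) * k%:R `^ (- gain_exponent q * r) * k%:R `^ (- noise_exponent q)).
  by ring.
have coef0 : 0 <= gain_coef q `^ r * noise_coef q by rewrite mulr_ge0 ?powR_ge0.
rewrite -!natpowD//; apply: ler_pM; rewrite ?powR_ge0//; first by rewrite mulr_ge0 ?powR_ge0.
  apply: ler_wpM2r => //; apply: ge0_ler_powR; rewrite ?nnegrE ?(ltW ell0)//.
    by have [] := ell_factor (isT : (1 < 2)%N) => /ltW.
  exact: weight_factor_le.
apply: ler_natpow => //; have noise_le := wexp_le_noise.
have : (wexp - gain_exponent q) * r <= (noise_exponent q - 1) * r.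
  by apply: ler_wpM2r => //; lra.
nra.
Qed.

Section LyapunovDecrease.
Variables (kap eps s Clink Crate : R) (k1 : nat).
Hypothesis kap_ge0 : 0 <= kap.
Hypothesis eps_range : 0 <= eps <= 4^-1.
Hypothesis s_range : 0 < s <= 4^-1.
Hypothesis s_gam : 1 + s <= 2 * gam_min.
Hypothesis Clink_ge0 : 0 <= Clink.
Hypothesis Crate_ge0 : 0 <= Crate.
Hypothesis coupled : forall k, (k1 <= k)%N -> (1 < k)%N ->
  a - Crate * k%:R `^ (- s) <= rate (k%:R * coupling kap eps k) /\
  forall i j (y : R), 0 < aw i j -> 0 <= y -> (y%:E <= radius k)%E ->
    coupling kap eps k - Clink * k%:R `^ (- (1 + s)) <= pair_coupling i j k (l1 + y).

Local Notation Q k := (lyapunov kap eps k).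
Local Notation predicted k t := (error k t + drift k.+1 (error k t)).
Local Notation contraction_bound := (contraction_const kap drift_const Clink Crate).

Lemma stage_contraction k t : (k1 <= k)%N -> (0 < k)%N -> correction_small kap eps k ->
  stage_event k t -> Q k.+1 (predicted k t) (predicted k t) <=
    contraction_factor a contraction_bound s k.+1 * Q k (error k t) (error k t).
Proof.
move=> k1k k0 small [_ error_le]; have [a_le pair_ge] := coupled (leqW k1k) (k0 : 1 < k.+1)%N.
have a0 : 0 <= a by have := wexp_ge0; have := wexp_le_rate; lra.
have /andP[_ s_le] := s_range.
apply: (lyapunov_contracts kap_ge0 eps_range k0 a0 drift_const_ge0 s_le s_gam) => //.
  apply: inner_drift_le => //.
  apply: (@link_coercive_pair_coupling _ _ _ (l1 + fnorm (error k t))) => // [i|i j aij].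
    exact: state_le.
  by apply: pair_ge => //; exact: fnorm_ge0.
exact: drift_le.
Qed.

Let noise_term k : R := variance_const * (k%:R `^ (wexp - 2 * h) * ell k).
Let moment_term k : R := moment_const * k%:R `^ (- (1 + (r - 1) / 2)).

Let variance_const_ge0 : 0 <= variance_const.
Proof. by apply: sumr_ge0 => q _; rewrite mulr_ge0 ?gain_coef_ge0. Qed.

Let moment_term_ge0 k : 0 <= moment_term k.
Proof.
rewrite mulr_ge0 ?powR_ge0//; apply: sumr_ge0 => q _.
by rewrite !mulr_ge0 ?powR_ge0.
Qed.

Let noise_term_ge0 k : (1 < k)%N -> 0 <= noise_term k.
Proof. by move=> /ell_factor[ell0 _]; rewrite !mulr_ge0 ?powR_ge0 ?(ltW ell0). Qed.

Let moment_term_summable : tail_sum_bounded moment_term.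
Proof.
move=> k0 k01; apply: sum_boundedZ; first by apply: sumr_ge0 => q _; rewrite !mulr_ge0 ?powR_ge0.
apply: tail_sum_bounded_pow => //; have /andP[r1 _] := moment_order_range.
by rewrite divr_gt0//; lra.
Qed.

Let weighted_variance_range k : (1 < k)%N -> 0 <= weight wexp ell k *
  (\sum_q gain_bound q k * noise_bound q k) <= noise_term k.
Proof.
move=> k_gt1; have k0 := ltnW k_gt1; have w0 := ltW (weight_gt0 wexp ell_factor k_gt1).
apply/andP; split.
  by rewrite mulr_ge0//; apply: sumr_ge0 => q _; rewrite mulr_ge0 ?gain_bound_ge0.
apply: (le_trans (ler_wpM2l w0 (gain_variance_le k0))).
by rewrite /noise_term /weight natpowD// le_eqVlt; apply/orP; left; apply/eqP; ring.
Qed.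

Let weighted_moment_range k : (1 < k)%N -> 0 <= weight wexp ell k `^ r *
  (\sum_q gain_bound q k `^ r * noise_bound q k) <= moment_term k.
Proof.
move=> k_gt1; rewrite gain_moment_le// andbT mulr_ge0 ?powR_ge0//.
by apply: sumr_ge0 => q _; rewrite mulr_ge0 ?powR_ge0.
Qed.

Lemma shifted_lyapunov_bounded k0 (growth : nat -> R) (growth_prod : R) :
  (k1 <= k0)%N -> (1 < k0)%N -> (forall j, correction_small kap eps (j + k0)) ->
  (forall j, 0 <= contraction_factor a contraction_bound s (j + k0).+1) ->
  (forall j, 0 <= growth j) -> (forall l, \prod_(j < l) (1 + growth j) <= growth_prod) ->
  (forall j, power_step r (noise_factor noise_index)
    (weight wexp ell (j + k0).+1 * contraction_factor a contraction_bound s (j + k0).+1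
     / weight wexp ell (j + k0))
    (weight wexp ell (j + k0).+1 *
      \sum_q gain_bound q (j + k0).+1 * noise_bound q (j + k0).+1)
    (weight wexp ell (j + k0).+1 `^ r *
      \sum_q gain_bound q (j + k0).+1 `^ r * noise_bound q (j + k0).+1) (growth j)) ->
  {ae P, forall t, (forall j, stage_event (j + k0) t) -> exists C : R, forall j,
    weight wexp ell (j + k0) * Q (j + k0) (error (j + k0) t) (error (j + k0) t) <= C}.
Proof.
move=> k1_le k0_gt1 small contr0 growth0 prod_le step.
have shift_gt1 j : (1 < j + k0)%N by rewrite ltn_addl.
have predicted_entries k :
    measurable_entries (T := g_sigma_algebraType (Fk k)) (fun t => predicted k t).
  by apply: measurable_entriesD; [|apply: measurable_drift]; exact: error_adapted.
have gain_entries q k :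
    measurable_entries (T := g_sigma_algebraType (Fk k)) (fun=> gain q k.+1).
  by move=> i l; exact: measurable_cst.
have contracts j t : stage_event (j + k0) t ->
    Q (j + k0).+1 (predicted (j + k0) t) (predicted (j + k0) t) <=
    contraction_factor a contraction_bound s (j + k0).+1 *
    Q (j + k0) (error (j + k0) t) (error (j + k0) t).
  by apply: stage_contraction => //; [exact: leq_trans k1_le (leq_addl _ _)|exact: ltnW].
have lyapunov_gain_le q j :
    Q (j + k0).+1 (gain q (j + k0).+1) (gain q (j + k0).+1) <= gain_bound q (j + k0).+1.
  by apply: le_trans (gain_le q (ltn0Sn _)); exact: lyapunov_le.
exact: (weighted_lyapunov_bounded (J := noise_index)
  (fun j => @F_meas (j + k0)) (fun j => Fwd_nondecreasing (leqnSn (j + k0)))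
  (fun j => error_step (j + k0))
  (fun j => lyapunov_psd kap_ge0 eps_range (ltnW (shift_gt1 j)) (small j))
  (fun j => measurable_lyapunov _ _ _ (@error_adapted _) (@error_adapted _))
  (fun j => measurable_lyapunov _ _ _ (predicted_entries _) (predicted_entries _))
  (fun j q => measurable_lyapunov _ _ _ (predicted_entries _) (gain_entries q _))
  (fun j => @stage_event_adapted (j + k0)) contr0 contracts moment_order_range
  (fun q j => gain_bound_ge0 q (j + k0).+1) (fun q j => noise_bound_ge0 q (j + k0).+1)
  lyapunov_gain_le (fun q j A => @innovation_moments q (j + k0) A (ltnW (shift_gt1 j)))
  (fun j => weight_gt0 wexp ell_factor (shift_gt1 j)) growth0 prod_le step).
Qed.

Lemma stage_bounded_coupled : {ae P, forall t, (forall k, (1 < k)%N -> stage_event k t) ->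
  exists C : R, forall k, weight wexp ell k * inner (error k t) (error k t) <= C}.
Proof.
have /andP[s0 s_le] := s_range; have /andP[eps0 eps_le] := eps_range.
have [k2 small] : exists k2, forall k, (k2 <= k)%N -> (0 < k)%N -> correction_small kap eps k.
  by apply: natpow_small; [exact: correction_bound_ge0|lra|rewrite invr_gt0].
have s_unit : 0 < s <= 1 by lra.
have [k0 [k0_ge k0_gt1 contr0 [growth [growth_prod [growth0 prod_le recursion]]]]] :=
  weight_recursion (maxn k1 k2) moment_order_range wexp_ge0 wexp_le_rate s_unit
    (contraction_const_ge0 kap_ge0 drift_const_ge0 Clink_ge0 Crate_ge0)
    (noise_factor_ge0 noise_index) ell_factor noise_term_ge0
    (fun k _ => moment_term_ge0 k)
    (noise_negligibleZ variance_const_ge0 noise_small) moment_term_summable.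
have [k1_le k2_le] : (k1 <= k0)%N /\ (k2 <= k0)%N by apply/andP; rewrite -geq_max.
have shift_gt1 j : (1 < j + k0)%N by rewrite ltn_addl.
have shift_small j : correction_small kap eps (j + k0).
  by apply: small; [exact: leq_trans k2_le (leq_addl _ _)|exact: ltnW].
have bounded := shifted_lyapunov_bounded k1_le k0_gt1 shift_small contr0 growth0 prod_le
  (fun j => recursion j _ _ (weighted_variance_range (shift_gt1 j.+1))
     (weighted_moment_range (shift_gt1 j.+1))).
apply: filterS bounded => t bounded event.
have [j|C C_ge] := bounded; first exact: event.
apply: (@eventually_bounded _ _ k0 (2 * C)) => k k0k; rewrite -(subnK k0k).
move: (k - k0)%N => j; have := C_ge j; rewrite -(ler_pM2l (ltr0n R 2)) => /(le_trans _); apply.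
rewrite mulrCA ler_pM2l ?weight_gt0//.
by apply: (lyapunov_ge kap_ge0 eps_range) => //; exact: ltnW.
Qed.

End LyapunovDecrease.

Lemma stage_bounded : couples_at_rate a radius ->
  {ae P, forall t, (forall k, (1 < k)%N -> stage_event k t) ->
    exists C : R, forall k, weight wexp ell k * inner (error k t) (error k t) <= C}.
Proof.
move=> [kap [eps [s [Clink [Crate [k1
  [kap0 eps_range [s_range s_gam] [Clink0 Crate0] coupled]]]]]]].
exact: (stage_bounded_coupled kap0 eps_range s_range s_gam Clink0 Crate0 coupled).
Qed.

End Stage.

Hypothesis Z_bnd : {ae P, forall t, exists M : R, forall i k, (0 < k)%N -> (Z i k t <= M%:E)%E}.

Lemma ae_exhaust (A : nat -> set T) (Q : T -> Prop) :
  (forall M, {ae P, forall t, A M t -> Q t}) -> {ae P, forall t, exists M, A M t} ->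
  {ae P, forall t, Q t}.
Proof.
move=> AQ exA; apply: filterS2 (ae_foralln AQ) exA => t AQt [M AM].
exact: AQt AM.
Qed.

Lemma ae_from_stages (radius : nat -> nat -> \bar R) (Q : T -> Prop) :
  (forall M M' k, (M <= M')%N -> (radius M k <= radius M' k)%E) ->
  (forall M, {ae P, forall t, (forall k, (1 < k)%N -> stage_event M%:R (radius M) k t) -> Q t}) ->
  {ae P, forall t, exists M, forall k, (1 < k)%N -> error_event (radius M) k t} ->
  {ae P, forall t, Q t}.
Proof.
move=> radius_mono stageQ error_ex; apply: ae_exhaust stageQ _.
apply: filterS2 Z_bnd error_ex => t [M Z_le] [M' error_le].
have [Mn M_le] := exists_natr_ge M; exists (maxn Mn M') => k k1; split.
  move=> i; apply: (le_trans (Z_le i k.+1 isT)); rewrite lee_fin; apply: (le_trans M_le).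
  by rewrite ler_nat leq_maxl.
by apply: (le_trans (error_le k k1)); apply: radius_mono; exact: leq_maxr.
Qed.

Definition constant_radius (M : nat) : nat -> \bar R := fun=> M%:R%:E.

Definition polynomial_radius (M : nat) : nat -> \bar R :=
  fun k => (M%:R * k%:R `^ (- M.+1%:R^-1))%:E.

Let gam_margin : 0 < 2 * gam_min - 1. Proof. by have := gam_min_gt; lra. Qed.

Let tail_sum_bounded_gap (h c : R) : c < 2 * h - 1 ->
  tail_sum_bounded (fun k => k%:R `^ (c - 2 * h) * (1 : R)).
Proof.
move=> ch k0 k01; have gap : 0 < 2 * h - 1 - c by lra.
apply: sum_bounded_le (tail_sum_bounded_pow gap k01) => j.
by rewrite mulr1 le_eqVlt (_ : c - 2 * h = - (1 + (2 * h - 1 - c))) ?eqxx//; ring.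
Qed.

Lemma crude_stage_bounded (a M : R) radius : 0 <= a -> a <= (2 * gam_min - 1) / 4 -> 0 <= M ->
  couples_at_rate a radius ->
  {ae P, forall t, (forall k, (1 < k)%N -> stage_event M radius k t) ->
    exists C : R, forall k, k%:R `^ (2 * a) * inner (error k t) (error k t) <= C}.
Proof.
move=> a0 a_le M0 coupled; have gap := gam_margin.
have two_ge0 : 0 <= 2 :> R by rewrite ler0n.
have crude := @stage_bounded a gam_min (2 * a) 2 M (fun=> 1) (fun _ _ => 0) radius.
apply: filterS (crude _ _ _ _ _ _ _ _ two_ge0 M0 (@trigger_decays0 radius) coupled).
- move=> t bounded event; have [|C C_ge] := bounded; first exact: event.
  by exists C => k; have := C_ge k; rewrite /weight mulr1.
- by move=> i j _; rewrite lexx invr_ge0 ler0n.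
- by move=> i j aij; rewrite addr0 ler_pM2l// gam_min_le.
- exact: gam_min_le1.
- exact: mulr_ge0.
- exact: lexx.
- by lra.
- exact: weight_factor1.
- by left; apply: tail_sum_bounded_gap; lra.
Qed.

Lemma error_bounded : {ae P, forall t, exists M, forall k, (1 < k)%N ->
  error_event (constant_radius M) k t}.
Proof.
apply: (@ae_from_stages (fun _ _ => +oo%E)) => // [M|]; last first.
  by apply: aeW => t; exists 0%N => k _; rewrite /error_event /= leey.
have a_le : 0 <= (2 * gam_min - 1) / 4 by have := gam_margin; lra.
apply: filterS (crude_stage_bounded (lexx 0) a_le (ler0n R M) (couples_at_rate0 _)).
move=> t bounded /bounded[C C_ge]; have [Mn Mn_ge] := exists_natr_ge (Num.sqrt C).
exists Mn => k _; rewrite /error_event /= lee_fin; apply: le_trans Mn_ge.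
by apply: ler_wsqrtr; have := C_ge k; rewrite mulr0 powRr0 mul1r.
Qed.

Lemma polynomial_radius_exists (a C : R) t : 0 < a <= 1 ->
  (forall k, k%:R `^ (2 * a) * inner (error k t) (error k t) <= C) ->
  exists M, forall k, (1 < k)%N -> error_event (polynomial_radius M) k t.
Proof.
move=> /andP[a0 a1] C_ge; have [M M_ge] := exists_natr_ge (2 * Num.sqrt C + a^-1).
have a_inv : 0 <= a^-1 by rewrite invr_ge0 ltW.
have sqrtC0 := sqrtr_ge0 C; exists M => k k1; have k0 := ltnW k1.
have kp : 0 < k%:R `^ a :> R by rewrite powR_gt0// ltr0n.
have fnorm_le : fnorm (error k t) <= Num.sqrt C * k%:R `^ (- a).
  rewrite powRN ler_pdivlMr// -[k%:R `^ a]ger0_norm ?powR_ge0// -sqrtr_sqr mulrC.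
  by rewrite -sqrtrM ?sqr_ge0// natpow_sqr//; exact: ler_wsqrtr.
rewrite /error_event /= lee_fin; apply: (le_trans fnorm_le).
have a_range : 0 <= a <= 1 by rewrite ltW.
apply: (le_trans (ler_wpM2l sqrtC0 (natpow_succ_ge k0 a_range))); rewrite mulrCA mulrA.
apply: ler_pM; rewrite ?powR_ge0 ?mulr_ge0//; first by lra.
apply: ler_natpow => //; rewrite lerN2 -[leRHS]invrK lef_pV2 ?posrE ?invr_gt0 ?ltr0n//.
by rewrite -natr1; lra.
Qed.

Lemma error_polynomial_decay : {ae P, forall t, exists M, forall k, (1 < k)%N ->
  error_event (polynomial_radius M) k t}.
Proof.
apply: (@ae_from_stages constant_radius) error_bounded => [M M' k MM'|M].
  by rewrite lee_fin ler_nat.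
have [a /andP[a0 a_le] coupled] := couples_at_rate_bounded M%:R.
apply: filterS (crude_stage_bounded (ltW a0) a_le (ler0n R M) coupled) => t bounded event.
have [|C C_ge] := bounded; first exact: event.
have a_range : 0 < a <= 1 by rewrite a0 /=; have := gam_min_le1; lra.
exact: polynomial_radius_exists C_ge.
Qed.

Lemma error_rate (h a wexp : R) ell : h <= 1 ->
  (forall i j, 0 < aw i j -> h <= nu i j / 2 + gam i j) ->
  (forall M e : R, 0 <= M -> 0 < e -> couples_at_rate a (fun k => (M * k%:R `^ (- e))%:E)) ->
  0 <= wexp -> wexp <= 2 * a -> wexp <= 2 * h - 1 -> weight_factor ell ->
  noise_negligible a wexp (fun k => k%:R `^ (wexp - 2 * h) * ell k) ->
  {ae P, forall t, exists C : R, forall k, weight wexp ell k * inner (error k t) (error k t) <= C}.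
Proof.
move=> h_le1 h_le coupled wexp0 wexp_a wexp_h ell_factor noise_small.
apply: (@ae_from_stages polynomial_radius) error_polynomial_decay => [M M' k MM'|M].
  rewrite lee_fin; apply: ler_pM; rewrite ?powR_ge0 ?ler_nat//.
  have [->|k0] := posnP k; first by rewrite !powR0 ?oppr_eq0 ?invr_eq0 ?pnatr_eq0.
  by apply: ler_natpow => //; rewrite lerN2 lef_pV2 ?posrE ?ltr0n// ler_nat ltnS.
have radius_decay0 : 0 < M.+1%:R^-1 :> R by rewrite invr_gt0 ltr0n.
have [prob_coef prob_coef0 triggers] :
    exists2 c, 0 <= c & trigger_decays nu c (polynomial_radius M).
  apply: (@trigger_decays_nu M%:R) => k y k1.
  exact: decaying_radius_le (ltnW k1) (ler0n R M) radius_decay0.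
apply: (@stage_bounded a h wexp prob_coef M%:R ell nu (polynomial_radius M)) => //.
- move=> i j aij; rewrite nu_ge0//=.
  by have := nu_gam aij; have := gam_min_le aij; have := gam_min_gt; lra.
- by move=> i j aij; have := h_le i j aij; lra.
exact: coupled.
Qed.

Variables (h a m' : R).
Hypothesis h_def : (exists i j, 0 < aw i j /\ h = nu i j / 2 + gam i j) /\
  (forall i j, 0 < aw i j -> h <= nu i j / 2 + gam i j).
Hypothesis m'_def : (exists i j, 0 < aw i j /\ nu i j + gam i j = 1) ->
  (exists i j, [/\ 0 < aw i j, nu i j + gam i j = 1 & m' = pair_coef i j l1]) /\
  (forall i j, 0 < aw i j -> nu i j + gam i j = 1 -> m' <= pair_coef i j l1).
Hypothesis a_noncritical : (forall i j, 0 < aw i j -> nu i j + gam i j <> 1) ->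
  a = delta * bmin / N%:R.
Hypothesis a_critical : (exists i j, 0 < aw i j /\ nu i j + gam i j = 1) -> a = rate m'.

Let h_range : 2^-1 < h <= 1.
Proof.
have [[i [j [aij hE]]] h_le] := h_def; have := gam_range aij; have := nu_ge0 aij.
by have := nu_gam aij; rewrite hE div1r; lra.
Qed.

Let a_couples : 0 <= a /\ forall M e : R, 0 <= M -> 0 < e ->
  couples_at_rate a (fun k => (M * k%:R `^ (- e))%:E).
Proof.
case: (pselect (exists i j, 0 < aw i j /\ nu i j + gam i j = 1)) => [critical|no_critical].
  have [[i [j [aij _ m'E]]] m'_le] := m'_def critical.
  have m'0 : 0 < m' by rewrite m'E pair_coef_gt0.
  rewrite a_critical//; split; first exact/ltW/rate_gt0.
  by move=> M e M0 e0; exact: couples_at_rate_critical (ltW m'0) m'_le.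
have noncritical i j : 0 < aw i j -> nu i j + gam i j <> 1.
  by move=> aij ij_critical; apply: no_critical; exists i, j.
rewrite a_noncritical//; split; first by rewrite divr_ge0// ltW// mulr_gt0.
by move=> M e M0 e0; exact: couples_at_rate_noncritical.
Qed.

Definition rate_bound (i : 'I_N) (v : nat -> R) (t : T) : Prop :=
  exists C : R, forall k, (1 < k)%N -> enorm (estimate k t i - theta) <= C * v k.

Lemma enorm_le_fnorm k t i : enorm (estimate k t i - theta) <= fnorm (error k t).
Proof.
apply: ler_wsqrtr; apply: le_trans (sqr_row_le_inner (error k t) i).
by apply: ler_sum => l _; rewrite [error k t i l]mxE [(_ - _ : 'cV_n) l 0]mxE
  [(- _ : 'cV_n) l 0]mxE.
Qed.

Lemma rate_bound_of_weight (wexp : R) ell (v : nat -> R) i t :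
  (forall k, (1 < k)%N -> 0 <= v k /\ weight wexp ell k * v k ^+ 2 = 1) ->
  (exists C : R, forall k, weight wexp ell k * inner (error k t) (error k t) <= C) ->
  rate_bound i v t.
Proof.
move=> weightE [C C_ge]; exists (Num.sqrt C) => k k1; have [v0 wvE] := weightE k k1.
apply: (le_trans (enorm_le_fnorm k t i)); rewrite /fnorm.
have -> : inner (error k t) (error k t) =
    v k ^+ 2 * (weight wexp ell k * inner (error k t) (error k t)).
  by rewrite mulrA [v k ^+ 2 * _]mulrC wvE mul1r.
rewrite sqrtrM ?sqr_ge0// sqrtr_sqr ger0_norm// mulrC; apply: ler_wpM2r => //.
exact: ler_wsqrtr (C_ge k).
Qed.

Lemma rate_above_noise i : 1 < 2 * h - 2 * a ->
  {ae P, forall t, rate_bound i (fun k => k%:R `^ (- a)) t}.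
Proof.
move=> gap; have [a0 coupled] := a_couples; have /andP[h_gt h_le1] := h_range.
have wexp_h : 2 * a <= 2 * h - 1 by lra.
apply: filterS (error_rate h_le1 h_def.2 coupled (mulr_ge0 _ a0) (lexx _) wexp_h
  (@weight_factor1 R) _) => //; last by left; apply: tail_sum_bounded_gap; lra.
move=> t; apply: rate_bound_of_weight => k k1; split; first exact: powR_ge0.
by rewrite /weight mulr1 natpow_sqr ?(ltnW k1)// -natpowD ?(ltnW k1)// mulrN subrr powRr0.
Qed.

Let sqr_log_rate (u : R) k : (1 < k)%N ->
  (u / k%:R `^ (h - 1 / 2)) ^+ 2 = u ^+ 2 / k%:R `^ (2 * h - 1).
Proof.
move=> k1; rewrite exprMn exprVn natpow_sqr ?(ltnW k1)//.
by congr (_ / _ `^ _); field.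
Qed.

Let weight_log_rate (L u : R) k : (1 < k)%N -> L != 0 -> u ^+ 2 = L ->
  k%:R `^ (2 * h - 1) * L^-1 * (u / k%:R `^ (h - 1 / 2)) ^+ 2 = 1.
Proof.
move=> k1 L0 uE; rewrite sqr_log_rate// uE.
by field; rewrite L0 gt_eqF// powR_gt0// ltr0n ltnW.
Qed.

Lemma rate_below_noise i : 2 * h - 2 * a < 1 ->
  {ae P, forall t, rate_bound i (fun k => Num.sqrt (ln k%:R) / k%:R `^ (h - 1 / 2)) t}.
Proof.
move=> gap; have [a0 coupled] := a_couples; have /andP[h_gt h_le1] := h_range.
have wexp0 : 0 <= 2 * h - 1 by lra.
have wexp_a : 2 * h - 1 <= 2 * a by lra.
apply: filterS (error_rate h_le1 h_def.2 coupled wexp0 wexp_a (lexx _)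
  (weight_factor_ln R 1) _); last first.
  right; split; first by lra.
  exists 1 => // k k1; rewrite (_ : 2 * h - 1 - 2 * h = - 1); last by ring.
  by rewrite natpowN1 expr1 invfM mul1r.
move=> t; apply: rate_bound_of_weight => k k1; have lnk := ln_natr_gt0 R k1.
split; first by rewrite divr_ge0 ?sqrtr_ge0 ?powR_ge0.
by rewrite /weight weight_log_rate// ?expr1 ?gt_eqF// sqr_sqrtr// ltW.
Qed.

Lemma rate_at_noise i : 2 * h - 2 * a = 1 ->
  {ae P, forall t, rate_bound i (fun k => ln k%:R / k%:R `^ (h - 1 / 2)) t}.
Proof.
move=> gap; have [a0 coupled] := a_couples; have /andP[h_gt h_le1] := h_range.
have wexp0 : 0 <= 2 * h - 1 by lra.
have wexp_a : 2 * h - 1 <= 2 * a by lra.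
apply: filterS (error_rate h_le1 h_def.2 coupled wexp0 wexp_a (lexx _)
  (weight_factor_ln R 2) _); last first.
  left => k0 k01; apply: sum_bounded_le (tail_sum_bounded_ln (ltr1n R 2) k01) => j.
  rewrite (_ : 2 * h - 1 - 2 * h = - 1); last by ring.
  rewrite natpowN1 powRN powR_mulrn//.
  by apply/ltW/ln_natr_gt0; rewrite ltnS ltn_addl// ltnW.
move=> t; apply: rate_bound_of_weight => k k1; have lnk := ln_natr_gt0 R k1.
split; first by rewrite divr_ge0 ?powR_ge0 ?(ltW lnk).
by rewrite /weight weight_log_rate// gt_eqF// exprn_gt0.
Qed.

Let ae_imply (c : Prop) (Q : T -> Prop) :
  (c -> {ae P, forall t, Q t}) -> {ae P, forall t, c -> Q t}.
Proof.
move=> cQ; case: (pselect c) => [cT|nc]; first by apply: filterS (cQ cT) => t Qt _.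
by apply: aeW.
Qed.

Lemma estimate_rates i : {ae P, forall t,
  [/\ 1 < 2 * h - 2 * a -> rate_bound i (fun k => k%:R `^ (- a)) t,
      2 * h - 2 * a = 1 -> rate_bound i (fun k => ln k%:R / k%:R `^ (h - 1 / 2)) t &
      2 * h - 2 * a < 1 ->
        rate_bound i (fun k => Num.sqrt (ln k%:R) / k%:R `^ (h - 1 / 2)) t]}.
Proof.
apply: filterS3 (ae_imply (@rate_above_noise i)) (ae_imply (@rate_at_noise i))
  (ae_imply (@rate_below_noise i)) => t *.
by split.
Qed.

End SensorNetwork.

Theorem theorem4p3
  (R : realType) (dsp : measure_display) (T : measurableType dsp)
  (P : probability T R)
  (N n : nat) (m : 'I_N -> nat)
  (aw : 'I_N -> 'I_N -> R)
  (H : forall i : 'I_N, nat -> 'M[R]_(m i, n))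
  (theta : 'cV[R]_n) (theta0 : 'I_N -> 'cV[R]_n)
  (w : forall i : 'I_N, nat -> T -> 'cV[R]_(m i))
  (dn : 'I_N -> nat -> T -> R)
  (nu b alpha1 gam : 'I_N -> 'I_N -> R) (beta1 : 'I_N -> R)
  (Hbar delta : R) (p : nat) (rho : R)
  (h bmin m' a : R)
  (* network *)
  (aw_ge0 : forall i j, 0 <= aw i j)
  (aw_sym : forall i j, aw i j = aw j i)
  (aw_noloop : forall i, aw i i = 0)
  (* (A1) *)
  (Hbar_gt0 : 0 < Hbar)
  (H_bnd : forall i k, (0 < k)%N -> opnorm_le (H i k) Hbar)
  (p_gt0 : (0 < p)%N) (delta_gt0 : 0 < delta)
  (PE : forall k, (0 < k)%N ->
     loewner_ge (p%:R^-1 *: \sum_(k <= t < k + p) \sum_(i < N) (H i t)^T *m H i t)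
                (delta%:M))
  (* the noises are random variables *)
  (w_meas : forall i k (l : 'I_(m i)), measurable_fun setT (fun t => w i k t l 0))
  (d_meas : forall i k, measurable_fun setT (dn i k))
  (* (A2) *)
  (rho_gt2 : 2 < rho)
  (w_int : forall i k (l : 'I_(m i)), (0 < k)%N ->
     P.-integrable setT (fun t => (w i k t l 0)%:E))
  (w_mds : forall i k (l : 'I_(m i)) A, (0 < k)%N -> Fwd w dn k.-1 A ->
     (\int[P]_(t in A) (w i k t l 0)%:E = 0)%E)
  (w_mom : exists Z : 'I_N -> nat -> T -> \bar R,
     (forall i k, (0 < k)%N ->
        cond_exp_nonneg P (Fw w k.-1) (fun t => (enorm (w i k t) `^ rho)%:E) (Z i k)) /\
     {ae P, forall t, exists M : R, forall i k, (0 < k)%N -> (Z i k t <= M%:E)%E})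
  (* (A3) *)
  (conn : \rank (laplacian aw) = N.-1)
  (* (A4) *)
  (d_lap : forall i k (B : set R), (0 < k)%N -> measurable B ->
     P (dn i k @^-1` B) = (\int[lebesgue_measure]_(x in B) (lap_density x)%:E)%E)
  (d_indep : mutually_independent P
     (fun c : ('I_N * nat) + unit =>
        match c with inl (i, k) => Fd dn i k | inr _ => Fw_all w end))
  (* algorithm parameters *)
  (nu_ge0 : forall i j, 0 < aw i j -> 0 <= nu i j)
  (nu_sym : forall i j, 0 < aw i j -> nu i j = nu j i)
  (b_gt0 : forall i j, 0 < aw i j -> 0 < b i j)
  (b_sym : forall i j, 0 < aw i j -> b i j = b j i)
  (* (i) *)
  (alpha1_gt0 : forall i j, 0 < aw i j -> 0 < alpha1 i j)
  (alpha1_sym : forall i j, 0 < aw i j -> alpha1 i j = alpha1 j i)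
  (beta1_gt0 : forall i, 0 < beta1 i)
  (* (ii) *)
  (gam_range : forall i j, 0 < aw i j -> 1 / 2 < gam i j <= 1)
  (gam_sym : forall i j, 0 < aw i j -> gam i j = gam j i)
  (nu_gam : forall i j, 0 < aw i j -> nu i j + gam i j <= 1)
  (* the constants h, underline beta, m', a *)
  (h_def : (exists i j, 0 < aw i j /\ h = nu i j / 2 + gam i j) /\
           (forall i j, 0 < aw i j -> h <= nu i j / 2 + gam i j))
  (bmin_def : (exists i, bmin = beta1 i) /\ (forall i, bmin <= beta1 i))
  (m'_def : (exists i j, 0 < aw i j /\ nu i j + gam i j = 1) ->
     (exists i j, [/\ 0 < aw i j, nu i j + gam i j = 1 &
                     m' = alpha1 i j * expR (- l1norm theta / b i j) / b i j]) /\
     (forall i j, 0 < aw i j -> nu i j + gam i j = 1 ->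
                  m' <= alpha1 i j * expR (- l1norm theta / b i j) / b i j))
  (a_def1 : (forall i j, 0 < aw i j -> nu i j + gam i j <> 1) ->
     a = delta * bmin / N%:R)
  (a_def2 : (exists i j, 0 < aw i j /\ nu i j + gam i j = 1) ->
     a = delta * lambda2 (laplacian aw) * bmin * m' /
         (2 * N%:R * n%:R * Hbar ^+ 2 * bmin + N%:R * lambda2 (laplacian aw) * m'))
  : forall i : 'I_N,
    {ae P, forall t,
      let err k := SC_est aw nu b
                     (fun i j k => alpha1 i j / (k%:R `^ gam i j))
                     (fun i k => beta1 i / k%:R)
                     H theta theta0 (fun i k => w i k t) (fun i k => dn i k t) k i
                   - theta in
      [/\ 1 < 2 * h - 2 * a ->
            exists C : R, forall k, (2 <= k)%N -> enorm (err k) <= C * k%:R `^ (- a),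
          2 * h - 2 * a = 1 ->
            exists C : R, forall k, (2 <= k)%N ->
              enorm (err k) <= C * (ln k%:R / k%:R `^ (h - 1 / 2)) &
          2 * h - 2 * a < 1 ->
            exists C : R, forall k, (2 <= k)%N ->
              enorm (err k) <= C * (Num.sqrt (ln k%:R) / k%:R `^ (h - 1 / 2))]}.
Proof.
move=> i; have [n0|n_gt0] := posnP n.
  by apply: aeW => t; split => _; exists 0 => k _; rewrite enorm_dim0// mul0r.
have N_gt1 : (1 < N)%N by have [[i0 [j0 [aij _]]] _] := h_def; exact: edge_card_gt1 aij.
have [[i_min bminE] bmin_le] := bmin_def; have [Z [Z_cond Z_bnd]] := w_mom.
have bmin_gt0 : 0 < bmin by rewrite bminE.
exact: (estimate_rates n_gt0 N_gt1 aw_ge0 aw_sym conn Hbar_gt0 H_bnd p_gt0 delta_gt0 PE bmin_gt0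
  theta0 nu_ge0 nu_sym b_gt0 b_sym alpha1_gt0 alpha1_sym beta1_gt0 bmin_le gam_range gam_sym
  w_meas d_meas rho_gt2 w_int w_mds Z_cond d_lap d_indep nu_gam Z_bnd h_def m'_def a_def1 a_def2 i).
Qed.
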